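(* Let $\mathcal M(R,F)$ be an $Sp(2k)$-type quantum matrix algebra. Then the matrix $M$ of the algebra generators satisfies the Cayley–Hamilton identity $$\sum_{i=0}^{2k} (-q)^i\, M^{\overline{2k-i}}\, \epsilon_i = 0 ,$$ where $$\epsilon_i := \sum_{j=0}^{\lfloor i/2\rfloor} a_{i-2j}\, g^j\quad (0\le i\le k), \qquad \epsilon_{k+i} := \epsilon_{k-i}\, g^{i}\quad (1\le i\le k).$$
   Context: **R-matrices.** $V$ is a finite dimensional $\mathbb C$-vector space, $\dim V=N$, $I$ is the identity operator. For $X\in\mathrm{End}(V^{\otimes k})$, $X_m$ denotes $X$ acting in the tensor factors $m,\dots,m+k-1$ of $V^{\otimes n}$; $X_{ij}$ denotes $X\in \mathrm{End}(V^{\otimes 2})$ acting in factors $i,j$. An R-matrix is $R\in\mathrm{Aut}(V^{\otimes 2})$ with $R_1R_2R_1=R_2R_1R_2$. It is skew invertible if there is $\Psi_R\in\mathrm{End}(V^{\otimes2})$ with $\mathrm{Tr}_{(2)}R_{12}(\Psi_R)_{23}=\mathrm{Tr}_{(2)}(\Psi_R)_{12}R_{23}=P_{13}$, $P$ being the flip. Then $(D_R)_1:=\mathrm{Tr}_{(2)}(\Psi_R)_{12}$; $R$ is strict skew invertible if $D_R$ is invertible. The R-trace of $X\in\mathrm{End}(V)\otimes W$ ($W$ a vector space) is $\mathrm{Tr}_R(X)=\sum_{i,j}(D_R)_i^jX_j^i\in W$; $\mathrm{Tr}_{R^{(i_1,\dots,i_s)}}$ denotes the R-trace taken in the tensor factors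 $i_1,\dots,i_s$. A pair $\{R,F\}$ of R-matrices is compatible if $R_1F_2F_1=F_2F_1R_2$ and $R_2F_1F_2=F_1F_2R_1$. **BMW type.** Let $q\in\mathbb C\setminus\{0,\pm1\}$, $\mu\in\mathbb C\setminus\{0,q,-q^{-1}\}$, $j_q:=(q^j-q^{-j})/(q-q^{-1})$. $R$ is of BMW type if its minimal polynomial gives $(qI-R)(q^{-1}I+R)(\mu I-R)=0$ (third order) and $K:=\mu^{-1}(q-q^{-1})^{-1}(qI-R)(q^{-1}I+R)$ satisfies $K_2K_1=K_2R_1^{\pm1}R_2^{\pm1}$ and $K_1K_2K_1=K_1$. The antisymmetrizers are the operators $\rho_R(a^{(1)})=I$ and $$\rho_R(a^{(i+1)})=\tfrac{q^i}{(i+1)_q}\,\rho_R(a^{(i)})\,R^-_i(q^{-2i})\,\rho_R(a^{(i)}),\qquad R_i^-(x)=I+\tfrac{x-1}{q-q^{-1}}R_i+\tfrac{\mu(x-1)}{\mu+qx}K_i .$$ **$Sp(2k)$ type.** Let $k\ge2$. A skew invertible BMW type R-matrix $R$ is of $Sp(2k)$ type if $\mu=-q^{-1-2k}$ and $R$ has finite height $k$, i.e. $i_q\ne0$ for $i=2,\dots,k$, $\mu\neq -q^{-2i+1}$ for $i=1,\dots,k$, $\rho_R(a^{(i)})\ne0$ for $i=2,\dots,k$, and $\rho_R(a^{(k)})R_k^-(q^{-2k})\rho_R(a^{(k)})=0$. **Quantum matrix algebra.** For a compatible pair $\{R,F\}$, $\mathcal M(R,F)$ is the unital associative $\mathbb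 C$-algebra generated by the entries of $M=\|M_a^b\|_{a,b=1}^N$ modulo $R_1M_{\overline1}M_{\overline2}=M_{\overline1}M_{\overline2}R_1$, where $M_{\overline1}=M_1$, $M_{\overline i}=F_{i-1}M_{\overline{i-1}}F_{i-1}^{-1}$. It is of $Sp(2k)$ type if $R$ is of $Sp(2k)$ type and $F$ is strict skew invertible. Set $a_0=1$, $a_i=\mathrm{Tr}_{R^{(1,\dots,i)}}(M_{\overline1}\cdots M_{\overline i}\,\rho_R(a^{(i)}))$ for $1\le i\le k$, and (2-contraction) $$g=\frac{\mu(q-q^{-1})}{(q-\mu)(q^{-1}+\mu)}\mathrm{Tr}_{R^{(1,2)}}(M_{\overline1}M_{\overline2}K_1).$$ The elements $g,a_i$ commute with one another. Elements of $\mathcal M(R,F)$ written to the right of a matrix multiply all its entries from the right. **$\star$-powers.** $\phi(X)_1=\mathrm{Tr}_{R^{(2)}}(F_1X_1F_1^{-1}R_1)$ for $X\in\mathrm{End}(V)\otimes \mathcal M(R,F)$; $M^{\overline0}=I$, $M^{\overline{m+1}}=M\cdot\phi(M^{\overline m})$, with $\cdot$ the usual matrix product. *)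

(* Defs.v *)
From HB Require Import structures.
From mathcomp Require Import all_boot all_algebra.
From mathcomp Require Import boolp classical_sets.
From mathcomp Require Import monalg.

Set Implicit Arguments.
Unset Strict Implicit.
Unset Printing Implicit Defensive.

Import GRing.Theory.
Local Open Scope ring_scope.
Local Open Scope quotient_scope.

(* V = C^N, and the basis of V^{(x)n} is indexed by the words of length n over
   'I_N.  An element of End(V^{(x)n}) (x) A is a square matrix over A indexed
   by these words.  Tensor factors given by a natural number are numbered from
   1, as in X_1, X_2; those given by an ordinal are numbered from 0. *)
Definition word (N n : nat) : Type := {ffun 'I_n -> 'I_N}.

Definition word_count (N n : nat) : nat := #|{ffun 'I_n -> 'I_N}|.

Notation op A N n := 'M[A]_(word_count N n).

Section TensorOperators.
Variables (N : nat) (A : pzRingType).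

Definition mkop n (f : word N n -> word N n -> A) : op A N n :=
  \matrix_(i, j) f (enum_val i) (enum_val j).

Definition ent n (X : op A N n) (s t : word N n) : A :=
  X (enum_rank s) (enum_rank t).

(* X in End(V^{(x)k}) acting in the factors p 0, ..., p (k - 1) of V^{(x)n} *)
Definition embed k n (p : 'I_k -> 'I_n) (X : op A N k) : op A N n :=
  mkop (fun s t : word N n =>
    if [forall j, (j \notin codom p) ==> (s j == t j)]
    then ent X [ffun i => s (p i)] [ffun i => t (p i)] else 0).

(* X_m acting in the factors m, ..., m + k - 1 of V^{(x)(n.+1)}; meaningful
   only for 0 < m and m + k <= n.+2, outside of which [inord] truncates. *)
Definition at_factor n k (X : op A N k) (m : nat) : op A N n.+1 :=
  embed (fun i : 'I_k => inord (m.-1 + i) : 'I_n.+1) X.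

Definition insert_letter n (i : 'I_n.+1) (c : 'I_N) (s : word N n) :
    word N n.+1 :=
  [ffun j => if unlift i j is Some j' then s j' else c].

Definition ptrace n (i : 'I_n.+1) (X : op A N n.+1) : op A N n :=
  mkop (fun s t => \sum_c ent X (insert_letter i c s) (insert_letter i c t)).

Definition flip : op A N 2 :=
  mkop (fun s t : word N 2 =>
    ((s ord0 == t ord_max) && (s ord_max == t ord0))%:R).

Definition rscale n (X : op A N n) (x : A) : op A N n :=
  map_mx (fun y => y * x) X.

End TensorOperators.

Section RMatrices.
Variables (C : fieldType) (N : nat).
Implicit Types (R F Psi : op C N 2).

Definition Rmatrix R : Prop :=
  R \in unitmx /\
  let R_ := at_factor 2 R in R_ 1 * R_ 2 * R_ 1 = R_ 2 * R_ 1 * R_ 2.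

Definition skew_inverse R Psi : Prop :=
  let R_ := at_factor 2 R in
  let Psi_ := at_factor 2 Psi in
  ptrace (inord 1) (R_ 1 * Psi_ 2) = flip N C /\
  ptrace (inord 1) (Psi_ 1 * R_ 2) = flip N C.

Definition skew_invertible R : Prop := exists Psi, skew_inverse R Psi.

(* The skew inverse is unique when it exists; 0 is a dummy value. *)
Definition Psi_of R : op C N 2 := xget 0 [set Psi | skew_inverse R Psi].

Definition D_of R : op C N 1 := ptrace ord_max (Psi_of R).

Definition strict_skew_invertible R : Prop :=
  skew_invertible R /\ D_of R \in unitmx.

Definition compatible R F : Prop :=
  let R_ := at_factor 2 R in
  let F_ := at_factor 2 F in
  [/\ Rmatrix R, Rmatrix F,
      R_ 1 * F_ 2 * F_ 1 = F_ 2 * F_ 1 * R_ 2 &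
      R_ 2 * F_ 1 * F_ 2 = F_ 1 * F_ 2 * R_ 1].

(* [horner_mx] and [mxminpoly] need a size of the form n.+1 *)
Definition annihilates n (p : {poly C}) (X : 'M[C]_n) : Prop :=
  \sum_(i < size p) p`_i *: X ^+ i = 0.

Definition minimal_polynomial n (p : {poly C}) (X : 'M[C]_n) : Prop :=
  [/\ p \is monic, annihilates p X & forall r, annihilates r X -> p %| r].

End RMatrices.

Section BMW.
Variables (C : fieldType) (N : nat) (q mu : C).

Definition qnum (j : nat) : C := (q ^+ j - q ^- j) / (q - q^-1).

Variable R : op C N 2.

Definition Kmat : op C N 2 :=
  (mu^-1 * (q - q^-1)^-1) *: ((q%:M - R) * (q^-1%:M + R)).

Definition BMW_type : Prop :=
  let R_ := at_factor 2 R in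
  let Rinv_ := at_factor 2 (invmx R) in
  let K_ := at_factor 2 Kmat in
  [/\ [/\ q != 0, q != 1 & q != -1],
      [/\ mu != 0, mu != q & mu != - q^-1],
      Rmatrix R,
      minimal_polynomial (('X - q%:P) * ('X + (q^-1)%:P) * ('X - mu%:P)) R &
      [/\ K_ 2 * K_ 1 = K_ 2 * R_ 1 * R_ 2,
          K_ 2 * K_ 1 = K_ 2 * Rinv_ 1 * Rinv_ 2 &
          K_ 1 * K_ 2 * K_ 1 = K_ 1]].

Definition Rminus n (i : nat) (x : C) : op C N n.+1 :=
  1 + ((x - 1) / (q - q^-1)) *: at_factor n R i
    + (mu * (x - 1) / (mu + q * x)) *: at_factor n Kmat i.

(* rho_R(a^{(i)}) as an operator on V^{(x)(n.+1)}, for 1 <= i <= n.+1 *)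
Fixpoint antisym (n i : nat) : op C N n.+1 :=
  match i with
  | 0 | 1 => 1
  | j.+1 => (q ^+ j / qnum j.+1) *:
              (antisym n j * Rminus n j (q ^- (2 * j)) * antisym n j)
  end.

Definition finite_height (k : nat) : Prop :=
  [/\ forall i, (2 <= i <= k)%N -> qnum i != 0,
      forall i, (1 <= i <= k)%N -> mu != - q ^ (1 - (2 * i)%:Z),
      forall i, (2 <= i <= k)%N -> antisym i.-1 i != 0 &
      antisym k k * Rminus k k (q ^- (2 * k)) * antisym k k = 0].

Definition Sp_type (k : nat) : Prop :=
  [/\ (2 <= k)%N, skew_invertible R, BMW_type,
      mu = - q ^ (-1 - (2 * k)%:Z) & finite_height k].

End BMW.

(* The elements below make sense for any matrix M over any algebra A; they are
   used for the generic matrix of the quantum matrix algebra and, in the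
   relations of that algebra, of the free algebra. *)
Section MatrixElements.
Variables (C : fieldType) (N : nat) (A : algType C).
Variables (q mu : C) (R F : op C N 2) (M : op A N 1).

Definition extend_scalars n (X : op C N n) : op A N n := map_mx (in_alg A) X.

Definition Rtrace n (i : 'I_n.+1) (X : op A N n.+1) : op A N n :=
  mkop (fun s t => \sum_c \sum_d
    ent (D_of R) [ffun=> c] [ffun=> d] *:
      ent X (insert_letter i d s) (insert_letter i c t)).

(* On V^{(x)0}, of dimension 1, \tr is the identification with A. *)
Fixpoint Rtrace_all n : op A N n -> A :=
  match n with
  | 0 => fun X => \tr X
  | n'.+1 => fun X => Rtrace_all (Rtrace ord_max X)
  end.

(* M_{\overline i} on V^{(x)(n.+1)}, for 1 <= i <= n.+1 *)
Fixpoint Mbar (n i : nat) : op A N n.+1 :=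
  match i with
  | 0 | 1 => at_factor n M 1
  | j.+1 => extend_scalars (at_factor n F j) * Mbar n j
              * extend_scalars (at_factor n (invmx F) j)
  end.

Definition Mbar_prod (n i : nat) : op A N n.+1 :=
  \prod_(1 <= j < i.+1) Mbar n j.

Definition qm_a (i : nat) : A :=
  if i is j.+1 then
    Rtrace_all (Mbar_prod j i * extend_scalars (antisym q mu R j i))
  else 1.

Definition qm_g : A :=
  (mu * (q - q^-1) / ((q - mu) * (q^-1 + mu))) *:
    Rtrace_all (Mbar_prod 1 2 * extend_scalars (Kmat q mu R)).

Definition qm_phi (X : op A N 1) : op A N 1 :=
  Rtrace ord_max
    (extend_scalars F * at_factor 1 X 1 * extend_scalars (invmx F)
       * extend_scalars R).

Fixpoint star_pow (m : nat) : op A N 1 :=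
  if m is m'.+1 then M * qm_phi (star_pow m') else 1.

Definition qm_eps_low (i : nat) : A :=
  \sum_(j < i./2.+1) qm_a (i - 2 * j) * qm_g ^+ j.

Definition qm_eps (k i : nat) : A :=
  if (i <= k)%N then qm_eps_low i
  else qm_eps_low (2 * k - i) * qm_g ^+ (i - k).

(* R_1 M_{\overline 1} M_{\overline 2} - M_{\overline 1} M_{\overline 2} R_1 *)
Definition qm_relator : op A N 2 :=
  extend_scalars R * Mbar_prod 1 2 - Mbar_prod 1 2 * extend_scalars R.

End MatrixElements.

Section MatrixElementsMorphism.
Variables (C : fieldType) (N : nat) (A B : algType C).
Variables (f : {lrmorphism A -> B}) (R F : op C N 2) (M : op A N 1).

Fact map_extend_scalars n (X : op C N n) :
  map_mx f (extend_scalars A X) = extend_scalars B X.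
Proof.
by apply/matrixP => i j; rewrite !mxE /= linearZ rmorph1.
Qed.

Fact map_at_factor n m :
  map_mx f (at_factor n M m) = at_factor n (map_mx f M) m.
Proof.
apply/matrixP => s t; rewrite !mxE; case: ifP => _; last exact: rmorph0.
by rewrite /ent !mxE.
Qed.

Fact map_Mbar n i : map_mx f (Mbar F M n i) = Mbar F (map_mx f M) n i.
Proof.
elim: i => [|[|i] IHi] /=; try exact: map_at_factor.
rewrite [LHS](map_mxM f) [X in X *m _](map_mxM f).
by rewrite !map_extend_scalars IHi.
Qed.

Fact map_Mbar_prod n i :
  map_mx f (Mbar_prod F M n i) = Mbar_prod F (map_mx f M) n i.
Proof.
rewrite /Mbar_prod; elim: i => [|i IHi]; first by rewrite !big_geq // map_mx1.
rewrite [in LHS]big_nat_recr // [in RHS]big_nat_recr //.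
by rewrite [LHS](map_mxM f) IHi map_Mbar.
Qed.

Fact map_qm_relator :
  map_mx f (qm_relator R F M) = qm_relator R F (map_mx f M).
Proof.
rewrite /qm_relator map_mxB [X in X - _](map_mxM f) [X in _ - X](map_mxM f).
by rewrite !map_extend_scalars map_Mbar_prod.
Qed.

End MatrixElementsMorphism.

Section FreeAlgebra.
Variables (C : fieldType) (N : nat).

Definition free_alg : Type := {malg C[{fmonom ('I_N * 'I_N)%type}]}.

HB.instance Definition _ := GRing.Lalgebra.on free_alg.

Fact free_alg_scaleAr (c : C) (x y : free_alg) : c *: (x * y) = x * (c *: y).
Proof.
have mulC z : z * c%:MP = c *: z :> free_alg.
  rewrite malgM_def fgmulgU malgZ_def; apply: eq_bigr => k _.
  by rewrite mulm1 mulrC.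
by rewrite -(mul_malgC c y) mulrA mulC scalerAl.
Qed.

HB.instance Definition _ :=
  GRing.Lalgebra_isAlgebra.Build C free_alg free_alg_scaleAr.

(* used to prove that 1 != 0 in the quotient *)
Definition free_augm : {rmorphism free_alg -> C} :=
  @mcoeff {fmonom ('I_N * 'I_N)%type} C mone.

Definition free_gen (a b : 'I_N) : free_alg := << fmu (a, b) >>%R.

Definition free_mat : op free_alg N 1 :=
  mkop (fun s t : word N 1 => free_gen (s ord0) (t ord0)).

End FreeAlgebra.

(* M(R,F) is the quotient of the free algebra by the two-sided ideal generated
   by the entries of [qm_relator]. *)
Section QuantumMatrixAlgebra.
Variables (C : fieldType) (N : nat) (R F : op C N 2).
Local Notation FA := (free_alg C N).

Inductive qma_ideal : FA -> Prop :=
  | qma_ideal_rel i j : qma_ideal (qm_relator R F (free_mat C N) i j)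
  | qma_ideal0 : qma_ideal 0
  | qma_idealB x y : qma_ideal x -> qma_ideal y -> qma_ideal (x - y)
  | qma_idealMl a x : qma_ideal x -> qma_ideal (a * x)
  | qma_idealMr a x : qma_ideal x -> qma_ideal (x * a).

Definition qma_ideal_pred : {pred FA} := fun x => `[< qma_ideal x >].

Fact qma_ideal_zmod_closed : zmod_closed qma_ideal_pred.
Proof.
split=> [|x y /asboolP Ix /asboolP Iy]; apply/asboolP; first exact: qma_ideal0.
exact: qma_idealB.
Qed.

HB.instance Definition _ :=
  GRing.isZmodClosed.Build FA qma_ideal_pred qma_ideal_zmod_closed.

Definition QMA : Type := Quotient.quot qma_ideal_pred.

HB.instance Definition _ := ZmodQuotient.on QMA.

Local Notation pi := (\pi_(QMA) : FA -> QMA).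

Fact qma_piP (x y : FA) : pi x = pi y <-> qma_ideal (x - y).
Proof.
split=> [|I]; first by move/eqP; rewrite -Quotient.idealrBE => /asboolP.
by apply/eqP; rewrite -Quotient.idealrBE; apply/asboolP.
Qed.

Definition qma_one : QMA := pi 1.
Definition qma_mul : QMA -> QMA -> QMA := lift_op2 QMA *%R.
Definition qma_scale (c : C) : QMA -> QMA := lift_op1 QMA ( *:%R c).

Fact qma_repr (x : FA) : qma_ideal (repr (pi x) - x).
Proof. by apply/qma_piP; rewrite reprK. Qed.

Fact qma_piM (x y : FA) : qma_mul (pi x) (pi y) = pi (x * y).
Proof.
unlock qma_mul; apply/qma_piP; set x' := repr _; set y' := repr _.
have -> : x' * y' - x * y = x' * (y' - y) - (- (x' - x)) * y.
  by rewrite mulrBr mulNr opprK mulrBl addrA subrK.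
apply: qma_idealB; first exact/qma_idealMl/qma_repr.
apply: qma_idealMr; rewrite -sub0r; apply: qma_idealB; first exact: qma_ideal0.
exact: qma_repr.
Qed.

Fact qma_piZ (c : C) (x : FA) : qma_scale c (pi x) = pi (c *: x).
Proof.
unlock qma_scale; apply/qma_piP; rewrite -scalerBr -[_ - x]mul1r scalerAl.
exact/qma_idealMl/qma_repr.
Qed.

Fact qma_piD (x y : FA) : pi (x + y) = pi x + pi y.
Proof. by rewrite piE. Qed.

Fact qma_ideal_augm (x : FA) : qma_ideal x -> free_augm C N x = 0.
Proof.
elim=> [i j||y z _ y0 _ z0|a y _ y0|y a _ y0].
- set aug := free_augm C N.
  have M0 : map_mx aug (at_factor 1 (free_mat C N) 1) = 0.
    apply/matrixP => s t; rewrite !mxE; case: ifP => _; last exact: rmorph0.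
    by rewrite /ent !mxE /aug /= mcoeffU fmP fmuE fm1.
  have P0 : map_mx aug (Mbar_prod F (free_mat C N) 1 2) = 0.
    rewrite /Mbar_prod big_ltn // [LHS](map_mxM aug) M0; exact: mul0mx.
  have : map_mx aug (qm_relator R F (free_mat C N)) = 0.
    rewrite /qm_relator map_mxB [X in X - _](map_mxM aug).
    rewrite [X in _ - X](map_mxM aug) P0.
    by rewrite mulmx0 mul0mx subr0.
  by move/matrixP/(_ i j); rewrite mxE [RHS]mxE.
- exact: rmorph0.
- by rewrite rmorphB y0 z0 subr0.
- by rewrite rmorphM y0 mulr0.
- by rewrite rmorphM y0 mul0r.
Qed.

Fact qma_mulA : associative qma_mul.
Proof.
by move=> x y z; rewrite -[x]reprK -[y]reprK -[z]reprK !qma_piM mulrA.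
Qed.

Fact qma_mul1 : left_id qma_one qma_mul.
Proof. by move=> x; rewrite -[x]reprK qma_piM mul1r. Qed.

Fact qma_mulr1 : right_id qma_one qma_mul.
Proof. by move=> x; rewrite -[x]reprK qma_piM mulr1. Qed.

Fact qma_mulDl : left_distributive qma_mul +%R.
Proof.
move=> x y z; rewrite -[x]reprK -[y]reprK -[z]reprK.
by rewrite -qma_piD !qma_piM mulrDl qma_piD.
Qed.

Fact qma_mulDr : right_distributive qma_mul +%R.
Proof.
move=> x y z; rewrite -[x]reprK -[y]reprK -[z]reprK.
by rewrite -qma_piD !qma_piM mulrDr qma_piD.
Qed.

Fact qma_one_neq0 : qma_one != 0.
Proof.
have -> : 0 = pi 0 by rewrite piE.
apply/eqP => /qma_piP /qma_ideal_augm /eqP.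
by rewrite subr0 rmorph1 oner_eq0.
Qed.

HB.instance Definition _ := GRing.Zmodule_isNzRing.Build QMA
  qma_mulA qma_mul1 qma_mulr1 qma_mulDl qma_mulDr qma_one_neq0.

Fact qma_scaleA (a b : C) (x : QMA) :
  qma_scale a (qma_scale b x) = qma_scale (a * b) x.
Proof. by rewrite -[x]reprK !qma_piZ scalerA. Qed.

Fact qma_scale1 : left_id 1 qma_scale.
Proof. by move=> x; rewrite -[x]reprK qma_piZ scale1r. Qed.

Fact qma_scaleDr : right_distributive qma_scale +%R.
Proof.
move=> c x y; rewrite -[x]reprK -[y]reprK.
by rewrite -qma_piD !qma_piZ scalerDr qma_piD.
Qed.

Fact qma_scaleDl (x : QMA) : {morph qma_scale^~ x : a b / a + b}.
Proof. by move=> a b; rewrite -[x]reprK !qma_piZ scalerDl qma_piD. Qed.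

HB.instance Definition _ := GRing.Zmodule_isLmodule.Build C QMA
  qma_scaleA qma_scale1 qma_scaleDr qma_scaleDl.

Fact qma_scaleAl (c : C) (x y : QMA) : c *: (x * y) = (c *: x) * y.
Proof.
rewrite -[x]reprK -[y]reprK.
rewrite [LHS](congr1 (qma_scale c) (qma_piM _ _)).
by rewrite [RHS](congr1 (qma_mul^~ _) (qma_piZ _ _)) qma_piZ qma_piM scalerAl.
Qed.

HB.instance Definition _ := GRing.Lmodule_isLalgebra.Build C QMA qma_scaleAl.

Fact qma_scaleAr (c : C) (x y : QMA) : c *: (x * y) = x * (c *: y).
Proof.
rewrite -[x]reprK -[y]reprK.
rewrite [LHS](congr1 (qma_scale c) (qma_piM _ _)).
by rewrite [RHS](congr1 (qma_mul _) (qma_piZ _ _)) qma_piZ qma_piM scalerAr.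
Qed.

HB.instance Definition _ := GRing.Lalgebra_isAlgebra.Build C QMA qma_scaleAr.

Definition qma_pi_fun (x : FA) : QMA := pi x.

Fact qma_pi_zmod_morphism : zmod_morphism qma_pi_fun.
Proof. by move=> x y; rewrite /qma_pi_fun piE. Qed.

Fact qma_pi_monoid_morphism : monoid_morphism qma_pi_fun.
Proof. by split=> // x y; rewrite /qma_pi_fun -qma_piM. Qed.

Fact qma_pi_scalable : scalable qma_pi_fun.
Proof. by move=> c x; rewrite /qma_pi_fun -qma_piZ. Qed.

HB.instance Definition _ :=
  GRing.isZmodMorphism.Build FA QMA qma_pi_fun qma_pi_zmod_morphism.
HB.instance Definition _ :=
  GRing.isMonoidMorphism.Build FA QMA qma_pi_fun qma_pi_monoid_morphism.
HB.instance Definition _ :=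
  GRing.isScalable.Build C FA QMA *:%R qma_pi_fun qma_pi_scalable.

Definition qma_pi : {lrmorphism FA -> QMA} := qma_pi_fun.

Definition QMA_mat : op QMA N 1 := map_mx qma_pi (free_mat C N).

Lemma QMA_relation : qm_relator R F QMA_mat = 0.
Proof.
rewrite /QMA_mat -map_qm_relator; apply/matrixP => i j; rewrite mxE [RHS]mxE.
rewrite -(rmorph0 qma_pi); apply/qma_piP; rewrite subr0.
exact: qma_ideal_rel.
Qed.

End QuantumMatrixAlgebra.

Definition Sp_type_QMA (C : fieldType) (N : nat) (q mu : C)
    (R F : op C N 2) (k : nat) : Prop :=
  [/\ compatible R F, Sp_type q mu R k & strict_skew_invertible F].

(* Main.v *)
Require Import Defs.
From HB Require Import structures.
From mathcomp Require Import all_boot all_algebra.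
From mathcomp Require Import classical_sets reals complex.
From mathcomp Require Import zify ring.

(** Write r_i, k_i, f_i for R, K, F acting in the factors (the strands) i, i+1
of a long tensor power of V.  The proof takes place in the algebra of operators
on this power with entries in the quantum matrix algebra, and uses only what
the record [tower] collects: the Birman-Murakami-Wenzl (BMW) relations of the r
and k, the mixed braid relations with the f, the subalgebras of operators that
live in the first i strands, and the partial R-traces T.

The R-traces enter through one equation: if x lives in the first i+1 strands,
then k_(i+1) x k_(i+1) = mu^-1 T_(i+1)(x) k_(i+1).  It holds because K is a
matrix of rank one, u(s) v(t), whose contraction over the second letter is
mu^-1 D_R; both facts come from contracting BMW relations with the skew
inverse of R ([rank_one], [trace_weight], [KXK]).  Since x k_(i+1) = 0 forces
x = 0 for x in the first i strands, the equation determines the traces, and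
all their properties, cyclicity included ([cyclic_r]), follow from BMW
relations.

The star power X_m of M is the trace over the strands 2, ..., m of
M_1 ... M_m r_(m-1) ... r_1 ([Xp_rec]).  Two families of matrices interpolate
between the X_m a_i.  In both, all strands but the first are traced:
A(m,i) is obtained from M_1 ... M_(m+i-1) a^(i) r_(m-1) ... r_1 with the
antisymmetrizer on the strands m, ..., m+i-1, and B(m,i) from
M_1 ... M_(m+i) k_m r_(m-1) ... r_1 a^(i) with the antisymmetrizer on the
strands m+1, ..., m+i ([qA], [qB]).  The antisymmetrizer a^(i+1) is a product
a^(i) R^-(x) a^(i), where R^-(x) has the three terms 1, r and k.  Accordingly
A(m,i+1) is a combination of X_m a_i, A(m+1,i) and B(m,i) ([qA_rec]).  In the
same way B(m,i+1) is a combination of X_(m-1) a_i g, A(m,i) g and B(m-1,i) g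
([qB_rec]): here k_m absorbs two of the M's, as
M_m M_(m+1) k_m = mu^-2 k_m g, and the k's then unwind around the trace.

With A(m,1) = X_m and B(m,1) = mu^-1 X_(m-1) g these recursions have an
explicit solution in terms of truncated Cayley-Hamilton sums ([AB_closed]).
The height condition on R says that the right-hand side which would define
A(k,k+1) vanishes ([top_flip] moves it to the strands where it is needed), and
mu = - q^(-1-2k) gives the two sums of the solution equal weights, so that they
add up to the sum over all 2k+1 terms ([eps_sum]). *)

Set Implicit Arguments.
Unset Strict Implicit.
Unset Printing Implicit Defensive.
Import GRing.Theory.
Local Open Scope ring_scope.

(** * Local relations of the Birman-Murakami-Wenzl algebra *)

Lemma cancelL (H : pzRingType) (x y a b : H) : y * x = 1 -> x * a = x * b -> a = b.
Proof. by move=> yx e; rewrite -[a]mul1r -[b]mul1r -yx -!mulrA e. Qed.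

Lemma cancelR (H : pzRingType) (x y a b : H) : x * y = 1 -> a * x = b * x -> a = b.
Proof. by move=> yx e; rewrite -[a]mulr1 -[b]mulr1 -yx !mulrA e. Qed.

Section LocalRelations.
Variables (C : fieldType) (H : algType C) (q mu lam : C).
Implicit Types (r k : H).

(** The loop value: the scalar by which k * k is a multiple of k. *)
Definition loop_val : C := (q - mu) * (q^-1 + mu) / (mu * lam).

(** The Kauffman skein relation r - r^-1 = lam (1 - k) solved for r^-1.  Throughout,
[lam] is a name for q - q^-1. *)
Definition skein_inv r k : H := r - lam *: (1 - k).

Record bmw_gen r k : Prop := BmwGen {
  bmw_rV : r * skein_inv r k = 1;
  bmw_Vr : skein_inv r k * r = 1;
  bmw_rk : r * k = mu *: k;
  bmw_kr : k * r = mu *: k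
}.

(** A list of the relations of two neighbouring strands that is closed under their
exchange; [bmw_adjI] derives it from a few of them. *)
Record bmw_adj r1 k1 r2 k2 : Prop := BmwAdj {
  adj_gen1 : bmw_gen r1 k1;
  adj_gen2 : bmw_gen r2 k2;
  adj_braid : r1 * r2 * r1 = r2 * r1 * r2;
  adj_krr12 : k1 * r2 * r1 = k1 * k2;
  adj_krr21 : k2 * r1 * r2 = k2 * k1;
  adj_rrk12 : r2 * r1 * k2 = k1 * k2;
  adj_rrk21 : r1 * r2 * k1 = k2 * k1;
  adj_kkk12 : k1 * k2 * k1 = k1;
  adj_kkk21 : k2 * k1 * k2 = k2;
  adj_rkk12 : r2 * k1 * k2 = skein_inv r1 k1 * k2;
  adj_rkk21 : r1 * k2 * k1 = skein_inv r2 k2 * k1;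
  adj_kkr12 : k1 * k2 * r1 = k1 * skein_inv r2 k2;
  adj_kkr21 : k2 * k1 * r2 = k2 * skein_inv r1 k1
}.

Lemma bmw_adjC r1 k1 r2 k2 : bmw_adj r1 k1 r2 k2 -> bmw_adj r2 k2 r1 k1.
Proof. by case=> *; split. Qed.

Hypotheses (lamE : lam = q - q^-1) (mu0 : mu != 0) (lam0 : lam != 0).

Lemma q_neq0 : q != 0.
Proof. by apply: contraNneq lam0; rewrite lamE => ->; rewrite invr0 subr0. Qed.

Lemma qq1_neq0 : q * q - 1 != 0.
Proof.
have q0 := q_neq0.
have -> : q * q - 1 = q * lam by rewrite lamE mulrBr mulfV.
by rewrite mulf_neq0.
Qed.

Section Gen.
Variables (r k : H) (g : bmw_gen r k).

Lemma skein_k : skein_inv r k * k = mu^-1 *: k.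
Proof.
apply: (cancelL (bmw_Vr g)).
by rewrite mulrA (bmw_rV g) mul1r -scalerAr (bmw_rk g) scalerA mulVf // scale1r.
Qed.

Lemma bmw_kkE : k * k = loop_val *: k.
Proof.
have q0 := q_neq0.
have := skein_k; rewrite /skein_inv mulrBl (bmw_rk g) -scalerAl mulrBl mul1r.
rewrite scalerBr => e.
have -> : k * k = lam^-1 *: (lam *: (k * k)) by rewrite scalerA mulVf // scale1r.
have -> : lam *: (k * k) = (mu^-1 - mu + lam) *: k.
  by rewrite scalerDl scalerBl -e opprB [_ + (_ - _)]addrC addrK subrK.
rewrite scalerA; congr (_ *: _); rewrite /loop_val lamE; field.
by rewrite mu0 q0 qq1_neq0.
Qed.

Lemma bmw_k_skein : k = 1 - lam^-1 *: (r - skein_inv r k).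
Proof.
by rewrite /skein_inv opprB addrCA subrr addr0 scalerA mulVf // scale1r subKr.
Qed.

Lemma bmw_rrE : r * r = 1 + lam *: r - (lam * mu) *: k.
Proof.
have := bmw_rV g; rewrite {1}/skein_inv mulrBr -scalerAr mulrBr mulr1 (bmw_rk g).
move/eqP; rewrite subr_eq => /eqP ->.
by rewrite scalerBr scalerA addrA.
Qed.

Lemma skein_absorb a : r * a = - q^-1 *: a -> skein_inv r k * a = - q *: a.
Proof.
move=> e; apply: (cancelL (bmw_Vr g)).
rewrite mulrA (bmw_rV g) mul1r -scalerAr e scalerA mulrNN mulfV ?scale1r //.
exact: q_neq0.
Qed.

Lemma k_absorb a : r * a = - q^-1 *: a -> k * a = 0.
Proof.
move=> e; rewrite bmw_k_skein mulrBl mul1r -scalerAl mulrBl e skein_absorb //.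
rewrite -scalerBl scalerA opprK [- _ + q]addrC -lamE mulVf // scale1r subrr //.
Qed.

End Gen.

Lemma skein_intertwine r1 k1 r2 k2 w : bmw_gen r1 k1 -> bmw_gen r2 k2 ->
  w * r1 = r2 * w -> w * skein_inv r1 k1 = skein_inv r2 k2 * w.
Proof.
move=> g1 g2 e; apply: (cancelR (bmw_rV g1)).
rewrite -mulrA (bmw_Vr g1) mulr1 -mulrA e.
by rewrite mulrA (bmw_Vr g2) mul1r.
Qed.

(** k is a linear combination of 1, r and r^-1. *)
Lemma k_intertwine r1 k1 r2 k2 w : bmw_gen r1 k1 -> bmw_gen r2 k2 ->
  w * r1 = r2 * w -> w * k1 = k2 * w.
Proof.
move=> g1 g2 e; have e' := skein_intertwine g1 g2 e.
rewrite (bmw_k_skein r1 k1) (bmw_k_skein r2 k2) mulrBr mulrBl mulr1 mul1r.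
by rewrite -scalerAr -scalerAl mulrBr mulrBl e e'.
Qed.

(** By [k_intertwine], r1 r2 carries k1 to k2 and the half twist r1 r2 r1 exchanges
k1 and k2.  The first fact turns each given relation into its mirror image, the
second one exchanges the two strands. *)
Lemma bmw_adjI r1 k1 r2 k2 :
  bmw_gen r1 k1 -> bmw_gen r2 k2 -> r1 * r2 * r1 = r2 * r1 * r2 ->
  k2 * k1 = k2 * r1 * r2 ->
  k2 * k1 = k2 * skein_inv r1 k1 * skein_inv r2 k2 ->
  k1 * k2 * k1 = k1 -> bmw_adj r1 k1 r2 k2.
Proof.
move=> g1 g2 br kk kk' kkk.
have br12 : r1 * r2 * r1 = r2 * (r1 * r2) by rewrite mulrA.
have br21 : r2 * r1 * r2 = r1 * (r2 * r1) by rewrite mulrA.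
have c12 := k_intertwine g1 g2 br12.
have c21 := k_intertwine g2 g1 br21.
set i1 := skein_inv r1 k1 in kk' *; set i2 := skein_inv r2 k2 in kk' *.
have [r1V V1r r2V V2r] : [/\ r1 * i1 = 1, i1 * r1 = 1, r2 * i2 = 1 & i2 * r2 = 1].
  by case: g1; case: g2.
have K1 x : r1 * (i1 * x) = x by rewrite mulrA r1V mul1r.
have K1' x : i1 * (r1 * x) = x by rewrite mulrA V1r mul1r.
have K2 x : r2 * (i2 * x) = x by rewrite mulrA r2V mul1r.
have K2' x : i2 * (r2 * x) = x by rewrite mulrA V2r mul1r.
have bri : i1 * i2 * r1 = r2 * (i1 * i2).
  apply: (cancelL V1r); apply: (cancelL V2r).
  by rewrite -!mulrA K1 K2 [RHS]mulrA [RHS]mulrA -br -!mulrA K1 r2V mulr1.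
have bri' : i2 * i1 * r2 = r1 * (i2 * i1).
  apply: (cancelL V2r); apply: (cancelL V1r).
  by rewrite -!mulrA K2 K1 [RHS]mulrA [RHS]mulrA br -!mulrA K2 r1V mulr1.
have d12 := k_intertwine g1 g2 bri.
have rrk21 : r1 * r2 * k1 = k2 * k1 by rewrite c12 kk mulrA.
have iik21 : i1 * i2 * k1 = k2 * k1 by rewrite d12 kk' mulrA.
have kkk21 : k2 * k1 * k2 = k2.
  have D : r1 * r2 * r1 * k1 = k2 * (r1 * r2 * r1).
    by apply: (k_intertwine g1 g2); rewrite !mulrA -br.
  have D' : r1 * r2 * r1 * k2 = k1 * (r1 * r2 * r1).
    by apply: (k_intertwine g2 g1); rewrite {2}br !mulrA.
  have VD : i1 * (i2 * i1) * (r1 * r2 * r1) = 1.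
    by rewrite -!mulrA K1' K2' V1r.
  apply: (@cancelR _ (r1 * r2 * r1) (i1 * (i2 * i1))).
    by rewrite -!mulrA K1 K2 r1V.
  move: (r1 * r2 * r1) D D' => w D D'.
  rewrite -[LHS]mulrA -D [LHS]mulrA -[_ * w]mulrA -D' [k2 * (w * _)]mulrA -D.
  by rewrite -!mulrA [k1 * _]mulrA kkk.
have rrk12 : r2 * r1 * k2 = k1 * k2.
  by rewrite -{1}kkk21 -iik21 -!mulrA K1 K2.
have iik12 : i2 * i1 * k2 = k1 * k2.
  by rewrite -{1}kkk21 -rrk21 -!mulrA K1' K2'.
have d21 := k_intertwine g2 g1 bri'.
split=> //.
- by rewrite -rrk12 c21 mulrA.
- by rewrite -mulrA -iik12 -!mulrA K2.
- by rewrite -mulrA -iik21 -!mulrA K1.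
- by rewrite -iik12 d21 -!mulrA V1r mulr1.
- by rewrite kk' -!mulrA V2r mulr1.
Qed.

Lemma bmw_krk r1 k1 r2 k2 : bmw_adj r1 k1 r2 k2 -> k2 * r1 * k2 = mu^-1 *: k2.
Proof.
move=> a; have e : mu *: (k2 * r1 * k2) = k2.
  rewrite -[RHS](adj_kkk21 a) -(adj_krr21 a) -[in RHS]mulrA (bmw_rk (adj_gen2 a)).
  by rewrite -scalerAr.
by rewrite -[in RHS]e scalerA mulVf // scale1r.
Qed.

(** The coefficients of r and k in the baxterized generator [Rm], the operator
R^-(x) of the recursion for antisymmetrizers. *)
Definition Rm_r (x : C) : C := (x - 1) / lam.
Definition Rm_k (x : C) : C := mu * (x - 1) / (mu + q * x).
Definition Rm r k (x : C) : H := 1 + Rm_r x *: r + Rm_k x *: k.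

Section SixTerms.
Variable v : nat -> H.

(** Linear combinations of six fixed vectors: an identity between them is checked
coefficient by coefficient, each time by [field]. *)
Definition lin (c0 c1 c2 c3 c4 c5 : C) : H :=
  c0 *: v 0 + c1 *: v 1 + c2 *: v 2 + c3 *: v 3 + c4 *: v 4 + c5 *: v 5.

Lemma linD c0 c1 c2 c3 c4 c5 d0 d1 d2 d3 d4 d5 :
  lin c0 c1 c2 c3 c4 c5 + lin d0 d1 d2 d3 d4 d5 =
  lin (c0 + d0) (c1 + d1) (c2 + d2) (c3 + d3) (c4 + d4) (c5 + d5).
Proof.
rewrite /lin !scalerDl; do 5 (rewrite [LHS]addrACA; congr (_ + _)).
Qed.

Lemma linZ x c0 c1 c2 c3 c4 c5 :
  x *: lin c0 c1 c2 c3 c4 c5 =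
  lin (x * c0) (x * c1) (x * c2) (x * c3) (x * c4) (x * c5).
Proof. by rewrite /lin !scalerDr !scalerA. Qed.

Lemma eq_lin c0 c1 c2 c3 c4 c5 d0 d1 d2 d3 d4 d5 :
  c0 = d0 -> c1 = d1 -> c2 = d2 -> c3 = d3 -> c4 = d4 -> c5 = d5 ->
  lin c0 c1 c2 c3 c4 c5 = lin d0 d1 d2 d3 d4 d5.
Proof. by move=> -> -> -> -> -> ->. Qed.

End SixTerms.

Section Fusion.
Variables (r1 k1 r2 k2 a : H) (adj : bmw_adj r1 k1 r2 k2).
Hypothesis (r1a : r1 * a = - q^-1 *: a).

Let v (i : nat) : H :=
  match i with
  | 0 => a | 1 => r2 * a | 2 => k2 * a
  | 3 => r1 * (r2 * a) | 4 => r1 * (k2 * a) | _ => k1 * (k2 * a)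
  end.

Local Notation lin := (lin v).

(** A consequence of the Yang-Baxter equation for [Rm].  If r1 a = - q^-1 a, then
a, r2 a, k2 a, r1 r2 a, r1 k2 a and k1 k2 a span a space stable under r2 which
contains the vectors at hand, and the claim becomes six rational identities. *)
Lemma fusion_key x : mu + q * x != 0 -> mu + x / q != 0 ->
  (r2 + q^-1 *: 1) * (Rm r1 k1 x * (Rm r2 k2 (x / (q * q)) * a)) = 0.
Proof.
move=> nz nz'.
have q0 := q_neq0.
have k1a : k1 * a = 0 by apply: k_absorb r1a; apply: adj_gen1 adj.
have E1 : k1 * (r2 * a) = lin 0 0 0 0 0 (- q).
  have -> : a = - q *: (r1 * a) by rewrite r1a scalerA mulrNN mulfV // scale1r.
  rewrite -!scalerAr !mulrA (adj_krr12 adj) /lin /v !scale0r !add0r.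
  by rewrite mulrA.
have E0 : r1 * a = lin (- q^-1) 0 0 0 0 0 by rewrite /lin !scale0r !addr0.
have vE0 : a = lin 1 0 0 0 0 0 by rewrite /lin !scale0r !addr0 scale1r.
have vE1 : r2 * a = lin 0 1 0 0 0 0 by rewrite /lin !scale0r !addr0 scale1r add0r.
have vE2 : k2 * a = lin 0 0 1 0 0 0.
  by rewrite /lin !scale0r !addr0 scale1r !add0r.
have vE3 : r1 * (r2 * a) = lin 0 0 0 1 0 0.
  by rewrite /lin !scale0r !addr0 scale1r !add0r.
have vE4 : r1 * (k2 * a) = lin 0 0 0 0 1 0.
  by rewrite /lin !scale0r !addr0 scale1r !add0r.
have vE5 : k1 * (k2 * a) = lin 0 0 0 0 0 1.
  by rewrite /lin !scale0r scale1r !add0r.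
have F1 : r2 * (r2 * a) = lin 1 lam (- (lam * mu)) 0 0 0.
  rewrite mulrA (bmw_rrE (adj_gen2 adj)) mulrBl mulrDl mul1r -!scalerAl.
  by rewrite /lin /v !scale0r !addr0 scale1r scaleNr.
have F2 : r2 * (k2 * a) = lin 0 0 mu 0 0 0.
  by rewrite mulrA (bmw_rk (adj_gen2 adj)) -scalerAl vE2 linZ !mulr0 mulr1.
have F3 : r2 * (r1 * (r2 * a)) = lin 0 0 0 (- q^-1) 0 0.
  rewrite !mulrA -(adj_braid adj) -!mulrA r1a -!scalerAr vE3 linZ.
  by rewrite !mulr0 mulr1.
have F4 : r2 * (r1 * (k2 * a)) = lin 0 0 0 0 0 1.
  by rewrite !mulrA (adj_rrk12 adj) -!mulrA.
have F5 : r2 * (k1 * (k2 * a)) = lin 0 0 (- lam) 0 1 lam.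
  rewrite !mulrA (adj_rkk12 adj) /skein_inv !mulrBl -!scalerAl !mulrBl mul1r.
  rewrite scalerBr opprB addrC -!mulrA /lin /v !scale0r scale1r scaleNr.
  by rewrite !add0r addr0 -addrA addrC.
set y := Rm_r x; set z := Rm_k x; pose b := Rm_r (x / (q * q)); pose c := Rm_k (x / (q * q)).
have -> : Rm r2 k2 (x / (q * q)) * a = lin 1 b c 0 0 0.
  by rewrite /Rm !mulrDl -!scalerAl mul1r /lin !scale0r !addr0 scale1r.
have -> : Rm r1 k1 x * lin 1 b c 0 0 0 =
  lin (1 - y / q) b c (y * b) (y * c) (z * (c - q * b)).
  rewrite /Rm !mulrDl -!scalerAl mul1r {2 3}/lin !scale0r !addr0 scale1r !mulrDr.
  rewrite -!scalerAr E0 k1a E1 vE3 vE4 vE5 add0r !linZ !linD !linZ !linD.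
  by apply: eq_lin; rewrite /y /z; ring.
have HL c0 c1 c2 c3 c4 c5 : r2 * lin c0 c1 c2 c3 c4 c5 =
    c0 *: lin 0 1 0 0 0 0 + c1 *: lin 1 lam (- (lam * mu)) 0 0 0
    + c2 *: lin 0 0 mu 0 0 0 + c3 *: lin 0 0 0 (- q^-1) 0 0
    + c4 *: lin 0 0 0 0 0 1 + c5 *: lin 0 0 (- lam) 0 1 lam.
  by rewrite {1}/lin !mulrDr -!scalerAr -F1 -F2 -F3 -F4 -F5 -vE1.
rewrite mulrDl -scalerAl mul1r HL !linZ !linD.
transitivity (lin 0 0 0 0 0 0); last by rewrite /lin !scale0r !addr0.
have qq := qq1_neq0.
have nz2 : mu * q + x != 0.
  by apply: contra nz' => /eqP e; rewrite -[mu](mulfK q0) -mulrDl e mul0r.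
by apply: eq_lin; rewrite /b /c /y /z /Rm_r /Rm_k lamE; field; rewrite ?q0 ?qq ?nz ?nz2.
Qed.

End Fusion.

Lemma fusion_base r k : bmw_gen r k -> mu + q^-1 != 0 ->
  (r + q^-1 *: 1) * Rm r k ((q * q)^-1) = 0.
Proof.
move=> g nz; have q0 := q_neq0; have qq := qq1_neq0.
have nz2 : mu * q + 1 != 0.
  by apply: contra nz => /eqP e; rewrite -[mu](mulfK q0) -[X in _ + X]mul1r -mulrDl e mul0r.
pose v i := match i with 0 => 1 | 1 => r | 2 => k | _ => 0 end : H.
have E : Rm r k ((q * q)^-1) = lin v 1 (Rm_r ((q * q)^-1)) (Rm_k ((q * q)^-1)) 0 0 0.
  by rewrite /lin !scale0r !addr0 scale1r.
have E1 : r * 1 = lin v 0 1 0 0 0 0 by rewrite /lin !scale0r !addr0 add0r scale1r mulr1.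
have E2 : r * r = lin v 1 lam (- (lam * mu)) 0 0 0.
  by rewrite (bmw_rrE g) /lin !scale0r !addr0 scale1r scaleNr.
have E3 : r * k = lin v 0 0 mu 0 0 0.
  by rewrite (bmw_rk g) /lin !scale0r !addr0 !add0r.
have HL c0 c1 c2 : r * lin v c0 c1 c2 0 0 0 = c0 *: lin v 0 1 0 0 0 0
    + c1 *: lin v 1 lam (- (lam * mu)) 0 0 0 + c2 *: lin v 0 0 mu 0 0 0.
  by rewrite -E1 -E2 -E3 /lin !scale0r !addr0 !mulrDr -!scalerAr.
rewrite mulrDl -scalerAl mul1r E HL !linZ !linD.
transitivity (lin v 0 0 0 0 0 0); last by rewrite /lin !scale0r !addr0.
by apply: eq_lin; rewrite /Rm_r /Rm_k lamE; field; rewrite ?q0 ?qq ?nz2.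
Qed.

End LocalRelations.

(** * Antisymmetrizers *)

Section Antisymmetrizer.
Variables (C : fieldType) (H : algType C) (q mu lam : C).

Record bmw_fam n (r k : nat -> H) : Prop := BmwFam {
  fam_gen : forall i, (0 < i < n)%N -> bmw_gen mu lam (r i) (k i);
  fam_adj : forall i, (0 < i)%N -> (i.+1 < n)%N ->
    bmw_adj mu lam (r i) (k i) (r i.+1) (k i.+1);
  fam_far : forall i j, (0 < i)%N -> (i.+1 < j)%N -> (j < n)%N ->
    r i * r j = r j * r i
}.
Local Notation Rm := (@Rm C H q mu lam).

(** The antisymmetrizer of an abstract family of generators.  Abstraction over the
family makes it possible to shift, to reverse and to conjugate the strands. *)
Fixpoint asf (r k : nat -> H) (i : nat) : H :=
  match i with
  | 0 | 1 => 1
  | j.+1 => (q ^+ j / qnum q j.+1) *: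
     (asf r k j * Rm (r j) (k j) (q ^- (2 * j)) * asf r k j)
  end.

Lemma asfS r k i : (0 < i)%N -> asf r k i.+1 = (q ^+ i / qnum q i.+1) *:
     (asf r k i * Rm (r i) (k i) (q ^- (2 * i)) * asf r k i).
Proof. by case: i. Qed.

Lemma comm_scale (c : C) (x y : H) : GRing.comm x y -> GRing.comm x (c *: y).
Proof. by rewrite /GRing.comm -scalerAl -scalerAr => ->. Qed.

Lemma comm_Rm x r k y : GRing.comm x r -> GRing.comm x k -> GRing.comm x (Rm r k y).
Proof.
move=> cr ck; apply: commrD; last exact: comm_scale.
by apply: commrD; [exact: commr1 | exact: comm_scale].
Qed.

Lemma asf_ind (P : H -> Prop) r k n :
  P 1 -> (forall x y, P x -> P y -> P (x * y)) ->
  (forall x y, P x -> P y -> P (x + y)) -> (forall c x, P x -> P (c *: x)) ->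
  (forall j, (0 < j < n)%N -> P (r j) /\ P (k j)) ->
  forall i, (i <= n)%N -> P (asf r k i).
Proof.
move=> P1 PM PD PZ Prk; elim=> [//|[//|i] IH] lin; rewrite asfS //.
have [Pr Pk] := Prk i.+1 lin.
have PR : P (Rm (r i.+1) (k i.+1) (q ^- (2 * i.+1))).
  by apply: (PD); [apply: (PD) => //; exact: PZ | exact: PZ].
have Pi : P (asf r k i.+1) by apply/IH/ltnW.
by apply/PZ/PM => //; apply: PM.
Qed.

Lemma comm_asf x r k n :
  (forall j, (0 < j < n)%N -> GRing.comm x (r j) /\ GRing.comm x (k j)) ->
  forall i, (i <= n)%N -> GRing.comm x (asf r k i).
Proof.
move=> h; apply: asf_ind => //; first exact: commr1.
- by move=> *; exact: commrM.
- by move=> *; exact: commrD.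
- by move=> *; exact: comm_scale.
Qed.

Lemma eq_asf r k r' k' i : (forall j, (0 < j < i)%N -> r j = r' j /\ k j = k' j) ->
  asf r k i = asf r' k' i.
Proof.
elim: i => [//|[//|i] IH] e; rewrite [LHS]asfS // [RHS]asfS //.
have [-> ->] := e i.+1 (ltnSn _).
rewrite IH // => j /andP[j0 ji]; apply: e; lia.
Qed.

Lemma Rm_intertwine w r k r' k' x : w * r = r' * w -> w * k = k' * w ->
  w * Rm r k x = Rm r' k' x * w.
Proof.
move=> er ek; rewrite /Rm !mulrDr !mulrDl mulr1 mul1r -!scalerAr -!scalerAl.
by rewrite er ek.
Qed.

Lemma asf_intertwine w r k r' k' i :
  (forall j, (0 < j < i)%N -> w * r j = r' j * w /\ w * k j = k' j * w) ->
  w * asf r k i = asf r' k' i * w.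
Proof.
elim: i => [|[|i] IH] e; rewrite ?mulr1 ?mul1r //.
have [er ek] := e i.+1 (ltnSn _).
have {IH} IH : w * asf r k i.+1 = asf r' k' i.+1 * w.
  by apply: IH => j ji; apply: e; lia.
rewrite asfS // [in RHS]asfS // -scalerAr -scalerAl; congr (_ *: _).
by rewrite !mulrA IH -[_ * w * _]mulrA (Rm_intertwine _ er ek) -!mulrA IH.
Qed.

Hypotheses (lamE : lam = q - q^-1) (mu0 : mu != 0) (lam0 : lam != 0).
Variable ht : nat.
Hypothesis qnum0 : forall i, (2 <= i <= ht)%N -> qnum q i != 0.
Hypothesis mun0 : forall i, (1 <= i <= ht)%N -> mu + q * q ^- (2 * i) != 0.

Lemma fam_comm n r k i j : bmw_fam n r k -> (0 < i)%N -> (i.+1 < j)%N -> (j < n)%N ->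
  [/\ GRing.comm (r j) (r i), GRing.comm (r j) (k i),
     GRing.comm (k j) (r i) & GRing.comm (k j) (k i)].
Proof.
move=> f i0 ij jn; have := fam_far f i0 ij jn.
have gi : bmw_gen mu lam (r i) (k i) by apply: fam_gen f _ _; lia.
have gj : bmw_gen mu lam (r j) (k j) by apply: fam_gen f _ _; lia.
move=> e; have c1 := k_intertwine lam0 gi gi (esym e).
have c2 := k_intertwine lam0 gj gj e.
split; [exact: esym e|exact: c1|exact: esym c2|].
exact: (k_intertwine lam0 gi gi (esym c2)).
Qed.

Lemma q_expM j : q ^- (2 * j.+1) = q ^- (2 * j) / (q * q).
Proof. by rewrite mulnS exprD invfM mulrC expr2. Qed.

Lemma Rm_absorb r k x i : (0 < i < ht)%N -> bmw_gen mu lam r k ->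
  r * x = - q^-1 *: x ->
  (q ^+ i / qnum q i.+1) *: (Rm r k (q ^- (2 * i)) * x) = x.
Proof.
move=> iht g e; have q0 := q_neq0 lamE lam0.
rewrite /Rm !mulrDl mul1r -!scalerAl e (k_absorb lamE lam0 g e) scaler0 addr0.
rewrite scalerA -[X in X + _]scale1r -scalerDl scalerA -[RHS]scale1r.
congr (_ *: _); have := @qnum0 i.+1 ltac:(lia); rewrite /qnum -lamE.
have -> : q ^- (2 * i) = (q ^+ i * q ^+ i)^-1 by rewrite -exprD mul2n addnn.
rewrite /Rm_r exprS; have := expf_neq0 i q0; move: (q ^+ i) => p p0.
rewrite mulf_eq0 negb_or => /andP[nz _]; rewrite lamE; field.
rewrite ?q0 ?p0 ?(qq1_neq0 lamE lam0) /=.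
have w0 : q * p != 0 by rewrite mulf_neq0.
by apply: contra nz; rewrite !subr_eq0 => /eqP e1; rewrite -[X in _ == X]mul1r -e1 mulfK.
Qed.

(** Where all r_j act as - q^-1, so that all k_j act as 0, the factor [Rm] is a
scalar, which the prefactor of the recursion inverts. *)
Lemma asf_unit n r k x i : bmw_fam n r k -> (i <= n)%N -> (i <= ht)%N ->
  (forall j, (0 < j < i)%N -> r j * x = - q^-1 *: x) -> asf r k i * x = x.
Proof.
move=> f; elim: i => [|[|i] IH] lin iht e; rewrite ?mul1r //.
have IH' : asf r k i.+1 * x = x by apply: IH => [||j ji]; [lia..|apply: e; lia].
have g : bmw_gen mu lam (r i.+1) (k i.+1) by apply: fam_gen f _ _; lia.
have E := Rm_absorb (i := i.+1) ltac:(lia) g (e i.+1 ltac:(lia)).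
by rewrite asfS // -scalerAl -!mulrA IH' scalerAr E IH'.
Qed.

(** For the last generator, the left copy of a^(i) is expanded by its own
recursion.  This exposes a product R^-_i(x) R^-_(i+1)(x q^-2) a^(i), on which
[fusion_key] evaluates r_(i+1). *)
Lemma asf_absorb n r k i j : bmw_fam n r k -> (i <= n)%N -> (i <= ht.+1)%N ->
  (0 < j < i)%N -> r j * asf r k i = - q^-1 *: asf r k i.
Proof.
move=> f; elim: i j => [|i IH] j; first by lia.
move=> lin iht /andP[j0]; rewrite ltnS leq_eqVlt => /orP[/eqP eji|ji]; last first.
  have i0 : (0 < i)%N by lia.
  rewrite asfS // -scalerAr !mulrA IH; try lia.
  by rewrite -!scalerAl !scalerA mulrC.
rewrite eji in j0 *; case: i => [|[|i]] in IH lin iht j0 eji *; first by lia.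
  have g : bmw_gen mu lam (r 1%N) (k 1%N) by apply: fam_gen f _ _; lia.
  have nz : mu + q^-1 != 0.
    have q0 := q_neq0 lamE lam0.
    by have := @mun0 1 ltac:(lia); rewrite muln1 expr2 invfM mulrA mulfV // mul1r.
  have := fusion_base lamE lam0 g nz.
  rewrite mulrDl -scalerAl mul1r => /eqP; rewrite addr_eq0 => /eqP e.
  by rewrite asfS // mul1r mulr1 -scalerAr muln1 expr2 e scalerN scaleNr
    !scalerA mulrC.
set a := asf r k i.+2; rewrite asfS // -/a -scalerAr.
have ra : r i.+1 * a = - q^-1 *: a by apply: IH; lia.
have nz1 : mu + q * q ^- (2 * i.+1) != 0 by apply: mun0; lia.
have nz2 : mu + q ^- (2 * i.+1) / q != 0.
  have q0 := q_neq0 lamE lam0.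
  have -> : q ^- (2 * i.+1) / q = q * q ^- (2 * i.+2).
    by rewrite [in RHS]q_expM mulrCA invfM [q * _]mulrA mulfV // mul1r.
  by apply: mun0; lia.
have adj : bmw_adj mu lam (r i.+1) (k i.+1) (r i.+2) (k i.+2).
  by apply: fam_adj f _ _ _; lia.
have key := fusion_key lamE lam0 adj ra nz1 nz2.
rewrite -q_expM in key.
set W := Rm _ _ _ * (Rm _ _ _ * a) in key.
have aE : a = (q ^+ i.+1 / qnum q i.+2) *: (asf r k i.+1 * Rm (r i.+1) (k i.+1) (q ^- (2 * i.+1)) * asf r k i.+1).
  by rewrite /a asfS.
have com : GRing.comm (asf r k i.+1) (r i.+2) /\ GRing.comm (asf r k i.+1) (k i.+2).
  by split; apply: commr_sym; apply: (@comm_asf _ r k i.+1) => // l li;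
    have [] := @fam_comm n r k l i.+2 f ltac:(lia) ltac:(lia) ltac:(lia).
have a'a : asf r k i.+1 * a = a.
  by apply: (asf_unit f) => [||l li]; [lia..|apply: IH; lia].
have E : a * Rm (r i.+2) (k i.+2) (q ^- (2 * i.+2)) * a =
    (q ^+ i.+1 / qnum q i.+2) *: (asf r k i.+1 * W).
  rewrite {1}aE -!scalerAl; congr (_ *: _).
  rewrite -!mulrA; congr (_ * _); rewrite /W; congr (_ * _).
  rewrite mulrA (comm_Rm _ com.1 com.2) -mulrA; congr (_ * _).
  exact: a'a.
set c := _ / qnum q i.+3; rewrite E; set c' := _ / qnum q i.+2.
rewrite -scalerAr [r i.+2 * _]mulrA -com.1 -[_ * _ * W]mulrA.
have -> : r i.+2 * W = - q^-1 *: W.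
  by apply/eqP; rewrite scaleNr -addr_eq0; rewrite mulrDl -scalerAl mul1r in key; apply/eqP.
by rewrite -scalerAr !scalerA; congr (_ *: _); ring.
Qed.

End Antisymmetrizer.

Section Families.
Variables (C : fieldType) (H : algType C) (mu lam : C).
Local Notation bmw_fam := (@bmw_fam C H mu lam).

Lemma fam_le n n' r k : bmw_fam n r k -> (n' <= n)%N -> bmw_fam n' r k.
Proof.
move=> f le; split=> *; [apply: (fam_gen f)|apply: (fam_adj f)|apply: (fam_far f)]; lia.
Qed.

Lemma fam_rev n r k : bmw_fam n r k ->
  bmw_fam n (fun i => r (n - i)%N) (fun i => k (n - i)%N).
Proof.
move=> f; split=> [i i0|i i0 ilt|i j i0 ij jn].
- by apply: (fam_gen f); lia.
- have -> : (n - i = (n - i.+1).+1)%N by lia.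
  by apply: bmw_adjC; apply: (fam_adj f); lia.
- by symmetry; apply: (fam_far f); lia.
Qed.

Lemma fam_shift s n r k : bmw_fam (s + n) r k ->
  bmw_fam n (fun i => r (s + i)%N) (fun i => k (s + i)%N).
Proof.
move=> f; split=> [i i0|i i0 ilt|i j i0 ij jn].
- by apply: (fam_gen f); lia.
- by rewrite addnS; apply: (fam_adj f); lia.
- by apply: (fam_far f); lia.
Qed.

End Families.

Section Converse.
Variables (C : fieldType) (H : algType C).
(* The relations are invariant under reversal of products: left-handed
   statements in the converse algebra are the right-handed ones in H. *)
HB.instance Definition _ := GRing.Lmodule.copy (H^c) H.
Fact converse_scaleAl (c : C) (x y : H^c) : c *: (x * y) = (c *: x : H^c) * y.
Proof. exact: (@scalerAr C H c y x). Qed.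
Fact converse_scaleAr (c : C) (x y : H^c) : c *: (x * y) = x * (c *: y : H^c).
Proof. exact: (@scalerAl C H c y x). Qed.
HB.instance Definition _ := GRing.Lmodule_isLalgebra.Build C (H^c) converse_scaleAl.
HB.instance Definition _ := GRing.Lalgebra_isAlgebra.Build C (H^c) converse_scaleAr.
End Converse.

Section ConverseAntisymmetrizer.
Variables (C : fieldType) (H : algType C) (q mu lam : C).

Lemma bmw_gen_conv (r k : H) : bmw_gen mu lam r k -> @bmw_gen C H^c mu lam r k.
Proof. by case=> *; split. Qed.

Lemma bmw_adj_conv (r1 k1 r2 k2 : H) : bmw_adj mu lam r1 k1 r2 k2 ->
  @bmw_adj C H^c mu lam r1 k1 r2 k2.
Proof.
have E (x y z : H) : (x : H^c) * y * z = z * y * x :> H by rewrite -mulrA.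
case=> *; split; rewrite ?E //; exact: bmw_gen_conv.
Qed.

Lemma fam_conv n (r k : nat -> H) : bmw_fam mu lam n r k ->
  @bmw_fam C H^c mu lam n r k.
Proof.
move=> f; split=> [i i0|i i0 ilt|i j i0 ij jn].
- by apply: bmw_gen_conv; apply: (fam_gen f).
- by apply: bmw_adj_conv; apply: (fam_adj f).
- by symmetry; apply: (fam_far f).
Qed.

Lemma asf_conv (r k : nat -> H) i :
  @asf C H^c q mu lam r k i = asf q mu lam r k i :> H.
Proof.
elim: i => [|[|i] IH] //; rewrite asfS // [RHS]asfS // -IH.
congr (_ *: _); exact: mulrA.
Qed.
End ConverseAntisymmetrizer.

(** * Antisymmetrizers on shifted strands *)

Section Shifts.
Variables (C : fieldType) (H : algType C) (q mu lam : C).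
Hypotheses (lamE : lam = q - q^-1) (mu0 : mu != 0) (lam0 : lam != 0).
Variable ht : nat.
Hypothesis qnum0 : forall i, (2 <= i <= ht)%N -> qnum q i != 0.
Hypothesis mun0 : forall i, (1 <= i <= ht)%N -> mu + q * q ^- (2 * i) != 0.
Local Notation Rm := (@Rm C H q mu lam).
Local Notation bmw_fam := (@bmw_fam C H mu lam).
Local Notation asf := (@asf C H q mu lam).

Lemma asf_absorbr n r k i j : bmw_fam n r k -> (i <= n)%N -> (i <= ht.+1)%N ->
  (0 < j < i)%N -> asf r k i * r j = - q^-1 *: asf r k i.
Proof.
move=> f lin iht ji.
have := asf_absorb lamE mu0 lam0 qnum0 mun0 (fam_conv f) lin iht ji.
by rewrite asf_conv.
Qed.

Lemma asf_unitr n r k x i : bmw_fam n r k -> (i <= n)%N -> (i <= ht)%N ->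
  (forall j, (0 < j < i)%N -> x * r j = - q^-1 *: x) -> x * asf r k i = x.
Proof.
move=> f lin iht e.
have := asf_unit lamE mu0 lam0 qnum0 (fam_conv f) lin iht e.
by rewrite asf_conv.
Qed.

(** Each side absorbs the generators from the left and from the right, so the
product of the two is equal to either of them. *)
Lemma asf_rev n r k i : bmw_fam n r k -> (i <= n)%N -> (i <= ht)%N ->
  asf (fun j => r (i - j)%N) (fun j => k (i - j)%N) i = asf r k i.
Proof.
move=> f lin iht; have fi := fam_le f lin; have fr := fam_rev fi.
rewrite -[LHS](asf_unit lamE mu0 lam0 qnum0 fi (leqnn i) iht); last first.
  move=> j ji; have := asf_absorb lamE mu0 lam0 qnum0 mun0 fr (leqnn i) (leqW iht).
  move=> /(_ (i - j)%N ltac:(lia)) /=; have -> //: (i - (i - j) = j)%N by lia.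
by apply: (asf_unitr fr) => // j ji; apply: (asf_absorbr f) => //; lia.
Qed.

Section Family.
Variables (n : nat) (r k : nat -> H) (f : bmw_fam n r k).

Definition asy s i := asf (fun j => r (s + j)%N) (fun j => k (s + j)%N) i.

Lemma fam_at s i : (s + i <= n)%N ->
  bmw_fam i (fun j => r (s + j)%N) (fun j => k (s + j)%N).
Proof. by move=> sin; apply/fam_shift/(fam_le f). Qed.

Lemma asy_absorb s i j : (s + i <= n)%N -> (i <= ht)%N -> (s < j < s + i)%N ->
  r j * asy s i = - q^-1 *: asy s i.
Proof.
move=> sin iht ji; have -> : j = (s + (j - s))%N by lia.
by apply: (asf_absorb lamE mu0 lam0 qnum0 mun0 (fam_at sin)); lia.
Qed.

Lemma asy_absorbr s i j : (s + i <= n)%N -> (i <= ht)%N -> (s < j < s + i)%N ->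
  asy s i * r j = - q^-1 *: asy s i.
Proof.
move=> sin iht ji; have -> : j = (s + (j - s))%N by lia.
by apply: (asf_absorbr (fam_at sin)); lia.
Qed.

Lemma asy_unit s i x : (s + i <= n)%N -> (i <= ht)%N ->
  (forall j, (s < j < s + i)%N -> r j * x = - q^-1 *: x) -> asy s i * x = x.
Proof.
move=> sin iht e; apply: (asf_unit lamE mu0 lam0 qnum0 (fam_at sin)) => // j ji.
by apply: e; lia.
Qed.

Lemma asy_idem s i : (s + i <= n)%N -> (i <= ht)%N -> asy s i * asy s i = asy s i.
Proof. by move=> sin iht; apply: asy_unit => // j; apply: asy_absorb. Qed.

(** The recursion for the reversed family, read backwards by [asf_rev]: it adds a
strand in front, where the defining recursion adds it at the end. *)
Lemma asyS s i : (0 < i < ht)%N -> (s + i.+1 <= n)%N ->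
  asy s i.+1 = (q ^+ i / qnum q i.+1) *:
    (asy s.+1 i * Rm (r s.+1) (k s.+1) (q ^- (2 * i)) * asy s.+1 i).
Proof.
move=> iht sin; rewrite /asy -(asf_rev (fam_at sin)) //; last lia.
rewrite asfS; last lia.
have -> : (i.+1 - i = 1)%N by lia.
rewrite addn1.
suff -> : asf (fun j => r (s + (i.+1 - j))%N) (fun j => k (s + (i.+1 - j))%N) i =
  asf (fun j => r (s.+1 + j)%N) (fun j => k (s.+1 + j)%N) i by [].
rewrite -[RHS](asf_rev (@fam_at s.+1 i ltac:(lia))) //; last lia.
by apply: eq_asf => j ji; have -> : (s + (i.+1 - j) = s.+1 + (i - j))%N by lia.
Qed.

Definition stair a b := \prod_(a <= j < b) r j.

Lemma stair_nil a b : (b <= a)%N -> stair a b = 1.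
Proof. exact: big_geq. Qed.

Lemma stair_recl a b : (a < b)%N -> stair a b = r a * stair a.+1 b.
Proof. by move=> ab; rewrite /stair big_ltn. Qed.

Lemma stair_recr a b : (a <= b)%N -> stair a b.+1 = stair a b * r b.
Proof. by move=> ab; rewrite /stair big_nat_recr. Qed.

Lemma stair_comm a b x : (forall j, (a <= j < b)%N -> GRing.comm x (r j)) ->
  GRing.comm x (stair a b).
Proof. by move=> e; rewrite /stair big_nat; apply: commr_prod. Qed.

(** The braid relation at j, j+1; all other factors commute. *)
Lemma stair_shift a b j : (0 < a)%N -> (b <= n)%N -> (a <= j)%N -> (j.+1 < b)%N ->
  stair a b * r j = r j.+1 * stair a b.
Proof.
move=> a0 bn aj jb.
have -> : stair a b = stair a j * (r j * (r j.+1 * stair j.+2 b)).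
  rewrite -!stair_recl; try lia.
  by rewrite /stair -big_cat_nat //; lia.
have c1 : GRing.comm (r j) (stair j.+2 b).
  by apply: stair_comm => l lj; apply: (fam_far f); lia.
have c2 : GRing.comm (r j.+1) (stair a j).
  by apply: stair_comm => l lj; apply: esym; apply: (fam_far f); lia.
have adj : bmw_adj mu lam (r j) (k j) (r j.+1) (k j.+1) by apply: (fam_adj f); lia.
rewrite -!mulrA -c1 [r j.+1 * (stair _ _ * _)]mulrA c2 -!mulrA; congr (_ * _).
by rewrite !mulrA (adj_braid adj).
Qed.

Lemma stair_shift_k a b j : (0 < a)%N -> (b <= n)%N -> (a <= j)%N -> (j.+1 < b)%N ->
  stair a b * k j = k j.+1 * stair a b.
Proof.
move=> a0 bn aj jb; apply: (k_intertwine lam0 (r1 := r j) (r2 := r j.+1)).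
- by apply: (fam_gen f); lia.
- by apply: (fam_gen f); lia.
- exact: stair_shift.
Qed.

Lemma stair_shift_asy a b s i : (0 < a)%N -> (b <= n)%N -> (a <= s.+1)%N ->
  (s + i < b)%N -> stair a b * asy s i = asy s.+1 i * stair a b.
Proof.
move=> a0 bn aj jb; apply: asf_intertwine => j ji; rewrite addSn.
by split; [apply: stair_shift | apply: stair_shift_k]; lia.
Qed.

Lemma stair_shift_stair a b c d : (0 < a)%N -> (b <= n)%N -> (a <= c)%N ->
  (d < b)%N -> stair a b * stair c d = stair c.+1 d.+1 * stair a b.
Proof.
move=> a0 bn ac; elim: d => [|d IH] db.
  by rewrite [stair c _]stair_nil // [stair c.+1 _]stair_nil // mulr1 mul1r.
case: (leqP c d) => cd; last first.
  by rewrite [stair c _]stair_nil // [stair c.+1 _]stair_nil // mulr1 mul1r.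
rewrite [stair c d.+1]stair_recr // [stair c.+1 d.+2]stair_recr // mulrA IH; last lia.
by rewrite -!mulrA stair_shift //; lia.
Qed.

(** A staircase moves every generator up by one strand, except the last one; its
square V V sends the last generator round to the first one, because V r_b
ends in the part of V that can still be moved. *)
Lemma stair_wrap a b : (0 < a)%N -> (b < n)%N -> (a < b)%N ->
  stair a b.+1 * stair a b.+1 * r b = r a * (stair a b.+1 * stair a b.+1).
Proof.
move=> a0 bn ab; set V := stair a b.+1.
have VE : V = stair a b * r b by rewrite -stair_recr // ltnW.
have VE' : V = r a * stair a.+1 b.+1 by rewrite -stair_recl // ltnW.
have sh : V * stair a b = stair a.+1 b.+1 * V by apply: stair_shift_stair; lia.
have e : V * V = stair a.+1 b.+1 * V * r b by rewrite {2}VE mulrA sh.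
by rewrite [in RHS]e !mulrA -VE'.
Qed.

Lemma stair_unitR a b x : (0 < a)%N -> (b <= n)%N -> x * stair a b = 0 -> x = 0.
Proof.
move=> a0; elim: b => [|b IH] bn.
  by rewrite stair_nil // mulr1.
case: (leqP a b) => ab; last by rewrite stair_nil // mulr1.
rewrite stair_recr // mulrA => e; apply: IH; first lia.
have g : bmw_gen mu lam (r b) (k b) by apply: (fam_gen f); lia.
by rewrite -[LHS]mulr1 -(bmw_rV g) mulrA e mul0r.
Qed.

Lemma asy_stair s i : (s + i <= n)%N -> (i <= ht)%N -> forall b, (b <= s + i)%N ->
  exists c, asy s i * stair s.+1 b = c *: asy s i /\ stair s.+1 b * asy s i = c *: asy s i.
Proof.
move=> sin iht; elim=> [|b IH] bi.
  by exists 1; rewrite stair_nil // mulr1 mul1r scale1r.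
case: (leqP s.+1 b) => sb; last by exists 1; rewrite stair_nil // mulr1 mul1r scale1r.
have [c [e1 e2]] := IH ltac:(lia); exists (- q^-1 * c); rewrite stair_recr //; split.
  by rewrite mulrA e1 -scalerAl asy_absorbr ?scalerA ?[c * _]mulrC //; lia.
by rewrite -mulrA asy_absorb ?sb // -scalerAr e2 scalerA.
Qed.

(** With V = r_(s+1) ... r_(s+ht) = r_(s+1) W, the element W V carries the
generators of the last two strands to those of the first two ([stair_wrap]).
It also carries the lower antisymmetrizer to the upper one: V does so, and W
commutes with the upper one, on which it acts from both sides by the same
scalar. *)
Lemma top_flip s : (1 < ht)%N -> (s + ht < n)%N ->
  asy s ht * Rm (r (s + ht)%N) (k (s + ht)%N) (q ^- (2 * ht)) * asy s ht = 0 ->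
  asy s.+1 ht * Rm (r s.+1) (k s.+1) (q ^- (2 * ht)) * asy s.+1 ht = 0.
Proof.
move=> ht0 sn e0.
set V := stair s.+1 (s + ht).+1; set W := stair s.+2 (s + ht).+1.
apply: (@stair_unitR s.+2 (s + ht).+1) => //; rewrite -/W.
apply: (@stair_unitR s.+1 (s + ht).+1) => //; rewrite -/V.
have VE : V = r s.+1 * W by rewrite /V /W -stair_recl //; lia.
have wrap : V * V * r (s + ht)%N = r s.+1 * (V * V) by apply: stair_wrap; lia.
have g : bmw_gen mu lam (r s.+1) (k s.+1) by apply: (fam_gen f); lia.
have g' : bmw_gen mu lam (r (s + ht)%N) (k (s + ht)%N) by apply: (fam_gen f); lia.
have wr : W * V * r (s + ht)%N = r s.+1 * (W * V).
  apply: (cancelL (bmw_Vr g)); rewrite !mulrA -VE wrap.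
  by rewrite {1}VE !mulrA.
have wk : W * V * k (s + ht)%N = k s.+1 * (W * V) by apply: (k_intertwine lam0 g' g).
have wR := Rm_intertwine q mu lam (q ^- (2 * ht)) wr wk.
have Va : V * asy s ht = asy s.+1 ht * V by apply: stair_shift_asy; lia.
have [||c [aW Wa]] := @asy_stair s.+1 ht _ (leqnn _) (s + ht).+1 _; [lia..|].
have com : asy s.+1 ht * W = W * asy s.+1 ht by rewrite aW Wa.
set A := asy s.+1 ht in Va com *; set R := Rm (r s.+1) _ _ in wR *.
rewrite -[A * R * A * W]mulrA com -!mulrA -Va [W * _]mulrA [R * _]mulrA -wR.
rewrite !mulrA com -[W * A * V]mulrA -Va.
by rewrite -!mulrA [asy s ht * _]mulrA e0 !mulr0.
Qed.

End Family.
End Shifts.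

(** * Partial traces on a tower of BMW algebras *)

(** [tw_S i] consists of the operators in the first i strands, [tw_T i] is the
trace of the strand i, and [tw_fi] the inverse of [tw_f].  By [tw_inj] the cap
equation [tw_Tk] has only one solution, so it is the definition of the trace. *)
Record tower (C : fieldType) (H : algType C) (mu lam : C) (n : nat) := Tower {
  tw_r : nat -> H;
  tw_k : nat -> H;
  tw_f : nat -> H;
  tw_fi : nat -> H;
  tw_S : nat -> H -> Prop;
  tw_T : nat -> H -> H;
  tw_fam : bmw_fam mu lam n tw_r tw_k;
  tw_S1 : forall i, tw_S i 1;
  tw_SD : forall i x y, tw_S i x -> tw_S i y -> tw_S i (x + y);
  tw_SZ : forall i c x, tw_S i x -> tw_S i (c *: x);
  tw_SM : forall i x y, tw_S i x -> tw_S i y -> tw_S i (x * y);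
  tw_SW : forall i j x, (i <= j)%N -> tw_S i x -> tw_S j x;
  tw_Sr : forall i, (0 < i < n)%N -> tw_S i.+1 (tw_r i);
  tw_Sk : forall i, (0 < i < n)%N -> tw_S i.+1 (tw_k i);
  tw_Sf : forall i, (0 < i < n)%N -> tw_S i.+1 (tw_f i);
  tw_Sfi : forall i, (0 < i < n)%N -> tw_S i.+1 (tw_fi i);
  tw_Cr : forall i j x, (i < j < n)%N -> tw_S i x -> GRing.comm x (tw_r j);
  tw_Ck : forall i j x, (i < j < n)%N -> tw_S i x -> GRing.comm x (tw_k j);
  tw_Cf : forall i j x, (i < j < n)%N -> tw_S i x -> GRing.comm x (tw_f j);
  tw_ffi : forall i, (0 < i < n)%N -> tw_f i * tw_fi i = 1;
  tw_fif : forall i, (0 < i < n)%N -> tw_fi i * tw_f i = 1;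
  tw_fff : forall i, (0 < i)%N -> (i.+1 < n)%N ->
    tw_f i * tw_f i.+1 * tw_f i = tw_f i.+1 * tw_f i * tw_f i.+1;
  tw_rff : forall i, (0 < i)%N -> (i.+1 < n)%N ->
    tw_r i * tw_f i.+1 * tw_f i = tw_f i.+1 * tw_f i * tw_r i.+1;
  tw_rff' : forall i, (0 < i)%N -> (i.+1 < n)%N ->
    tw_r i.+1 * tw_f i * tw_f i.+1 = tw_f i * tw_f i.+1 * tw_r i;
  tw_TD : forall i x y, tw_T i (x + y) = tw_T i x + tw_T i y;
  tw_TZ : forall i c x, tw_T i (c *: x) = c *: tw_T i x;
  tw_TS : forall i x, (i < n)%N -> tw_S i.+1 x -> tw_S i (tw_T i.+1 x);
  tw_Tk : forall i x, (i.+1 < n)%N -> tw_S i.+1 x ->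
    tw_k i.+1 * x * tw_k i.+1 = mu^-1 *: (tw_T i.+1 x * tw_k i.+1);
  tw_inj : forall i x, (i.+1 < n)%N -> tw_S i x -> x * tw_k i.+1 = 0 -> x = 0
}.

Section TowerTheory.
Variables (C : fieldType) (H : algType C) (q mu lam : C) (n : nat).
Variable (t : tower H mu lam n).
Local Notation r := (tw_r t).
Local Notation k := (tw_k t).
Local Notation f := (tw_f t).
Local Notation fi := (tw_fi t).
Local Notation S := (tw_S t).
Local Notation T := (tw_T t).
Local Notation ri i := (skein_inv lam (r i) (k i)).

Lemma tw_SN i x : S i x -> S i (- x).
Proof. by rewrite -scaleN1r; apply: tw_SZ. Qed.

Lemma tw_SB i x y : S i x -> S i y -> S i (x - y).
Proof. by move=> Sx /tw_SN; apply: tw_SD. Qed.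

Lemma tw_Sri i : (0 < i < n)%N -> S i.+1 (ri i).
Proof.
move=> ii; apply: tw_SB; first exact: tw_Sr.
by apply/tw_SZ/tw_SB; [exact: tw_S1 | exact: tw_Sk].
Qed.

Lemma tw_Cri i j x : (i < j < n)%N -> S i x -> GRing.comm x (ri j).
Proof.
move=> ij Sx; apply: commrB; first exact: tw_Cr ij Sx.
apply: comm_scale; apply: commrB; [exact: commr1|exact: tw_Ck ij Sx].
Qed.

Lemma comm_inv (x y z : H) : y * z = 1 -> z * y = 1 -> GRing.comm x y -> GRing.comm x z.
Proof.
move=> yz zy e; apply: (cancelR (x := y) (y := z)) => //.
by rewrite -mulrA zy mulr1 -mulrA e mulrA zy mul1r.
Qed.

Lemma tw_Cfi i j x : (i < j < n)%N -> S i x -> GRing.comm x (fi j).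
Proof.
move=> ij Sx; have j0 : (0 < j < n)%N by lia.
exact: (comm_inv (tw_ffi t j0) (tw_fif t j0) (tw_Cf ij Sx)).
Qed.

Hypotheses (lamE : lam = q - q^-1) (mu0 : mu != 0) (lam0 : lam != 0).

Lemma tw_gen i : (0 < i < n)%N -> bmw_gen mu lam (r i) (k i).
Proof. by move=> ii; apply: (fam_gen (tw_fam t)). Qed.

Lemma tw_adj i : (0 < i)%N -> (i.+1 < n)%N -> bmw_adj mu lam (r i) (k i) (r i.+1) (k i.+1).
Proof. by move=> ii; apply: (fam_adj (tw_fam t)). Qed.

Lemma tw_inj2 i x y : (i.+1 < n)%N -> S i x -> S i y -> x * k i.+1 = y * k i.+1 -> x = y.
Proof.
move=> ii Sx Sy e; apply/eqP; rewrite -subr_eq0; apply/eqP.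
by apply: tw_inj ii (tw_SB Sx Sy) _; rewrite mulrBl e subrr.
Qed.

(** The traces are computed by verifying the cap equation for a guess. *)
Lemma T_unique i x y : (i.+1 < n)%N -> S i.+1 x -> S i y ->
  k i.+1 * x * k i.+1 = mu^-1 *: (y * k i.+1) -> T i.+1 x = y.
Proof.
move=> ii Sx Sy; rewrite tw_Tk // => /(congr1 ( *:%R mu)); rewrite !scalerA mulfV //.
by rewrite !scale1r; apply: tw_inj2 => //; apply: tw_TS => //; lia.
Qed.

Lemma T_modl i x y : (i.+1 < n)%N -> S i.+1 x -> S i y -> T i.+1 (y * x) = y * T i.+1 x.
Proof.
move=> ii Sx Sy; apply: T_unique => //.
- by apply: tw_SM => //; apply: tw_SW Sy.
- by apply: tw_SM => //; apply: tw_TS => //; lia.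
- have c : GRing.comm y (k i.+1) by apply: tw_Ck Sy; lia.
  by rewrite mulrA -c -!mulrA [k _ * _]mulrA tw_Tk // -scalerAr.
Qed.

Lemma T_modr i x y : (i.+1 < n)%N -> S i.+1 x -> S i y -> T i.+1 (x * y) = T i.+1 x * y.
Proof.
move=> ii Sx Sy; apply: T_unique => //.
- by apply: tw_SM => //; apply: tw_SW Sy.
- by apply: tw_SM => //; apply: tw_TS => //; lia.
- have c : GRing.comm y (k i.+1) by apply: tw_Ck Sy; lia.
  by rewrite -!mulrA c !mulrA tw_Tk // -scalerAl.
Qed.

Lemma T_r i : (0 < i)%N -> (i.+1 < n)%N -> T i.+1 (r i) = 1.
Proof.
move=> i0 ii; apply: T_unique => //; [by apply: tw_Sr; lia|exact: tw_S1|].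
by rewrite mul1r (bmw_krk mu0 (tw_adj i0 ii)).
Qed.

Lemma T_k i : (0 < i)%N -> (i.+1 < n)%N -> T i.+1 (k i) = mu *: 1.
Proof.
move=> i0 ii; apply: T_unique => //; [by apply: tw_Sk; lia|by apply/tw_SZ/tw_S1|].
by rewrite -scalerAl mul1r scalerA mulVf // scale1r (adj_kkk21 (tw_adj i0 ii)).
Qed.

Lemma T_1 i : (i.+1 < n)%N -> T i.+1 1 = (mu * loop_val q mu lam) *: 1.
Proof.
move=> ii; apply: T_unique => //; [exact: tw_S1|by apply/tw_SZ/tw_S1|].
have g : bmw_gen mu lam (r i.+1) (k i.+1) by apply: tw_gen; lia.
by rewrite mulr1 (bmw_kkE lamE mu0 lam0 g) -scalerAl mul1r scalerA mulrA mulVf // mul1r.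
Qed.

(** f_(i+1) f_(i+2) carries k_(i+1) to k_(i+2), so the cap equation for x at the
strand i+1 is conjugate to the one wanted at i+2. *)
Lemma T_conj_f i x : (i.+2 < n)%N -> S i.+1 x ->
  T i.+2 (f i.+1 * x * fi i.+1) = T i.+1 x.
Proof.
move=> ii Sx.
have STx : S i (T i.+1 x) by apply: tw_TS => //; lia.
apply: T_unique => //.
- apply: tw_SM; [apply: tw_SM|]; [by apply: tw_Sf; lia|by apply: tw_SW Sx|by apply: tw_Sfi; lia].
- by apply: tw_SW STx.
have g1 : bmw_gen mu lam (r i.+1) (k i.+1) by apply: tw_gen; lia.
have g2 : bmw_gen mu lam (r i.+2) (k i.+2) by apply: tw_gen; lia.
have ffk : f i.+1 * f i.+2 * k i.+1 = k i.+2 * (f i.+1 * f i.+2).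
  apply: (k_intertwine lam0 g1 g2); rewrite -tw_rff' ?mulrA //.
have f1 := @tw_ffi _ _ _ _ _ t i.+1 ltac:(lia); have f2 := @tw_ffi _ _ _ _ _ t i.+2 ltac:(lia).
have f1' := @tw_fif _ _ _ _ _ t i.+1 ltac:(lia); have f2' := @tw_fif _ _ _ _ _ t i.+2 ltac:(lia).
have Cx : GRing.comm x (f i.+2) by apply: tw_Cf Sx; lia.
have Cy1 : GRing.comm (T i.+1 x) (f i.+1) by apply: tw_Cf STx; lia.
have Cy2 : GRing.comm (T i.+1 x) (f i.+2) by apply: tw_Cf STx; lia.
(* The two halves of k f x f^-1 k = f f k x k f^-1 f^-1, with k on the upper
   strands on the left and on the lower strands on the right. *)
have E2 : fi i.+1 * k i.+2 = f i.+2 * k i.+1 * fi i.+2 * fi i.+1.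
  apply: (cancelL f1'); apply: (cancelR f1); apply: (cancelR f2).
  rewrite -!mulrA [f i.+1 * (fi i.+1 * _)]mulrA f1 mul1r.
  by rewrite [fi i.+1 * (f i.+1 * _)]mulrA f1' mul1r f2' mulr1 -ffk mulrA.
have E1 : k i.+2 * f i.+1 = f i.+1 * f i.+2 * k i.+1 * fi i.+2.
  by apply: (cancelR f2); rewrite -!mulrA f2' mulr1 -ffk mulrA.
rewrite !mulrA E1 -!mulrA E2.
rewrite -!mulrA [fi i.+2 * (x * _)]mulrA.
have Cx' : GRing.comm x (fi i.+2) by apply: tw_Cfi Sx; lia.
rewrite -Cx' -!mulrA [fi i.+2 * (f i.+2 * _)]mulrA f2' mul1r.
rewrite [x * (k _ * _)]mulrA [k i.+1 * (x * k i.+1 * _)]mulrA [k i.+1 * (x * k _)]mulrA.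
rewrite tw_Tk //; last lia.
rewrite -scalerAl -!scalerAr; congr (_ *: _).
rewrite -!mulrA [f i.+2 * (T _ _ * _)]mulrA -Cy2 -!mulrA [f i.+1 * (T _ _ * _)]mulrA -Cy1 -!mulrA.
congr (_ * _); rewrite !mulrA ffk -!mulrA [f i.+2 * (fi _ * _)]mulrA f2 mul1r f1 mulr1 //.
Qed.

(** k2 k1 k3 k2 is a pair of nested arcs which joins the strands 1, 2 to 4, 3; a
crossing slides along the arcs from one pair of strands to the other. *)
Lemma kappa_r (r1 k1 r2 k2 r3 k3 : H) : bmw_adj mu lam r1 k1 r2 k2 ->
  bmw_adj mu lam r2 k2 r3 k3 -> GRing.comm k1 k3 ->
  r1 * (k2 * k1 * k3 * k2) = r3 * (k2 * k1 * k3 * k2) /\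
  (k2 * k1 * k3 * k2) * r1 = (k2 * k1 * k3 * k2) * r3.
Proof.
move=> a12 a23 c; have a32 := bmw_adjC a23; have a21 := bmw_adjC a12.
have c' : k2 * k1 * k3 * k2 = k2 * k3 * k1 * k2 by rewrite -[_ * k1 * k3]mulrA c mulrA.
have L (r0 k0 k0' : H) : bmw_adj mu lam r0 k0 r2 k2 ->
    r0 * (k2 * k0 * k0' * k2) = skein_inv lam r2 k2 * k0 * k0' * k2.
  by move=> a; rewrite !mulrA (adj_rkk21 a).
have R (r0 k0 k0' : H) : bmw_adj mu lam r0 k0 r2 k2 ->
    (k2 * k0' * k0 * k2) * r0 = k2 * k0' * (k0 * skein_inv lam r2 k2).
  by move=> a; rewrite -!mulrA [k0 * (k2 * _)]mulrA (adj_kkr12 a).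
split.
  by rewrite (L _ _ _ a12) c' (L _ _ _ a32) -[_ * k1 * k3]mulrA c mulrA.
by rewrite (R _ _ _ a32) c' (R _ _ _ a12) !mulrA -[_ * k1 * k3]mulrA c mulrA.
Qed.

(** The cap equation applied twice: nested arcs trace two strands. *)
Lemma TT_kappa j x : (0 < j)%N -> (j.+2 < n)%N -> S j.+1 x ->
  let kap := k j.+1 * k j * k j.+2 * k j.+1 in
  kap * x * kap = (mu^-1 * mu^-1) *: (T j (T j.+1 x) * kap).
Proof.
case: j => [//|j] _ jn Sx kap.
have STx : S j.+1 (T j.+2 x) by apply: tw_TS => //; lia.
have STTx : S j (T j.+1 (T j.+2 x)) by apply: tw_TS => //; lia.
have c13 : GRing.comm (k j.+1) (k j.+3) by apply: (@tw_Ck _ _ _ _ _ t j.+2); [lia|apply: tw_Sk; lia].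
have cT : GRing.comm (T j.+2 x) (k j.+3) by apply: tw_Ck STx; lia.
have cTT1 : GRing.comm (T j.+1 (T j.+2 x)) (k j.+2) by apply: tw_Ck STTx; lia.
have a23 := @tw_adj j.+2 ltac:(lia) ltac:(lia).
rewrite /kap.
have -> : k j.+2 * k j.+1 * k j.+3 * k j.+2 * x * (k j.+2 * k j.+1 * k j.+3 * k j.+2) =
  k j.+2 * k j.+1 * k j.+3 * (k j.+2 * x * k j.+2) * k j.+3 * k j.+1 * k j.+2.
  by rewrite -!mulrA [k j.+1 * (k j.+3 * k j.+2)]mulrA c13 !mulrA.
rewrite tw_Tk; [|lia|done].
rewrite -!scalerAr -!scalerAl -[RHS]scalerA; congr (_ *: _).
have -> : k j.+2 * k j.+1 * k j.+3 * (T j.+2 x * k j.+2) * k j.+3 * k j.+1 * k j.+2 =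
  k j.+2 * (k j.+1 * T j.+2 x * k j.+1) * k j.+3 * k j.+2.
  rewrite -!mulrA [k j.+3 * (T _ _ * _)]mulrA -cT -!mulrA.
  rewrite [k j.+3 * (k j.+2 * _)]mulrA [k j.+3 * k j.+2 * (k j.+3 * _)]mulrA (adj_kkk21 a23).
  by rewrite [k j.+1 * (k j.+3 * k j.+2)]mulrA c13 -!mulrA.
rewrite tw_Tk; [|lia|done].
rewrite -!scalerAr -!scalerAl; congr (_ *: _).
by rewrite !mulrA -cTT1.
Qed.

(** In the sandwich of x between nested arcs, r_j slides to r_(j+2), passes x, and
slides back on the other side. *)
Lemma TT_cyc j x : (0 < j)%N -> (j.+2 < n)%N -> S j.+1 x ->
  T j (T j.+1 (r j * x)) = T j (T j.+1 (x * r j)).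
Proof.
case: j => [//|j] _ jn Sx.
have a12 := @tw_adj j.+1 ltac:(lia) ltac:(lia).
have a23 := @tw_adj j.+2 ltac:(lia) ltac:(lia).
have c13 : GRing.comm (k j.+1) (k j.+3) by apply: (@tw_Ck _ _ _ _ _ t j.+2); [lia|apply: tw_Sk; lia].
have [kr rk] := kappa_r a12 a23 c13.
have Sr : S j.+2 (r j.+1) by apply: tw_Sr; lia.
have Srx : S j.+2 (r j.+1 * x) by apply: tw_SM.
have Sxr : S j.+2 (x * r j.+1) by apply: tw_SM.
have Cx : GRing.comm x (r j.+3) by apply: tw_Cr Sx; lia.
have e1 := TT_kappa (j := j.+1) isT jn Srx; have e2 := TT_kappa (j := j.+1) isT jn Sxr.
rewrite /= in e1 e2.
set kap := _ * _ * _ * k j.+2 in kr rk e1 e2.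
have e : kap * (r j.+1 * x) * kap = kap * (x * r j.+1) * kap.
  by rewrite mulrA rk -[_ * r j.+3 * x]mulrA -Cx -!mulrA kr.
rewrite e e2 in e1.
(* The outer k_j and k_(j+2) straighten the nested arcs to two single caps, which
   [tw_inj2] cancels one after the other. *)
set X := T j.+1 _; set Y := T j.+1 _.
have SX : S j X by do 2 (apply: tw_TS; first lia).
have SY : S j Y by do 2 (apply: tw_TS; first lia).
have mm : mu^-1 * mu^-1 != 0 by rewrite mulf_neq0 ?invr_eq0.
have {e1} : Y * kap = X * kap.
  by move/(congr1 ( *:%R (mu^-1 * mu^-1)^-1)): e1; rewrite !scalerA mulVf // !scale1r.
have key Z : S j Z -> k j.+1 * (Z * kap) * k j.+3 = Z * k j.+1 * k j.+3.
  move=> SZ; have c1 : GRing.comm Z (k j.+1) by apply: tw_Ck SZ; lia.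
  rewrite mulrA -c1 -!mulrA; congr (_ * _).
  rewrite [k j.+3 * (k _ * _)]mulrA (adj_kkk21 a23).
  by rewrite !mulrA (adj_kkk12 a12).
move=> e1; have := congr1 (fun z => k j.+1 * z * k j.+3) e1.
have Sk1 Z : S j Z -> S j.+2 (Z * k j.+1).
  by move=> SZ; apply: tw_SM; [apply: tw_SW SZ; lia | apply: tw_Sk; lia].
rewrite /= !key // => /(tw_inj2 jn (Sk1 _ SY) (Sk1 _ SX)).
by move/(tw_inj2 (i := j)) => -> //; lia.
Qed.

(** The trace of the strands a+1, ..., a+m. *)
Fixpoint trs a m (x : H) : H := if m is m'.+1 then trs a m' (T (a + m')%N.+1 x) else x.

Lemma trsD a m x y : trs a m (x + y) = trs a m x + trs a m y.
Proof. by elim: m x y => [//|m IH] x y /=; rewrite tw_TD IH. Qed.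

Lemma trsZ a m c x : trs a m (c *: x) = c *: trs a m x.
Proof. by elim: m x => [//|m IH] x /=; rewrite tw_TZ IH. Qed.

Lemma trsN a m x : trs a m (- x) = - trs a m x.
Proof. by rewrite -scaleN1r trsZ scaleN1r. Qed.

Lemma trsB a m x y : trs a m (x - y) = trs a m x - trs a m y.
Proof. by rewrite trsD trsN. Qed.

Lemma trs_add a m1 m2 x : trs a (m1 + m2) x = trs a m1 (trs (a + m1) m2 x).
Proof. by elim: m2 x => [|m2 IH] x; rewrite ?addn0 // addnS /= IH addnA. Qed.

Lemma trs_S a m x : (a + m < n.+1)%N -> S (a + m) x -> S a (trs a m x).
Proof.
elim: m x => [|m IH] x; rewrite ?addn0 // addnS => am Sx /=.
by apply: IH; [lia | apply: tw_TS Sx; lia].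
Qed.

Lemma trs_modl a m x y : (a + m < n)%N -> S (a + m) x -> S a y ->
  trs a m (y * x) = y * trs a m x.
Proof.
elim: m x => [|m IH] x; rewrite ?addn0 // addnS => am Sx Sy /=.
have Sy' : S (a + m) y by apply: tw_SW Sy; lia.
by rewrite T_modl // IH //; [lia | apply: tw_TS Sx; lia].
Qed.

Lemma trs_modr a m x y : (a + m < n)%N -> S (a + m) x -> S a y ->
  trs a m (x * y) = trs a m x * y.
Proof.
elim: m x => [|m IH] x; rewrite ?addn0 // addnS => am Sx Sy /=.
have Sy' : S (a + m) y by apply: tw_SW Sy; lia.
by rewrite T_modr // IH //; [lia | apply: tw_TS Sx; lia].
Qed.

Definition cyclic a m y := S (a + m) y /\
  forall x, S (a + m) x -> trs a m (y * x) = trs a m (x * y).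

Lemma cyclicM a m x y : cyclic a m x -> cyclic a m y -> cyclic a m (x * y).
Proof.
move=> [Sx cx] [Sy cy]; split; first exact: tw_SM.
move=> z Sz; rewrite -mulrA cx; last exact: tw_SM.
by rewrite -mulrA cy ?mulrA //; exact: tw_SM.
Qed.

Lemma cyclicD a m x y : cyclic a m x -> cyclic a m y -> cyclic a m (x + y).
Proof.
move=> [Sx cx] [Sy cy]; split; first exact: tw_SD.
by move=> z Sz; rewrite mulrDl mulrDr !trsD cx // cy.
Qed.

Lemma cyclicZ a m c x : cyclic a m x -> cyclic a m (c *: x).
Proof.
move=> [Sx cx]; split; first exact: tw_SZ.
by move=> z Sz; rewrite -scalerAl -scalerAr !trsZ cx.
Qed.

Lemma cyclic1 a m : cyclic a m 1.
Proof. by split=> [|z Sz]; [exact: tw_S1 | rewrite mul1r mulr1]. Qed.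

Lemma cyclicN a m x : cyclic a m x -> cyclic a m (- x).
Proof. by rewrite -scaleN1r; apply: cyclicZ. Qed.

Lemma cyclic_inv a m x y : x * y = 1 -> y * x = 1 -> S (a + m) y ->
  cyclic a m x -> cyclic a m y.
Proof.
move=> xy yx Sy [Sx cx]; split=> // z Sz.
have := cx (y * z * y) ltac:(by apply: tw_SM => //; apply: tw_SM).
by rewrite !mulrA xy mul1r -!mulrA yx mulr1 => ->.
Qed.

Lemma cyclic_r a m j : (a < j)%N -> (j < a + m)%N -> ((a + m).+1 < n)%N -> cyclic a m (r j).
Proof.
move=> aj jm mn; split; first by apply: tw_SW (tw_Sr t _); lia.
move=> x Sx.
have -> : m = (j - a.+1 + 2 + (a + m - j.+1))%N by lia.
rewrite !(trs_add a (_ + 2)).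
have e : (a + (j - a.+1 + 2) = j.+1)%N by lia.
rewrite e; set m2 := (a + m - j.+1)%N.
have e2 : (j.+1 + m2 = a + m)%N by rewrite /m2; lia.
have Srj : S j.+1 (r j) by apply: tw_Sr; lia.
have -> : trs j.+1 m2 (r j * x) = r j * trs j.+1 m2 x by apply: trs_modl; rewrite ?e2 //; lia.
have -> : trs j.+1 m2 (x * r j) = trs j.+1 m2 x * r j by apply: trs_modr; rewrite ?e2 //; lia.
have Sx' : S j.+1 (trs j.+1 m2 x) by apply: trs_S; rewrite e2 //; lia.
rewrite !addn2 /=; have -> : (a + (j - a.+1)).+1 = j by lia.
have -> : (a + (j - a.+1).+1).+1 = j.+1 by lia.
by rewrite TT_cyc //; lia.
Qed.

Lemma cyclic_ri a m j : (a < j)%N -> (j < a + m)%N -> ((a + m).+1 < n)%N -> cyclic a m (ri j).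
Proof.
move=> aj jm mn; have g : bmw_gen mu lam (r j) (k j) by apply: tw_gen; lia.
apply: (cyclic_inv (bmw_rV g) (bmw_Vr g)); last exact: cyclic_r.
by apply: tw_SW (tw_Sri _); lia.
Qed.

Lemma cyclic_k a m j : (a < j)%N -> (j < a + m)%N -> ((a + m).+1 < n)%N -> cyclic a m (k j).
Proof.
move=> aj jm mn; rewrite (bmw_k_skein lam0 (r j) (k j)).
apply: cyclicD; first exact: cyclic1.
apply/cyclicN/cyclicZ/cyclicD; [exact: cyclic_r|].
by apply: cyclicN; apply: cyclic_ri.
Qed.

End TowerTheory.

(** * Quantum matrices on a tower *)

Section QuantumMatrix.
Variables (C : fieldType) (H : algType C) (q mu lam : C) (n : nat).
Variable (t : tower H mu lam n).
Local Notation r := (tw_r t).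
Local Notation k := (tw_k t).
Local Notation f := (tw_f t).
Local Notation fi := (tw_fi t).
Local Notation S := (tw_S t).
Local Notation T := (tw_T t).
Local Notation ri i := (skein_inv lam (r i) (k i)).
Local Notation trs := (trs t).
Local Notation asy := (asy q mu lam r k).

Variables (M G : H).

Fixpoint Mb j : H := match j with
  | 0 | 1 => M | j'.+1 => f j' * Mb j' * fi j' end.

Lemma MbS j : (0 < j)%N -> Mb j.+1 = f j * Mb j * fi j.
Proof. by case: j. Qed.

Hypothesis (SM : S 1 M) (SG : S 0 G).
Hypothesis relM : r 1%N * (Mb 1 * Mb 2) = Mb 1 * Mb 2 * r 1%N.
Hypothesis relG : Mb 1 * Mb 2 * k 1%N = (mu^-1 * mu^-1) *: (k 1%N * G).

Lemma f_far i j : (i.+1 < j < n)%N -> (0 < i)%N ->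
  [/\ GRing.comm (f i) (f j), GRing.comm (f i) (r j) & GRing.comm (r i) (f j)].
Proof.
move=> ij i0; have Sf : S i.+1 (f i) by apply: tw_Sf; lia.
have Sr : S i.+1 (r i) by apply: tw_Sr; lia.
by split; [apply: tw_Cf Sf|apply: tw_Cr Sf|apply: tw_Cf Sr].
Qed.

Lemma Mb_S j : (0 < j <= n)%N -> S j (Mb j).
Proof.
elim: j => [//|[|j] IH] jn //; rewrite MbS //.
apply: tw_SM; [apply: tw_SM|]; [apply: tw_Sf; lia| |apply: tw_Sfi; lia].
by apply: tw_SW (IH _); lia.
Qed.

Lemma Mb_lt i j : (0 < j < i)%N -> (i < n)%N ->
  GRing.comm (Mb j) (f i) /\ GRing.comm (Mb j) (r i).
Proof.
move=> ji iN; have SMb := @Mb_S j ltac:(lia).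
by split; [apply: tw_Cf SMb; lia|apply: tw_Cr SMb; lia].
Qed.

(** If conjugation by w carries y to x and y commutes with m, then x commutes with
the conjugate of m. *)
Lemma conj_comm (w w' x y m : H) : w * w' = 1 -> w' * w = 1 ->
  x * w = w * y -> GRing.comm y m -> GRing.comm x (w * m * w').
Proof.
move=> ww w'w xw ym; have yw : y * w' = w' * x.
  by apply: (cancelR ww); rewrite -mulrA w'w mulr1 -mulrA xw mulrA w'w mul1r.
by rewrite /GRing.comm !mulrA xw -[w * y * m]mulrA ym -!mulrA yw.
Qed.

Hypotheses (lamE : lam = q - q^-1) (mu0 : mu != 0) (lam0 : lam != 0).

Lemma Mb_gt2 i : (0 < i)%N -> (i.+1 < n)%N ->
  GRing.comm (f i) (Mb i.+2) /\ GRing.comm (r i) (Mb i.+2).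
Proof.
move=> i0 ii; have Mi := @Mb_lt i.+1 i ltac:(lia) ltac:(lia).
have [f1 f1' f2 f2'] : [/\ f i * fi i = 1, fi i * f i = 1,
    f i.+1 * fi i.+1 = 1 & fi i.+1 * f i.+1 = 1].
  by split; [apply: tw_ffi|apply: tw_fif|apply: tw_ffi|apply: tw_fif]; lia.
have ww : f i.+1 * f i * (fi i * fi i.+1) = 1.
  by rewrite -mulrA [f i * (_ * _)]mulrA f1 mul1r f2.
have w'w : fi i * fi i.+1 * (f i.+1 * f i) = 1.
  by rewrite -mulrA [fi i.+1 * (_ * _)]mulrA f2' mul1r f1'.
have -> : Mb i.+2 = f i.+1 * f i * Mb i * (fi i * fi i.+1).
  by rewrite MbS // MbS // !mulrA.
split.
  apply: (conj_comm ww w'w (y := f i.+1)); last exact/commr_sym/Mi.1.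
  by rewrite mulrA tw_fff.
apply: (conj_comm ww w'w (y := r i.+1)); last exact/commr_sym/Mi.2.
by rewrite mulrA tw_rff.
Qed.

Lemma Mb_gt i l : (0 < i)%N -> (i.+1 < l)%N -> (l <= n)%N ->
  GRing.comm (f i) (Mb l) /\ GRing.comm (r i) (Mb l).
Proof.
move=> i0; elim: l => [//|l IH]; rewrite ltnS leq_eqVlt => /orP[/eqP <-|il] ln.
  by apply: Mb_gt2.
have [cf cr] := IH il (ltnW ln); rewrite MbS; last lia.
have [ff fr rf] := @f_far i l ltac:(lia) ltac:(lia).
have Sf : S i.+1 (f i) by apply: tw_Sf; lia.
have Sr : S i.+1 (r i) by apply: tw_Sr; lia.
by split; (apply: commrM; first exact: commrM); [apply: tw_Cfi Sf|apply: tw_Cfi Sr]; lia.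
Qed.

Lemma fMb j : (0 < j < n)%N -> f j * Mb j = Mb j.+1 * f j.
Proof. by move=> jn; rewrite MbS ?(andP jn).1 // -!mulrA tw_fif // mulr1. Qed.

(** Conjugation by f_i f_(i+1) moves everything on the strands i, i+1 up by one
strand; this propagates the relations of M from the first pair of strands to
all others. *)
Lemma ffMb i : (0 < i)%N -> (i.+1 < n)%N ->
  let w := f i * f i.+1 in
  [/\ w * Mb i = Mb i.+1 * w, w * Mb i.+1 = Mb i.+2 * w, w * r i = r i.+1 * w &
      w * k i = k i.+1 * w].
Proof.
move=> i0 ii w; have [cf cr] := @Mb_gt i i.+2 i0 (ltnSn _) ii.
have [cf' cr'] := @Mb_lt i.+1 i ltac:(lia) ii.
have e3 : w * r i = r i.+1 * w by rewrite [RHS]mulrA tw_rff'.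
split=> //.
- by rewrite -mulrA -cf' mulrA fMb; [rewrite mulrA | lia].
- by rewrite -mulrA fMb; [rewrite mulrA cf mulrA | lia].
- by apply: (k_intertwine lam0 _ _ e3); apply: tw_gen; lia.
Qed.

Lemma ff_unit i : (0 < i)%N -> (i.+1 < n)%N ->
  exists w', f i * f i.+1 * w' = 1.
Proof.
move=> i0 ii; exists (fi i.+1 * fi i).
by rewrite -mulrA [f i.+1 * (_ * _)]mulrA tw_ffi ?mul1r ?tw_ffi //; lia.
Qed.

Lemma r_MM i : (0 < i < n)%N -> r i * (Mb i * Mb i.+1) = Mb i * Mb i.+1 * r i.
Proof.
elim: i => [//|[|i] IH] ii; first exact: relM.
have [e1 e2 e3 e4] := @ffMb i.+1 ltac:(lia) ltac:(lia).
have [w' ww] := @ff_unit i.+1 ltac:(lia) ltac:(lia).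
set w := f _ * _ in e1 e2 e3 e4 ww.
have W : w * (Mb i.+1 * Mb i.+2) = Mb i.+2 * Mb i.+3 * w.
  by rewrite mulrA e1 -mulrA e2 mulrA.
apply: (cancelR ww).
rewrite -[LHS]mulrA -W [LHS]mulrA -e3 -[LHS]mulrA IH; last lia.
by rewrite [LHS]mulrA W -[LHS]mulrA e3 mulrA.
Qed.

Lemma MMk i : (0 < i < n)%N ->
  Mb i * Mb i.+1 * k i = (mu^-1 * mu^-1) *: (k i * G).
Proof.
elim: i => [//|[|i] IH] ii; first exact: relG.
have [e1 e2 e3 e4] := @ffMb i.+1 ltac:(lia) ltac:(lia).
have [w' ww] := @ff_unit i.+1 ltac:(lia) ltac:(lia).
set w := f _ * _ in e1 e2 e3 e4 ww.
have cG : GRing.comm G w.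
  by apply: commrM; apply: (tw_Cf _ SG); lia.
have W : w * (Mb i.+1 * Mb i.+2) = Mb i.+2 * Mb i.+3 * w.
  by rewrite mulrA e1 -mulrA e2 mulrA.
apply: (cancelR ww).
rewrite -[LHS]mulrA -e4 [LHS]mulrA -W -[LHS]mulrA IH; last lia.
by rewrite -scalerAr -scalerAl; congr (_ *: _); rewrite mulrA e4 -[LHS]mulrA -[RHS]mulrA cG.
Qed.

Definition PM a b : H := \prod_(a <= j < b) Mb j.+1.

Lemma PM_nil a b : (b <= a)%N -> PM a b = 1.
Proof. by move=> ba; rewrite /PM big_geq. Qed.

Lemma PM_recl a b : (a < b)%N -> PM a b = Mb a.+1 * PM a.+1 b.
Proof. by move=> ab; rewrite /PM big_ltn. Qed.

Lemma PM_recr a b : (a <= b)%N -> PM a b.+1 = PM a b * Mb b.+1.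
Proof. by move=> ab; rewrite /PM big_nat_recr. Qed.

Lemma PM_cat a b c : (a <= b <= c)%N -> PM a c = PM a b * PM b c.
Proof. by move=> /andP[ab bc]; rewrite /PM -big_cat_nat. Qed.

Lemma PM_comm a b x : (forall j, (a < j <= b)%N -> GRing.comm x (Mb j)) ->
  GRing.comm x (PM a b).
Proof.
move=> e; rewrite /PM big_nat; apply: commr_prod => j jab; apply: e; lia.
Qed.

Lemma PM_S a b : (b <= n)%N -> S b (PM a b).
Proof.
elim: b => [|b IH] bn; first by rewrite PM_nil //; apply: tw_S1.
case: (leqP a b) => ab; last by rewrite PM_nil //; apply: tw_S1.
rewrite PM_recr //; apply: tw_SM; last by apply: Mb_S; lia.
by apply: tw_SW (IH (ltnW bn)).
Qed.

Lemma PM_Cr a b i : (0 < i < n)%N -> (b <= n)%N -> i != a -> i != b ->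
  GRing.comm (r i) (PM a b).
Proof.
move=> ii bn ia ib.
have far j : (a < j <= b)%N -> (j != i) -> (j != i.+1) -> GRing.comm (r i) (Mb j).
  move=> jab ji ji1; case: (ltnP j i) => ij.
    by apply: commr_sym; apply: (@Mb_lt i j _ _).2; lia.
  by apply: (@Mb_gt i j _ _ _).2; lia.
case: (boolP (a < i < b)%N) => aib; last by apply: PM_comm => j jab; apply: far => //; lia.
rewrite (@PM_cat a i.-1 b) ?(@PM_recl i.-1) ?(@PM_recl i.-1.+1); try lia.
apply: commrM; first by apply: PM_comm => j jab; apply: far; lia.
rewrite mulrA; apply: commrM; last by apply: PM_comm => j jab; apply: far; lia.
have -> : i.-1.+1 = i by lia.
exact: r_MM.
Qed.

Lemma PM_Ck a b i : (0 < i < n)%N -> (b <= n)%N -> i != a -> i != b ->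
  GRing.comm (k i) (PM a b).
Proof.
move=> ii bn ia ib; have g : bmw_gen mu lam (r i) (k i) by apply: tw_gen.
by apply: commr_sym; apply: (k_intertwine lam0 g g); apply: commr_sym; apply: PM_Cr.
Qed.

Lemma asy_prop (P : H -> Prop) s i :
  P 1 -> (forall x y, P x -> P y -> P (x * y)) ->
  (forall x y, P x -> P y -> P (x + y)) -> (forall c x, P x -> P (c *: x)) ->
  (forall j, (s < j < s + i)%N -> P (r j) /\ P (k j)) -> P (asy s i).
Proof.
move=> P1 PM' PD PZ Prk; apply: (@asf_ind _ _ q mu lam P _ _ i) => // j ji.
by apply: Prk; lia.
Qed.

Lemma asy_S s i : (s + i <= n)%N -> S (s + i) (asy s i).
Proof.
move=> si; apply: asy_prop; [exact: tw_S1|exact: tw_SM|exact: tw_SD|exact: tw_SZ|].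
by move=> j ji; split; [apply: tw_SW (tw_Sr t _)|apply: tw_SW (tw_Sk t _)]; lia.
Qed.

Lemma asy_comm s i x : (forall j, (s < j < s + i)%N ->
  GRing.comm x (r j) /\ GRing.comm x (k j)) -> GRing.comm x (asy s i).
Proof.
move=> e; apply: asy_prop => //; [exact: commr1|by move=> *; exact: commrM|
  by move=> *; exact: commrD|by move=> *; exact: comm_scale].
Qed.

Lemma asy_CS s i m x : (m <= s)%N -> (s + i <= n)%N -> S m x -> GRing.comm x (asy s i).
Proof.
move=> ms si Sx; apply: asy_comm => j ji.
by split; [apply: tw_Cr Sx|apply: tw_Ck Sx]; lia.
Qed.

Lemma asy_PM s i a b : (s + i <= n)%N -> (b <= n)%N ->
  (a <= s)%N || (s + i <= a)%N -> (b <= s)%N || (s + i <= b)%N ->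
  GRing.comm (asy s i) (PM a b).
Proof.
move=> si bn ha hb; apply: commr_sym; apply: asy_comm => j ji.
by split; apply: commr_sym; [apply: PM_Cr|apply: PM_Ck]; lia.
Qed.

Local Notation FF := (stair f).

Lemma FF_S a b : (0 < a)%N -> (b <= n)%N -> (0 < b)%N -> S b (FF a b).
Proof.
move=> a0; elim: b => [//|b IH] bn _.
case: (leqP a b) => ab; last by rewrite stair_nil //; apply: tw_S1.
rewrite stair_recr //; apply: tw_SM; last by apply: tw_Sf; lia.
by apply: tw_SW (IH _ _); lia.
Qed.

Lemma FF_inv a b : (0 < a)%N -> (b <= n)%N -> (0 < b)%N ->
  exists F', [/\ FF a b * F' = 1, F' * FF a b = 1 & S b F'].
Proof.
move=> a0; elim: b => [//|b IH] bn _.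
case: (leqP a b) => ab; last first.
  by exists 1; rewrite stair_nil // mul1r; split=> //; apply: tw_S1.
have [F' [e1 e2 S']] := IH ltac:(lia) ltac:(lia).
have fb : f b * fi b = 1 by apply: tw_ffi; lia.
have fb' : fi b * f b = 1 by apply: tw_fif; lia.
exists (fi b * F'); rewrite stair_recr //; split.
- by rewrite -mulrA [f b * _]mulrA fb mul1r.
- by rewrite -mulrA [F' * _]mulrA e2 mul1r.
- by apply: tw_SM; [apply: tw_Sfi; lia|apply: tw_SW S'; lia].
Qed.

Lemma FF_Mb a b l : (0 < a)%N -> (b <= n)%N -> (a <= l < b)%N ->
  FF a b * Mb l = Mb l.+1 * FF a b.
Proof.
move=> a0 bn /andP[al lb].
have -> : FF a b = FF a l * (f l * FF l.+1 b).
  by rewrite -stair_recl // /stair -big_cat_nat // ltnW.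
have c1 : GRing.comm (Mb l) (FF l.+1 b).
  by apply: stair_comm => j jl; apply: (@Mb_lt j l _ _).1; lia.
have c2 : GRing.comm (Mb l.+1) (FF a l).
  by apply: stair_comm => j jl; apply: commr_sym; apply: (@Mb_gt j l.+1 _ _ _).1; lia.
rewrite -!mulrA -c1 [f l * _]mulrA fMb; last lia.
by rewrite !mulrA c2.
Qed.

Lemma FF_r a b l : (0 < a)%N -> (b <= n)%N -> (a <= l)%N -> (l.+1 < b)%N ->
  FF a b * r l = r l.+1 * FF a b.
Proof.
move=> a0 bn al lb.
have -> : FF a b = FF a l * (f l * (f l.+1 * FF l.+2 b)).
  by rewrite -!stair_recl ?(ltnW lb) // /stair -big_cat_nat //; lia.
have c1 : GRing.comm (r l) (FF l.+2 b).
  by apply: stair_comm => j jl; have [] := @f_far l j ltac:(lia) ltac:(lia).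
have c2 : GRing.comm (r l.+1) (FF a l).
  by apply: stair_comm => j jl; apply: commr_sym; have [] := @f_far j l.+1 ltac:(lia) ltac:(lia).
have [_ _ e _] := @ffMb l ltac:(lia) ltac:(lia).
rewrite -!mulrA -c1 [f l.+1 * (r l * _)]mulrA [f l * (_ * _ * _)]mulrA [f l * (_ * r l)]mulrA e.
by rewrite !mulrA c2.
Qed.

Lemma FF_k a b l : (0 < a)%N -> (b <= n)%N -> (a <= l)%N -> (l.+1 < b)%N ->
  FF a b * k l = k l.+1 * FF a b.
Proof.
move=> a0 bn al lb; apply: (k_intertwine lam0 _ _ (FF_r a0 bn al lb)); apply: tw_gen; lia.
Qed.

Lemma FF_asy a b s i : (0 < a)%N -> (b <= n)%N -> (a <= s.+1)%N -> (s + i < b)%N ->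
  FF a b * asy s i = asy s.+1 i * FF a b.
Proof.
move=> a0 bn aj jb; apply: asf_intertwine => j ji; rewrite addSn.
by split; [apply: FF_r | apply: FF_k]; lia.
Qed.

Lemma FF_PM a b c d : (0 < a)%N -> (b <= n)%N -> (a <= c.+1)%N -> (d < b)%N ->
  FF a b * PM c d = PM c.+1 d.+1 * FF a b.
Proof.
move=> a0 bn ac; elim: d => [|d IH] db.
  by rewrite (@PM_nil c 0) // (@PM_nil c.+1 1) // mulr1 mul1r.
case: (leqP c d) => cd; last first.
  by rewrite (@PM_nil c d.+1) // (@PM_nil c.+1 d.+2) // mulr1 mul1r.
rewrite (PM_recr cd) (@PM_recr c.+1 d.+1) // mulrA IH; last lia.
by rewrite -[LHS]mulrA -[RHS]mulrA FF_Mb //; lia.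
Qed.

(** Conjugation by f_(a+1) ... f_(a+m) moves the traced strands up by one; the
trace does not see it by [T_conj_f]. *)
Lemma trs_FF a m F' x : (a + m.+1 < n)%N -> S (a + m) x ->
  FF a.+1 (a + m).+1 * F' = 1 -> F' * FF a.+1 (a + m).+1 = 1 ->
  trs a.+1 m (FF a.+1 (a + m).+1 * x * F') = trs a m x.
Proof.
elim: m x F' => [|m IH] x F'.
  rewrite addn0 => _ _ /=; rewrite stair_nil // !mul1r => -> _.
  by rewrite mulr1.
rewrite !addnS => amn Sx FF' F'F.
have [F1 [e1 e2 SF1]] := @FF_inv a.+1 (a + m).+1 ltac:(lia) ltac:(lia) ltac:(lia).
have FE : FF a.+1 (a + m).+2 = FF a.+1 (a + m).+1 * f (a + m).+1.
  by rewrite stair_recr //; lia.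
have ff : f (a + m).+1 * fi (a + m).+1 = 1 by apply: tw_ffi; lia.
have F'E : F' = fi (a + m).+1 * F1.
  have : fi (a + m).+1 * F1 * FF a.+1 (a + m).+2 = 1.
    by rewrite FE -mulrA [F1 * _]mulrA e2 mul1r tw_fif //; lia.
  by move/(congr1 ( *%R^~ F')); rewrite -mulrA FF' mulr1 mul1r.
rewrite F'E FE /= addSn.
have SF0 : S (a + m).+1 (FF a.+1 (a + m).+1) by apply: FF_S; lia.
set F0 := FF _ _ in e1 e2 FE SF0 *.
have -> : F0 * f (a + m).+1 * x * (fi (a + m).+1 * F1) =
  F0 * ((f (a + m).+1 * x * fi (a + m).+1) * F1) by rewrite !mulrA.
have Sfxf : S (a + m).+2 (f (a + m).+1 * x * fi (a + m).+1).
  by apply: tw_SM; [apply: tw_SM|]; [apply: tw_Sf|apply: tw_SW Sx|apply: tw_Sfi]; lia.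
have SYF : S (a + m).+2 (f (a + m).+1 * x * fi (a + m).+1 * F1).
  by apply: tw_SM => //; apply: tw_SW SF1.
rewrite (T_modl mu0 lam0 amn SYF SF0) (T_modr mu0 lam0 amn Sfxf SF1).
rewrite (T_conj_f mu0 lam0 amn Sx).
rewrite mulrA IH //; first by lia.
by apply: tw_TS => //; lia.
Qed.

(** The elements a_i. *)
Definition qa i : H := trs 0 i (PM 0 i * asy 0 i).

Lemma qa_S i : (i <= n)%N -> S 0 (qa i).
Proof.
move=> iN; apply: (trs_S mu0 lam0); rewrite add0n //.
by apply: tw_SM; [apply: PM_S|have := @asy_S 0 i; rewrite add0n; apply].
Qed.

Lemma trs_shift m i : (m + i < n)%N -> trs m i (PM m (m + i) * asy m i) = qa i.
Proof.
elim: m => [|m IH] mi; first by rewrite add0n.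
rewrite -IH; last lia.
have [F' [e1 e2 SF']] := @FF_inv m.+1 (m + i).+1 ltac:(lia) ltac:(lia) ltac:(lia).
rewrite -[RHS](@trs_FF m i F') //; last 2 first.
- by lia.
- by apply: tw_SM; [apply: PM_S; lia|apply: asy_S; lia].
congr trs; rewrite mulrA FF_PM; try lia.
rewrite -[in RHS]mulrA -[in RHS]mulrA [FF _ _ * _]mulrA FF_asy; try lia.
by rewrite -mulrA e1 mulr1.
Qed.
(** The product r_(m-1) ... r_1, and in [desc2] its shift by one strand. *)
Fixpoint desc m : H := match m with 0 | 1 => 1 | m'.+1 => r m' * desc m' end.
Fixpoint desc2 m : H := match m with 0 | 1 => 1 | m'.+1 => r m'.+1 * desc2 m' end.

Lemma descS m : (0 < m)%N -> desc m.+1 = r m * desc m.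
Proof. by case: m. Qed.

Lemma desc2_r m : (0 < m)%N -> desc2 m * r 1%N = desc m.+1.
Proof.
elim: m => [//|[|m] IH] _; first by rewrite /= mul1r mulr1.
by rewrite [desc2 _]/= -mulrA IH // [RHS]descS.
Qed.

Lemma desc2S m : (0 < m)%N -> desc2 m.+1 = r m.+1 * desc2 m.
Proof. by case: m. Qed.

Lemma desc01 : [/\ desc 0 = 1, desc 1 = 1, desc2 0 = 1 & desc2 1 = 1].
Proof. by []. Qed.

Opaque desc desc2.

Lemma desc_S m : (m <= n)%N -> S m (desc m).
Proof.
have [d0 d1 _ _] := desc01.
elim: m => [|[|m] IH] mn; [by rewrite d0; apply: tw_S1|by rewrite d1; apply: tw_S1|].
rewrite descS //; apply: tw_SM; first by apply: tw_Sr; lia.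
by apply: tw_SW (IH (ltnW mn)).
Qed.

Lemma desc_comm m x : (forall j, (0 < j < m)%N -> GRing.comm x (r j)) ->
  GRing.comm x (desc m).
Proof.
have [d0 d1 _ _] := desc01.
elim: m => [|[|m] IH] e; [by rewrite d0; exact: commr1|by rewrite d1; exact: commr1|].
rewrite descS //; apply: commrM; first by apply: e; lia.
by apply: IH => j jm; apply: e; lia.
Qed.

Lemma desc_PM m a b : (m <= a)%N -> (m <= b <= n)%N -> GRing.comm (desc m) (PM a b).
Proof.
move=> ma mb; apply: commr_sym; apply: desc_comm => j jm; apply: commr_sym.
by apply: PM_Cr; lia.
Qed.

Lemma FF_desc a m : (0 < a)%N -> (a <= n)%N -> (m < a)%N ->
  FF 1 a * desc m = desc2 m * FF 1 a.
Proof.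
have [d0 d1 d20 d21] := desc01.
move=> a0 an; elim: m => [|[|m] IH] ma; rewrite ?d0 ?d1 ?d20 ?d21 ?mulr1 ?mul1r //.
rewrite descS // desc2S // mulrA FF_r //.
by rewrite -mulrA IH ?mulrA //; lia.
Qed.

(** The trace of all strands but the first, after multiplication by M_1 ... M_l. *)
Definition Phi l x : H := trs 1 l.-1 (PM 0 l * x).

Definition Xp m : H := if m is 0 then 1 else Phi m (desc m).

Lemma Xp1 : Xp 1 = M.
Proof. by have [_ d1 _ _] := desc01; rewrite /Xp /Phi /= d1 mulr1 /PM big_nat1. Qed.

(** The operator f_1 f_2 ... f_m moves the trace that defines X_m up by one strand;
the new crossing r_1 then completes the descent r_m ... r_2 r_1. *)
Lemma Xp_rec m : (m.+2 < n)%N ->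
  Xp m.+1 = M * T 2 (f 1%N * Xp m * fi 1%N * r 1%N).
Proof.
move=> mn; case: m mn => [|m] mn.
  rewrite Xp1 mulr1 tw_ffi; last lia.
  by rewrite mul1r (T_r t mu0 lam0) ?mulr1.
have [F' [e1 e2 SF']] := @FF_inv 2 m.+2 isT ltac:(lia) isT.
have [f1 f1'] : f 1%N * fi 1%N = 1 /\ fi 1%N * f 1%N = 1.
  by split; [apply: tw_ffi|apply: tw_fif]; lia.
set z := PM 0 m.+1 * desc m.+1.
have Sz : S (1 + m) z by apply: tw_SM; [apply: PM_S; lia|apply: desc_S; lia].
have XE : Xp m.+1 = trs 2 m (FF 2 m.+2 * z * F').
  by have := @trs_FF 1 m F' z ltac:(lia) Sz e1 e2.
have SF : S (2 + m) (FF 2 m.+2) by apply: FF_S => //; lia.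
have Sz' : S (2 + m) z by apply: tw_SW Sz; lia.
have SFzF : S (2 + m) (FF 2 m.+2 * z * F') by apply: tw_SM => //; apply: tw_SM.
have Sf1 : S 2 (f 1%N) by apply: tw_Sf; lia.
have Sfi1 : S 2 (fi 1%N) by apply: tw_Sfi; lia.
have Sr1 : S 2 (r 1%N) by apply: tw_Sr; lia.
have mn' : (2 + m < n)%N by lia.
have E : f 1%N * Xp m.+1 * fi 1%N * r 1%N =
   trs 2 m (PM 1 m.+2 * desc m.+2).
  rewrite XE -(trs_modl mu0 lam0 mn' SFzF Sf1).
  have S1 : S (2 + m) (f 1%N * (FF 2 m.+2 * z * F')).
    by apply: tw_SM => //; apply: tw_SW Sf1.
  rewrite -!(trs_modr mu0 lam0 mn') //; last first.
    by apply: tw_SM => //; apply: tw_SW Sfi1.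
  congr trs; rewrite -(@desc2_r m.+1) // /z !mulrA -(stair_recl f) // FF_PM //; last lia.
  rewrite -[_ * _ * desc _]mulrA FF_desc //; try lia.
  rewrite (stair_recl f) // -!mulrA [FF 2 _ * (F' * _)]mulrA e1 mul1r.
  by rewrite [f _ * (fi _ * _)]mulrA f1 mul1r.
rewrite E; have -> : Xp m.+2 = trs 1 m.+1 (M * (PM 1 m.+2 * desc m.+2)).
  by rewrite /Xp /Phi (@PM_recl 0) // mulrA.
rewrite (trs_modl mu0 lam0) //; last first.
  by apply: tw_SM; [apply: PM_S; lia|apply: desc_S; lia].
by congr (_ * _); exact: (trs_add t 1 1 m).
Qed.

(** Factors that may be carried round under [Phi l]: cyclic for the trace of the
strands 2, ..., l, and compatible with M_1 ... M_l. *)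
Definition inner l y := cyclic t 1 l.-1 y /\ GRing.comm y (PM 0 l).

Lemma inner1 l : inner l 1.
Proof. by split; [exact: cyclic1 | exact/commr_sym/commr1]. Qed.

Lemma innerM l x y : inner l x -> inner l y -> inner l (x * y).
Proof.
move=> [cx Cx] [cy Cy]; split; first exact: cyclicM.
by apply/commr_sym/commrM; exact: commr_sym.
Qed.

Lemma innerD l x y : inner l x -> inner l y -> inner l (x + y).
Proof.
move=> [cx Cx] [cy Cy]; split; first exact: cyclicD.
by apply/commr_sym/commrD; exact: commr_sym.
Qed.

Lemma innerZ l c x : inner l x -> inner l (c *: x).
Proof.
move=> [cx Cx]; split; first exact: cyclicZ.
by apply/commr_sym/comm_scale; exact: commr_sym.
Qed.

Lemma inner_r l j : (1 < j < l)%N -> (l.+1 < n)%N -> inner l (r j) /\ inner l (k j).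
Proof.
move=> jl ln; split; split.
- by apply: (cyclic_r t mu0 lam0); lia.
- by apply: PM_Cr; lia.
- by apply: (cyclic_k t mu0 lam0); lia.
- by apply: PM_Ck; lia.
Qed.

Lemma inner_asy l s i : (0 < s)%N -> (s + i <= l)%N -> (l.+1 < n)%N -> inner l (asy s i).
Proof.
move=> s0 sl ln; apply: asy_prop.
- exact: inner1.
- exact: innerM.
- exact: innerD.
- exact: innerZ.
- by move=> j ji; apply: inner_r; lia.
Qed.

Lemma Phi_cyc l x y : (0 < l)%N -> (l <= n)%N -> inner l y -> S l x -> Phi l (y * x) = Phi l (x * y).
Proof.
move=> l0 ln [[Sy cy] Cy] Sx; rewrite /Phi mulrA -Cy -mulrA cy ?mulrA //.
have -> : (1 + l.-1 = l)%N by lia.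
by apply: tw_SM => //; apply: PM_S.
Qed.

Lemma PhiD l x y : Phi l (x + y) = Phi l x + Phi l y.
Proof. by rewrite /Phi mulrDr trsD. Qed.

Lemma PhiB l x y : Phi l (x - y) = Phi l x - Phi l y.
Proof. by rewrite /Phi mulrBr trsB. Qed.

Lemma PhiZ l c x : Phi l (c *: x) = c *: Phi l x.
Proof. by rewrite /Phi -scalerAr trsZ. Qed.

Lemma Phi_split m i x : (0 < m)%N -> (m + i < n)%N -> S m x ->
  GRing.comm x (PM m (m + i)) -> Phi (m + i) (x * asy m i) = Phi m x * qa i.
Proof.
move=> m0 mi Sx Cx; rewrite /Phi.
have -> : ((m + i).-1 = m.-1 + i)%N by lia.
rewrite trs_add; have -> : (1 + m.-1 = m)%N by lia.
rewrite (@PM_cat 0 m) ?leq_addr // -mulrA [PM m _ * _]mulrA -Cx !mulrA -[_ * PM m _ * _]mulrA.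
have SPx : S m (PM 0 m * x) by apply: tw_SM => //; apply: PM_S; lia.
rewrite (trs_modl mu0 lam0) //; last first.
  by apply: tw_SM; [apply: PM_S; lia|apply: asy_S; lia].
rewrite trs_shift // (trs_modr mu0 lam0) //.
- by lia.
- by have -> : (1 + m.-1 = m)%N by lia.
- by apply: tw_SW (qa_S _); lia.
Qed.

Variable ht : nat.
Hypothesis qnum0 : forall i, (2 <= i <= ht)%N -> qnum q i != 0.
Hypothesis mun0 : forall i, (1 <= i <= ht)%N -> mu + q * q ^- (2 * i) != 0.
Local Notation Rm := (@Rm C H q mu lam).

(** The families A(m,i) and B(m,i) of the recursion. *)
Definition qA m i : H := Phi (m + i).-1 (asy m.-1 i * desc m).
Definition qB m i : H := Phi (m + i) (k m * desc m * asy m i).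

Lemma Rm_r_q i : q ^+ i * Rm_r lam (q ^- (2 * i)) = - qnum q i.
Proof.
have q0 := q_neq0 lamE lam0.
rewrite /Rm_r /qnum -lamE; have -> : q ^- (2 * i) = (q ^+ i * q ^+ i)^-1.
  by rewrite -exprD mul2n addnn.
have := expf_neq0 i q0; move: (q ^+ i) => p p0; field.
by rewrite p0 lam0.
Qed.

Local Notation fam := (tw_fam t).

(** Under the trace one of the two antisymmetrizers goes round and merges with the
other.  The terms 1, r_m, k_m of [Rm] respectively split the trace into
X_m a_i, lengthen the descent, and produce B(m,i). *)
Lemma qA_rec m i : (0 < m)%N -> (0 < i <= ht)%N -> ((m + i).+1 < n)%N ->
  q ^+ i *: Phi (m + i) (asy m i * Rm (r m) (k m) (q ^- (2 * i)) * asy m i * desc m) =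
  q ^+ i *: (Xp m * qa i) - qnum q i *: qA m.+1 i
  + (q ^+ i * Rm_k q mu (q ^- (2 * i))) *: qB m i.
Proof.
move=> m0 iht mi; set b := asy m i.
have ib : inner (m + i) b by apply: inner_asy; lia.
have cb : GRing.comm (desc m) b by apply: (asy_CS (leqnn m)) (desc_S _); lia.
have bb : b * b = b by apply: (asy_idem lamE mu0 lam0 qnum0 mun0 fam); lia.
have Sb : S (m + i) b by apply: asy_S; lia.
have Sd : S (m + i) (desc m) by apply: tw_SW (desc_S _); lia.
have Sr : S (m + i) (r m) by apply: tw_SW (tw_Sr t _); lia.
have Sk : S (m + i) (k m) by apply: tw_SW (tw_Sk t _); lia.
have E x : S (m + i) x -> Phi (m + i) (b * x * b * desc m) = Phi (m + i) (x * desc m * b).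
  move=> Sx; rewrite -!mulrA Phi_cyc //; try lia; last by do !apply: tw_SM.
  by rewrite -!mulrA cb [b * (b * _)]mulrA bb.
rewrite E; last first.
  by rewrite /Rm; apply: tw_SD; [apply: tw_SD; [exact: tw_S1|exact: tw_SZ]|exact: tw_SZ].
rewrite /Rm !mulrDl mul1r -!scalerAl !PhiD !PhiZ !scalerDr !scalerA Rm_r_q.
congr (_ + _ + _).
- congr (_ *: _); rewrite Phi_split //; try lia; last by apply: desc_PM; lia.
  + by case: (m) m0.
  + by apply: desc_S; lia.
- rewrite -scaleNr; congr (_ *: _); rewrite -descS // /qA addSn /=.
  rewrite [RHS]Phi_cyc //; try lia.
  by apply: tw_SW (desc_S _); lia.
Qed.

Lemma T_cap_k j x : (0 < j)%N -> (j.+1 < n)%N -> S j x -> T j.+1 (x * k j) = mu *: x.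
Proof.
move=> j0 jn Sx; rewrite (T_modl mu0 lam0) //; last by apply: tw_Sk; lia.
by rewrite (T_k t mu0 lam0) // -scalerAr mulr1.
Qed.

Lemma T_cap_k2 j x y : (0 < j)%N -> (j.+1 < n)%N -> S j x -> S j y ->
  T j.+1 (x * k j * y) = mu *: (x * y).
Proof.
move=> j0 jn Sx Sy; rewrite (T_modr mu0 lam0) //; last first.
  by apply: tw_SM; [apply: tw_SW Sx|apply: tw_Sk; lia].
by rewrite T_cap_k // -scalerAl.
Qed.

Lemma trs_last m x : (0 < m)%N -> trs 1 m x = trs 1 m.-1 (T m.+1 x).
Proof. by case: m. Qed.

(** M_m M_(m+1) k_m gives k_m g, the trace removes k_m, and the next trace
removes r_(m-1) from the descent. *)
Lemma qB_1 m : (0 < m)%N -> (m.+2 < n)%N -> qB m 1 = mu^-1 *: (Xp m.-1 * G).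
Proof.
move=> m0 mn; have [d0 d1 _ _] := desc01.
have SPM : S m.-1 (PM 0 m.-1) by apply: PM_S; lia.
have Sdm : S m (desc m) by apply: desc_S; lia.
have cGd : GRing.comm G (desc m).
  by apply: desc_comm => j jm; apply: tw_Cr SG; lia.
rewrite /qB addn1 /Phi /= (_ : asy m 1 = 1) // mulr1.
have -> : PM 0 m.+1 * (k m * desc m) =
    (mu^-1 * mu^-1) *: (PM 0 m.-1 * k m * desc m * G).
  rewrite (PM_recr (leq0n m)) -{1}(prednK m0) (PM_recr (leq0n _)) prednK //.
  rewrite -!mulrA [Mb m * (_ * _)]mulrA [Mb m * Mb m.+1 * (_ * _)]mulrA MMk; last lia.
  by rewrite -scalerAl -scalerAr -[k m * G * _]mulrA cGd.
have SdG : S m (desc m * G) by apply: tw_SM => //; apply: tw_SW SG.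
have SPM' : S m (PM 0 m.-1) by apply: tw_SW SPM; lia.
have mn1 : (m.+1 < n)%N by lia.
have Tk : T m.+1 (PM 0 m.-1 * k m * desc m * G) = mu *: (PM 0 m.-1 * desc m * G).
  rewrite -mulrA (T_modr mu0 lam0) //; last by apply: tw_SM; [apply: tw_SW SPM'|apply: tw_Sk]; lia.
  by rewrite T_cap_k // -scalerAl mulrA.
rewrite trsZ; have -> : trs 1 m (PM 0 m.-1 * k m * desc m * G) = mu *: (Xp m.-1 * G).
  case: m m0 mn SPM Sdm cGd SdG SPM' mn1 Tk => [//|[|m]] _ mn SPM Sdm cGd SdG SPM' mn1 Tk.
    by rewrite /= Tk (PM_nil (leqnn 0)) d1 !mul1r.
  rewrite [LHS]/= add1n Tk tw_TZ trsZ /=; congr (_ *: _).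
  have SdmG : S m.+1 (desc m.+1 * G) by apply: tw_SM; [apply: desc_S; lia|apply: tw_SW SG].
  rewrite descS // -mulrA -[r _ * _ * G]mulrA mulrA ?add1n.
  rewrite (T_modr mu0 lam0) //; first last.
  - by apply: tw_SM; [apply: tw_SW SPM'|apply: tw_Sr]; lia.
  - by lia.
  rewrite (T_modl mu0 lam0) //; first last.
  - by apply: tw_Sr; lia.
  - by lia.
  rewrite (T_r t mu0 lam0) // ?mulr1; last lia.
  rewrite mulrA (trs_modr mu0 lam0) //; first last.
  - by apply: tw_SW SG.
  - by rewrite add1n; apply: tw_SM => //; apply: desc_S; lia.
  by rewrite add1n; lia.
by rewrite !scalerA -mulrA mulVf // mulr1.
Qed.

(** A staircase of caps is a strand that runs diagonally, past which everything
moves up by two strands. *)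
Lemma cap_slide a b l : (0 < a)%N -> (b <= n)%N -> (a <= l)%N -> (l.+2 < b)%N ->
  stair k a b * r l = r l.+2 * stair k a b.
Proof.
move=> a0 bn al lb.
have -> : stair k a b = stair k a l * (k l * (k l.+1 * (k l.+2 * stair k l.+3 b))).
  by rewrite -!stair_recl; try lia; rewrite /stair -big_cat_nat //; lia.
have SR : S l.+1 (r l) by apply: tw_Sr; lia.
have c1 : GRing.comm (r l) (stair k l.+3 b).
  by apply: stair_comm => j jl; apply: tw_Ck SR; lia.
have c2 : GRing.comm (r l.+2) (stair k a l).
  apply: stair_comm => j jl; apply: commr_sym.
  by apply: (@tw_Cr _ _ _ _ _ t j.+1); [lia|apply: tw_Sk; lia].
have c3 : GRing.comm (r l) (k l.+2) by apply: tw_Ck SR; lia.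
have c4 : GRing.comm (r l.+2) (k l).
  by apply/commr_sym; apply: (@tw_Cr _ _ _ _ _ t l.+1); [lia|apply: tw_Sk; lia].
have a1 := @tw_adj _ _ _ _ _ t l ltac:(lia) ltac:(lia).
have a2 := @tw_adj _ _ _ _ _ t l.+1 ltac:(lia) ltac:(lia).
have e : k l * k l.+1 * r l * k l.+2 = r l.+2 * k l * k l.+1 * k l.+2.
  by rewrite (adj_kkr12 a1) c4 -!mulrA [r l.+2 * _]mulrA (adj_rkk12 a2).
rewrite [RHS]mulrA c2 -!mulrA; congr (_ * _).
by rewrite -c1 [k l.+2 * (r l * _)]mulrA -c3 !mulrA e.
Qed.

Lemma cap_slide_asy a b s i : (0 < a)%N -> (b <= n)%N -> (a <= s.+1)%N -> ((s + i).+1 < b)%N ->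
  stair k a b * asy s i = asy s.+2 i * stair k a b.
Proof.
move=> a0 bn aj jb; apply: asf_intertwine => j ji; rewrite !addSn.
have e : stair k a b * r (s + j)%N = r (s + j).+2 * stair k a b by apply: cap_slide; lia.
by split=> //; apply: (k_intertwine lam0 _ _ e); apply: tw_gen; lia.
Qed.

(** The product r_(m+l)^-1 ... r_(m+1)^-1. *)
Fixpoint dinv m l : H := if l is l'.+1 then ri (m + l').+1 * dinv m l' else 1.

Lemma dinv_S m l : (m + l < n)%N -> S (m + l).+1 (dinv m l).
Proof.
elim: l => [|l IH] mln; first exact: tw_S1.
rewrite addnS; apply: tw_SM; first by apply: tw_Sri; lia.
by apply: tw_SW (IH _); lia.
Qed.

Lemma dinv_comm m l x : (forall j, (m < j <= m + l)%N -> GRing.comm x (ri j)) ->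
  GRing.comm x (dinv m l).
Proof.
elim: l => [|l IH] e; first exact: commr1.
by apply: commrM; [apply: e; lia|apply: IH => j jm; apply: e; lia].
Qed.

(** k_j = k_j k_(j+1) r_j^-1 r_(j+1)^-1, and r_(j+1)^-1 is the scalar - q on the
antisymmetrizer: this lengthens the staircase of caps strand by strand, until it
reaches across the whole antisymmetrizer. *)
Lemma cap_stretch m i l : (0 < m)%N -> (m.+1 + i <= n)%N -> (i <= ht)%N -> (l < i)%N ->
  k m * k m.+1 * asy m.+1 i =
  (- q) ^+ l *: (stair k m (m + l).+2 * dinv m l * asy m.+1 i).
Proof.
move=> m0 min iht; elim: l => [|l IH] li.
  rewrite addn0 expr0 scale1r /= mulr1 (stair_recr _ (leqnSn m)) (stair_recr _ (leqnn m)).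
  by rewrite (stair_nil _ (leqnn m)) mul1r.
rewrite IH; last lia.
rewrite addnS (@stair_recr _ _ k m (m + l).+2); last lia.
have adj := @tw_adj _ _ _ _ _ t (m + l).+1 ltac:(lia) ltac:(lia).
have [g1 g2] := (adj_gen1 adj, adj_gen2 adj).
have kE : k (m + l).+1 = k (m + l).+1 * k (m + l).+2 * ri (m + l).+1 * ri (m + l).+2.
  rewrite -(adj_krr12 adj) -[_ * _ * ri (m + l).+1]mulrA (bmw_rV g1) mulr1 -mulrA.
  by rewrite (bmw_rV g2) mulr1.
have rb : ri (m + l).+2 * asy m.+1 i = - q *: asy m.+1 i.
  apply: (skein_absorb lamE lam0 g2).
  by apply: (asy_absorb lamE mu0 lam0 qnum0 mun0 fam); lia.
have SD := @dinv_S m l ltac:(lia).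
have cD : GRing.comm (dinv m l) (ri (m + l).+2) by apply: tw_Cri SD; lia.
rewrite (@stair_recr _ _ k m (m + l).+1); last lia.
rewrite {1}kE /= exprSr -scalerA; congr (_ *: _).
rewrite scalerAr -rb -!mulrA; do 4 congr (_ * _).
by rewrite !mulrA -cD.
Qed.

Lemma stair_r_S a b : (0 < a)%N -> (b <= n)%N -> S b (stair r a b).
Proof.
move=> a0; elim: b => [|b IH] bn; first by rewrite stair_nil //; apply: tw_S1.
case: (leqP a b) => ab; last by rewrite stair_nil //; apply: tw_S1.
rewrite stair_recr //; apply: tw_SM; last by apply: tw_Sr; lia.
by apply: tw_SW (IH (ltnW bn)).
Qed.

Lemma stair_k_S a b : (0 < a)%N -> (b <= n)%N -> S b (stair k a b).
Proof.
move=> a0; elim: b => [|b IH] bn; first by rewrite stair_nil //; apply: tw_S1.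
case: (leqP a b) => ab; last by rewrite stair_nil //; apply: tw_S1.
rewrite stair_recr //; apply: tw_SM; last by apply: tw_Sk; lia.
by apply: tw_SW (IH (ltnW bn)).
Qed.

(** The inverse crossings left over by [cap_stretch] turn caps back into crossings:
r_(j+1)^-1 k_j k_(j+1) = r_j k_(j+1). *)
Lemma caps_contract m l z : (0 < m)%N -> (m + l < n)%N -> S m z ->
  dinv m l * (z * stair k m (m + l).+1) = z * stair r m (m + l) * k (m + l)%N.
Proof.
move=> m0; elim: l => [|l IH] mln Sz.
  rewrite addn0 /= mul1r (stair_nil r (leqnn m)) mulr1 (stair_recr k (leqnn m)).
  by rewrite (stair_nil k (leqnn m)) mul1r.
have adj := @tw_adj _ _ _ _ _ t (m + l)%N ltac:(lia) ltac:(rewrite addnS in mln; lia).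
rewrite addnS (@stair_recr _ _ k m (m + l).+1); last lia.
rewrite (@stair_recr _ _ r m (m + l)); last lia.
rewrite [z * (_ * _)]mulrA [dinv m l.+1]/= -mulrA [dinv m l * _]mulrA IH; try lia; last by [].
have g1 := adj_gen1 adj; have g2 := adj_gen2 adj.
have rkk : ri (m + l).+1 * k (m + l)%N * k (m + l).+1 = r (m + l)%N * k (m + l).+1.
  by rewrite -mulrA -(adj_rrk12 adj) !mulrA (bmw_Vr g2) mul1r.
have Sst : S (m + l) (stair r m (m + l)) by apply: stair_r_S; lia.
have Szs : S (m + l) (z * stair r m (m + l)).
  by apply: tw_SM => //; apply: tw_SW Sz; lia.
have c : GRing.comm (z * stair r m (m + l)) (ri (m + l).+1) by apply: tw_Cri Szs; lia.
rewrite -[_ * k (m + l)%N * _]mulrA [ri _ * _]mulrA -c -!mulrA [ri _ * (k _ * _)]mulrA rkk.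
by rewrite !mulrA.
Qed.

Lemma stair_absorb s i l : (0 < s)%N -> (s.-1 + i <= n)%N -> (i <= ht)%N -> (l < i)%N ->
  stair r s (s + l) * asy s.-1 i = (- q^-1) ^+ l *: asy s.-1 i.
Proof.
move=> s0 sin iht; elim: l => [|l IH] li.
  by rewrite addn0 (stair_nil r (leqnn s)) mul1r scale1r.
rewrite addnS (stair_recr r (leq_addr l s)) -mulrA.
rewrite (asy_absorb lamE mu0 lam0 qnum0 mun0 fam) //; last lia.
by rewrite -scalerAr IH ?scalerA ?exprS //; lia.
Qed.

Lemma PM_caps m p : (0 < m)%N -> (m <= p.+1)%N -> (p.+2 < n)%N ->
  PM 0 p.+2 * stair k m p.+2 = (mu^-1 * mu^-1) *: (stair k m p.+2 * PM 0 p * G).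
Proof.
move=> m0 mp pn.
have c : GRing.comm (PM 0 p.+2) (stair k m p.+1).
  by apply: stair_comm => j jm; apply: commr_sym; apply: PM_Ck; lia.
have SPM : S p (PM 0 p) by apply: PM_S; lia.
have c2 : GRing.comm (PM 0 p) (k p.+1) by apply: tw_Ck SPM; lia.
have PE : PM 0 p.+2 = PM 0 p * (Mb p.+1 * Mb p.+2).
  by rewrite (@PM_recr 0 p.+1) // (@PM_recr 0 p) // mulrA.
rewrite (stair_recr k mp) mulrA c -mulrA PE -mulrA MMk; last lia.
by rewrite -!scalerAr [PM 0 p * _]mulrA c2 !mulrA.
Qed.

(** The two terms of [qB_rec] in which the caps k_m k_(m+1) meet.  The caps are
stretched across the antisymmetrizer; they turn the last two M's into g; carried
round the trace, they reach the antisymmetrizer from the other side and move it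
down by two strands; there two traces remove them.  The powers of - q picked up
while stretching cancel against those of - q^-1 from the crossings that the
antisymmetrizer absorbs at the end. *)
Lemma qPhi_caps m i y0 Z : (1 < m)%N -> (0 < i <= ht)%N -> ((m + i).+2 < n)%N ->
  S m.+1 y0 -> GRing.comm G y0 -> S m Z -> y0 * k m = Z * k m ->
  Phi (m + i).+1 (k m * k m.+1 * y0 * desc m.-1 * asy m.+1 i) =
  Phi (m + i).-1 (Z * desc m.-1 * asy m.-1 i) * G.
Proof.
move=> m1 iht mi Sy cy SZ yZ.
have [l il] : exists l, i = l.+1 by exists i.-1; lia.
have [p pE] : exists p, p.+1 = (m + i)%N by exists (m + i).-1; lia.
have pml : p = (m + l)%N by lia.
set b := asy m.+1 i; set b' := asy m.-1 i; set d := desc m.-1.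
set E := stair k m p.+2; set D := dinv m l.
have Sd' : S m.-1 d by apply: desc_S; lia.
have Sd : S m d by apply: tw_SW Sd'; lia.
have Sb' : S p b' by rewrite /b' (_ : p = m.-1 + i)%N; [apply: asy_S; lia|lia].
have Syd : S m.+1 (y0 * d) by apply: tw_SM => //; apply: tw_SW Sd.
have cb : GRing.comm (y0 * d) b by apply: asy_CS Syd; lia.
have SD : S p.+1 D by rewrite pml; apply: dinv_S; lia.
have Sb : S p.+2 b by rewrite pE -addSn; apply: asy_S; lia.
have SE : S p.+2 E by apply: stair_k_S; lia.
have SX : S p.+2 (D * (y0 * d) * b).
  apply: tw_SM => //; apply: tw_SM; first by apply: tw_SW SD.
  by apply: tw_SW Syd; lia.
have cG j : (0 < j < n)%N -> [/\ GRing.comm G (r j), GRing.comm G (k j) & GRing.comm G (ri j)].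
  by move=> jn; split; [apply: tw_Cr SG|apply: tw_Ck SG|apply: tw_Cri SG]; lia.
have cGd : GRing.comm G d by apply: desc_comm => j jm; have [] := cG j ltac:(lia).
have cGD : GRing.comm G D by apply: dinv_comm => j jm; have [] := cG j ltac:(lia).
have cGb : GRing.comm G b by apply: asy_CS SG; lia.
have cGE : GRing.comm G E by apply: stair_comm => j jm; have [] := cG j ltac:(lia).
have cGX : GRing.comm G (D * (y0 * d) * b).
  by apply: commrM => //; apply: commrM => //; apply: commrM.
have cycE : cyclic t 1 p.+1 E.
  rewrite /E /stair big_nat; apply: big_ind => [|x y|j jm]; first exact: cyclic1.
    exact: cyclicM.
  by apply: (cyclic_k t mu0 lam0); lia.
(* The caps, stretched by [cap_stretch] over all strands of b. *)
have -> : k m * k m.+1 * y0 * d * b = (- q) ^+ l *: (E * (D * (y0 * d) * b)).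
  have st := @cap_stretch m i l ltac:(lia) ltac:(lia) ltac:(lia) ltac:(lia).
  rewrite -pml -/b -/E -/D in st.
  rewrite -[_ * y0 * d]mulrA -[_ * (y0 * d) * b]mulrA cb mulrA st -scalerAl.
  by congr (_ *: _); rewrite -[E * D * b * _]mulrA -cb -!mulrA.
rewrite PhiZ /Phi -pE [p.+2.-1]/= [p.+1.-1]/= mulrA PM_caps; try lia.
rewrite -/E -scalerAl trsZ -[_ * G * _]mulrA cGX -mulrA (cycE.2 _ _); last first.
  rewrite add1n; apply: tw_SM; first by apply: tw_SW (PM_S _ _); lia.
  by apply: tw_SM => //; apply: tw_SW SG.
(* The caps have gone round the trace and now stand on the right: b passes them. *)
have bE : b * E = E * b'.
  have := @cap_slide_asy m p.+2 m.-1 i ltac:(lia) ltac:(lia) ltac:(lia) ltac:(lia).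
  by have -> : m.-1.+2 = m.+1 by lia.
have dE : d * E = E * d.
  by apply: stair_comm => j jm; apply: tw_Ck Sd'; lia.
have kE : E = k m * stair k m.+1 p.+2 by apply: stair_recl; lia.
have yE : y0 * E = Z * E by rewrite kE !mulrA yZ.
set W := Z * stair r m p.
have DZE : D * (Z * E) = W * k p * k p.+1.
  rewrite /E (@stair_recr _ _ k m p.+1); last lia.
  have := @caps_contract m l Z ltac:(lia) ltac:(lia) SZ; rewrite -pml => cc.
  by rewrite [Z * (_ * _)]mulrA [D * (_ * _)]mulrA cc.
have XE : D * (y0 * d) * b * E = W * k p * k p.+1 * (d * b').
  rewrite -mulrA bE -mulrA -[y0 * d * _]mulrA [d * (E * _)]mulrA dE -[E * d * _]mulrA.
  by rewrite [y0 * (E * _)]mulrA yE mulrA DZE.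
have SW : S p W.
  by apply: tw_SM; [apply: tw_SW SZ; lia|apply: stair_r_S; lia].
have Sdb : S p (d * b') by apply: tw_SM => //; apply: tw_SW Sd'; lia.
have SPW : S p (PM 0 p * W) by apply: tw_SM => //; apply: PM_S; lia.
have p0 : (0 < p)%N by lia.
have -> : PM 0 p * (D * (y0 * d) * b * G) * E = PM 0 p * W * k p * k p.+1 * (d * b') * G.
  by rewrite -[LHS]mulrA -[_ * G * E]mulrA cGE [_ * (E * G)]mulrA XE !mulrA.
have SPWk : S p.+1 (PM 0 p * W * k p).
  by apply: tw_SM; [apply: tw_SW SPW|apply: tw_Sk; lia].
have Sdb1 : S p.+1 (d * b') by apply: tw_SW Sdb.
rewrite (trs_modr mu0 lam0) //; first last.
- by apply: tw_SW SG.
- rewrite add1n; apply: tw_SM; last by apply: tw_SW Sdb; lia.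
  by apply: tw_SM; [apply: tw_SW SPWk|apply: tw_Sk]; lia.
- by rewrite add1n; lia.
have p2n : (p.+2 < n)%N by lia.
have TT : trs 1 p.+1 (PM 0 p * W * k p * k p.+1 * (d * b')) =
    (mu * mu) *: trs 1 p.-1 (PM 0 p * W * (d * b')).
  rewrite (@trs_last p.+1) // (@trs_last p) // T_cap_k2 // tw_TZ T_cap_k2 //; last lia.
  by rewrite scalerA trsZ.
rewrite TT scalerAl scalerA scalerAl scalerA.
congr (_ * _).
have Wd : W * (d * b') = (- q^-1) ^+ l *: (Z * d * b').
  have sb := @stair_absorb m i l ltac:(lia) ltac:(lia) ltac:(lia) ltac:(lia).
  have sd : stair r m p * d = d * stair r m p.
    by apply/esym; apply: stair_comm => j jm; apply: tw_Cr Sd'; lia.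
  rewrite -pml -/b' in sb.
  by rewrite /W -mulrA [stair r m p * _]mulrA sd -mulrA sb -!scalerAr mulrA.
rewrite -[PM 0 p * W * _]mulrA Wd -scalerAr trsZ scalerA -[RHS]scale1r.
congr (_ *: _); have q0 := q_neq0 lamE lam0.
by rewrite mulrAC -exprMn mulrNN mulfV // expr1n mul1r mulrACA !mulVf // mulr1.
Qed.

(** Expansion as in [qA_rec].  In the term with r_(m+1) one uses
k_m r_(m+1) = k_m k_(m+1) r_m^-1 and
r_m^-1 r_(m-1) k_m = (k_(m-1) - lam r_(m-1) + lam mu^-1) k_m, whose three parts
give B(m-1,i), A(m,i) and X_(m-1) a_i. *)
Lemma qB_rec m i : (1 < m)%N -> (0 < i < ht)%N -> ((m + i).+3 < n)%N ->
  GRing.comm G (qa i) ->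
  qnum q i.+1 *: qB m i.+1 =
  (q ^+ i * mu^-1) *: (Xp m.-1 * qa i * G)
  - qnum q i *: ((qB m.-1 i - lam *: qA m i + (lam / mu) *: (Xp m.-1 * qa i)) * G)
  + (q ^+ i * Rm_k q mu (q ^- (2 * i))) *: (qA m i * G).
Proof.
move=> m1 iht mi cGa; set b := asy m.+1 i.
have ib : inner (m + i).+1 b by apply: inner_asy; lia.
have Sdm : S m (desc m) by apply: desc_S; lia.
have Sdm' : S m.-1 (desc m.-1) by apply: desc_S; lia.
have Skm : S m.+1 (k m) by apply: tw_Sk; lia.
have cd : GRing.comm (desc m) b by apply: asy_CS Sdm; lia.
have ck : GRing.comm (k m) b by apply: asy_CS Skm; lia.
have bb : b * b = b by apply: (asy_idem lamE mu0 lam0 qnum0 mun0 fam); lia.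
have Sb : S (m + i).+1 b by rewrite -addSn; apply: asy_S; lia.
have Sd : S (m + i).+1 (desc m) by apply: tw_SW Sdm; lia.
have Sk : S (m + i).+1 (k m) by apply: tw_SW Skm; lia.
have Sr1 : S (m + i).+1 (r m.+1) by apply: tw_SW (tw_Sr t _); lia.
have Sk1 : S (m + i).+1 (k m.+1) by apply: tw_SW (tw_Sk t _); lia.
have q0 : qnum q i.+1 != 0 by apply: qnum0; lia.
have E : qnum q i.+1 *: qB m i.+1 =
    q ^+ i *: Phi (m + i).+1 (k m * Rm (r m.+1) (k m.+1) (q ^- (2 * i)) * desc m * b).
  rewrite /qB addnS (asyS lamE mu0 lam0 qnum0 mun0 fam) //; last lia.
  rewrite -scalerAr PhiZ scalerA mulrC mulfVK //; congr (_ *: _).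
  rewrite -/b; set X := Rm _ _ _.
  have SX : S (m + i).+1 X.
    by rewrite /X /Rm; apply: tw_SD; [apply: tw_SD; [exact: tw_S1|exact: tw_SZ]|exact: tw_SZ].
  have cX : GRing.comm (desc m) X by apply: comm_Rm; [apply: tw_Cr Sdm|apply: tw_Ck Sdm]; lia.
  have -> : k m * desc m * (b * X * b) = b * (k m * desc m * X * b).
    have ckd : GRing.comm (k m * desc m) b by apply/commr_sym/commrM; exact: commr_sym.
    by rewrite -[b * X * b]mulrA [LHS]mulrA ckd !mulrA.
  rewrite Phi_cyc //; try lia; last by do !apply: tw_SM.
  by rewrite -[_ * b * b]mulrA bb -[k m * desc m * X]mulrA cX mulrA.
have {}E : qnum q i.+1 *: qB m i.+1 = q ^+ i *: Phi (m + i).+1 (k m * desc m * b)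
   - qnum q i *: Phi (m + i).+1 (k m * r m.+1 * desc m * b)
   + (q ^+ i * Rm_k q mu (q ^- (2 * i))) *: Phi (m + i).+1 (k m * k m.+1 * desc m * b).
  rewrite E /Rm !mulrDr !mulrDl mulr1 -!scalerAr -!scalerAl !PhiD !PhiZ !scalerDr !scalerA.
  by rewrite Rm_r_q scaleNr.
have adj := @tw_adj _ _ _ _ _ t m ltac:(lia) ltac:(lia).
have [g1 g2] := (adj_gen1 adj, adj_gen2 adj).
have adj0 := @tw_adj _ _ _ _ _ t m.-1 ltac:(lia) ltac:(lia).
rewrite prednK // in adj0; last lia.
have dE : desc m = r m.-1 * desc m.-1 by rewrite -descS ?prednK //; lia.
have Srm1 : S m (r m.-1) by rewrite -{1}(prednK (ltnW m1)); apply: tw_Sr; lia.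
have Skm1 : S m (k m.-1) by rewrite -{1}(prednK (ltnW m1)); apply: tw_Sk; lia.
have cGj j : (0 < j < n)%N -> [/\ GRing.comm G (r j), GRing.comm G (k j) & GRing.comm G (ri j)].
  by move=> jn; split; [apply: tw_Cr SG|apply: tw_Ck SG|apply: tw_Cri SG]; lia.
have qAE : Phi (m + i).-1 (r m.-1 * desc m.-1 * asy m.-1 i) = qA m i.
  rewrite -dE /qA [RHS]Phi_cyc //; try lia.
  - by apply: inner_asy; lia.
  - by apply: tw_SW Sdm; lia.
have cdr : GRing.comm (desc m) (r m.+1) by apply: tw_Cr Sdm; lia.
have cdk : GRing.comm (desc m) (k m.+1) by apply: tw_Ck Sdm; lia.
have pm : ((m + i).-1 = m.-1 + i)%N by lia.
have XE : Phi (m + i).-1 (desc m.-1 * asy m.-1 i) = Xp m.-1 * qa i.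
  rewrite pm Phi_split //; try lia; last by apply: desc_PM; lia.
  by case: (m) m1 => [|[]].
have t1 : Phi (m + i).+1 (k m * desc m * b) = mu^-1 *: (Xp m.-1 * qa i * G).
  rewrite -addSn Phi_split //; try lia.
  - have := qB_1 (ltnW m1) ltac:(lia); rewrite /qB addn1 (_ : asy m 1 = 1) // mulr1 => ->.
    by rewrite -scalerAl -!mulrA cGa.
  - by apply: tw_SM => //; apply: tw_SW Sdm.
  - apply/commr_sym; apply: commrM; apply: commr_sym; first by apply: PM_Ck; lia.
    by apply: desc_PM; lia.
have t2 : Phi (m + i).+1 (k m * r m.+1 * desc m * b) =
    (qB m.-1 i - lam *: qA m i + (lam / mu) *: (Xp m.-1 * qa i)) * G.
  have e : k m * r m.+1 * desc m * b =
      k m * k m.+1 * (ri m * r m.-1) * desc m.-1 * b.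
    rewrite -(adj_krr12 adj) dE !mulrA -[_ * r m * ri m]mulrA (bmw_rV g1) mulr1 //.
  pose Z := k m.-1 - lam *: r m.-1 + (lam / mu) *: 1.
  have SZ : S m Z.
    by apply: tw_SD; [apply: tw_SB => //; exact: tw_SZ|apply: tw_SZ; exact: tw_S1].
  have yZ : ri m * r m.-1 * k m = Z * k m.
    have -> : ri m * r m.-1 * k m =
        r m * r m.-1 * k m - lam *: (r m.-1 * k m - k m * r m.-1 * k m).
      by rewrite /skein_inv !mulrBl -!scalerAl !mulrBl mul1r.
    rewrite (adj_rrk12 adj0) (bmw_krk mu0 adj0) scalerBr scalerA opprB addrA addrAC.
    by rewrite /Z mulrDl mulrBl -!scalerAl mul1r.
  rewrite e (@qPhi_caps m i _ Z) //; try lia.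
  - congr (_ * _); rewrite /Z !mulrDl !mulNr -!scalerAl mul1r PhiD PhiB !PhiZ.
    by rewrite qAE XE /qB pm.
  - by apply: tw_SM; [apply: tw_Sri; lia|apply: tw_SW Srm1].
  - by apply: commrM; [have [] := cGj m ltac:(lia)|have [] := cGj m.-1 ltac:(lia)].
have t3 : Phi (m + i).+1 (k m * k m.+1 * desc m * b) = qA m i * G.
  rewrite dE mulrA (@qPhi_caps m i _ (r m.-1)) //; try lia.
  - by rewrite qAE.
  - by apply: tw_SW Srm1.
  - by have [] := cGj m.-1 ltac:(lia).
by rewrite E t1 t2 t3 scalerA.
Qed.

Lemma stair_r_inv a b : (0 < a)%N -> (b <= n)%N ->
  exists2 w, stair r a b * w = 1 /\ w * stair r a b = 1 & S b w.
Proof.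
move=> a0; elim: b => [|b IH] bn.
  by exists 1; rewrite ?stair_nil ?mul1r //; apply: tw_S1.
case: (leqP a b) => ab; last first.
  by exists 1; rewrite ?stair_nil ?mul1r //; apply: tw_S1.
have [w [e1 e2] Sw] := IH (ltnW bn).
have g : bmw_gen mu lam (r b) (k b) by apply: tw_gen; lia.
exists (ri b * w); rewrite ?(stair_recr r ab).
  split; first by rewrite -mulrA [r b * _]mulrA (bmw_rV g) mul1r.
  by rewrite -mulrA [w * _]mulrA e2 mul1r (bmw_Vr g).
by apply: tw_SM; [apply: tw_Sri; lia|apply: tw_SW Sw].
Qed.

Lemma trs2_k a z : (a.+2 < n)%N -> S a z ->
  trs a 2 (k a.+1 * z) = (mu * (mu * loop_val q mu lam)) *: z.
Proof.
move=> an Sz; rewrite /= addn1 addn0.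
have Sz1 : S a.+1 z by apply: tw_SW Sz.
rewrite (T_modr mu0 lam0) //; last by apply: tw_Sk; lia.
rewrite (T_k t mu0 lam0) // -scalerAl mul1r tw_TZ -[z in T _ z]mul1r.
rewrite (T_modr mu0 lam0) ?(T_1 t lamE mu0 lam0) //; try lia; last exact: tw_S1.
by rewrite -scalerAl mul1r scalerA.
Qed.

(** On i+2 strands, the trace of M_1 ... M_(i+2) with a^(i) and a cap k is a
multiple of g a_i if the cap is on the first two strands, and of a_i g if it is
on the last two.  The square of a staircase rotates the one picture into the
other, and the full trace is invariant under this conjugation. *)
Lemma G_qa i : (0 < i <= ht)%N -> (i.+4 < n)%N -> loop_val q mu lam != 0 -> GRing.comm G (qa i).
Proof.
move=> iht iN eta0; set V := stair r 1 i.+2.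
have [w [Vw wV] Sw] := @stair_r_inv 1 i.+2 isT ltac:(lia).
have SV : S i.+2 V by apply: stair_r_S; lia.
have wrap : V * V * r i.+1 = r 1%N * (V * V).
  by apply: (stair_wrap mu0 lam0 fam); lia.
have wk : V * V * k i.+1 = k 1%N * (V * V).
  by apply: (k_intertwine lam0 _ _ wrap); apply: tw_gen; lia.
have Va : V * V * asy 0 i = asy 2 i * (V * V).
  rewrite -mulrA (stair_shift_asy q mu0 lam0 fam) //; try lia.
  rewrite mulrA (stair_shift_asy q mu0 lam0 fam) ?mulrA //; lia.
have cV : GRing.comm V (PM 0 i.+2).
  by apply/commr_sym/stair_comm => j jl; apply/commr_sym/PM_Cr; lia.
have cyV : cyclic t 0 i.+2 V.
  rewrite /V /stair big_nat; apply: big_ind => [|x y|j jm]; first exact: cyclic1.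
    exact: cyclicM.
  by apply: (cyclic_r t mu0 lam0); lia.
have cyW := cyclicM cyV cyV.
have cW : GRing.comm (V * V) (PM 0 i.+2) by apply/commr_sym/commrM; exact: commr_sym.
have Sa0 : S i (asy 0 i) by have := @asy_S 0 i ltac:(lia).
have Sa2 : S i.+2 (asy 2 i) by have := @asy_S 2 i ltac:(lia).
have Sk : S i.+2 (k i.+1) by apply: tw_Sk; lia.
have SX : S i.+2 (asy 0 i * k i.+1) by apply: tw_SM => //; apply: tw_SW Sa0; lia.
have SPM : S i.+2 (PM 0 i.+2) by apply: PM_S; lia.
have key : trs 0 i.+2 (PM 0 i.+2 * (asy 2 i * k 1%N)) =
    trs 0 i.+2 (PM 0 i.+2 * (asy 0 i * k i.+1)).
  have WW : V * V * (w * w) = 1 by rewrite -mulrA [V * (w * w)]mulrA Vw mul1r Vw.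
  have W'W : w * w * (V * V) = 1 by rewrite -mulrA [w * (V * V)]mulrA wV mul1r wV.
  have e : asy 2 i * k 1%N = V * V * (asy 0 i * k i.+1 * (w * w)).
    rewrite !mulrA Va -[_ * (V * V) * k _]mulrA wk -!mulrA [V * (w * w)]mulrA Vw mul1r Vw.
    by rewrite mulr1.
  rewrite e mulrA -cW -mulrA (cyW.2 _ _) ?add0n; last first.
    by apply: tw_SM => //; apply: tw_SM => //; apply: tw_SM.
  by rewrite -[PM 0 i.+2 * _ * _]mulrA -[_ * (w * w) * _]mulrA W'W mulr1.
have EY : trs 0 i.+2 (PM 0 i.+2 * (asy 2 i * k 1%N)) =
    loop_val q mu lam *: (G * qa i).
  have ck : GRing.comm (k 1%N) (asy 2 i).
    by apply: (@asy_CS _ _ 2); [|lia|apply: tw_Sk; lia].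
  have e : PM 0 i.+2 * (asy 2 i * k 1%N) =
      (mu^-1 * mu^-1) *: (k 1%N * G * (PM 2 (2 + i) * asy 2 i)).
    rewrite -ck (@PM_cat 0 2) // -mulrA [PM 2 _ * (k _ * _)]mulrA.
    rewrite -(@PM_Ck 2 i.+2 1) //; try lia.
    rewrite -[k 1%N * _ * _]mulrA mulrA (@PM_recr 0 1) // (@PM_recr 0 0) // PM_nil // mul1r.
    by rewrite MMk -?scalerAl //; lia.
  have SkG : S 2 (k 1%N * G) by apply: tw_SM; [apply: tw_Sk; lia|apply: tw_SW SG].
  have i2n : (0 + 2 + i < n)%N by lia.
  rewrite e trsZ (trs_add t 0 2 i) (trs_modl mu0 lam0) //; first last.
    by apply: tw_SM => //; apply: PM_S; lia.
  have -> : trs (0 + 2) i (PM 2 (2 + i) * asy 2 i) = qa i.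
    by apply: (@trs_shift 2 i); lia.
  rewrite -mulrA trs2_k //; try lia; last first.
    by apply: tw_SM => //; apply: qa_S; lia.
  rewrite scalerA; congr (_ *: _).
  by rewrite !mulrA mulfVK // mulVf // mul1r.
have EX : trs 0 i.+2 (PM 0 i.+2 * (asy 0 i * k i.+1)) =
    loop_val q mu lam *: (qa i * G).
  have e : PM 0 i.+2 * (asy 0 i * k i.+1) =
      (mu^-1 * mu^-1) *: (PM 0 i * asy 0 i * (k i.+1 * G)).
    rewrite (@PM_cat 0 i) ?leq_addr //; last lia.
    rewrite -mulrA [PM i _ * _]mulrA -(@asy_PM 0 i i i.+2) //; try lia.
    rewrite (@PM_recr i i.+1) // (@PM_recr i i) // (@PM_nil i i) // mul1r.
    rewrite -[asy 0 i * _ * _]mulrA MMk; last lia.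
    by rewrite -!scalerAr mulrA.
  have SPa : S i (PM 0 i * asy 0 i) by apply: tw_SM => //; apply: PM_S; lia.
  have SkG : S i.+2 (k i.+1 * G) by apply: tw_SM => //; apply: tw_SW SG.
  rewrite e trsZ -(addn2 i) (trs_add t 0 i 2) (trs_modl mu0 lam0) ?add0n ?addn2 //; last lia.
  rewrite trs2_k //; [|lia|by apply: tw_SW SG].
  rewrite -scalerAr trsZ (trs_modr mu0 lam0) ?add0n //; last lia.
  rewrite scalerA; congr (_ *: _).
  by rewrite !mulrA mulfVK // mulVf // mul1r.
move: key; rewrite EX EY => /(congr1 ( *:%R (loop_val q mu lam)^-1)).
by rewrite !scalerA mulVf // !scale1r.
Qed.

End QuantumMatrix.

(** * Solution of the recursion *)

Section Recursion.
Variables (C : fieldType) (H : algType C) (q mu : C) (ht : nat).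
Variables (X a : nat -> H) (G : H) (A B : nat -> nat -> H).
Local Notation lam := (q - q^-1).

Let y i : C := mu * q ^+ (2 * i).
Definition c_rec i : C := y i * lam / (q + y i).
Definition e_rec i : C := lam * q / (q + y i).

Hypotheses (q0 : q != 0) (mu0 : mu != 0) (lam0 : lam != 0).
Hypothesis (y0 : forall i, (0 < i <= ht)%N -> q + y i != 0).
Hypothesis a0 : a 0 = 1.
Hypothesis A1 : forall m, (0 < m)%N -> (m <= 2 * ht)%N -> A m 1 = X m.
Hypothesis B1 : forall m, (0 < m)%N -> (m < 2 * ht)%N -> B m 1 = mu^-1 *: (X m.-1 * G).
Hypothesis Arec : forall m i, (0 < m)%N -> (0 < i < ht)%N -> (m + i <= 2 * ht)%N ->
  A m i.+1 = q ^+ i *: (X m * a i) - A m.+1 i - c_rec i *: B m i.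
Hypothesis Brec : forall m i, (1 < m)%N -> (0 < i < ht)%N -> (m + i < 2 * ht)%N ->
  B m i.+1 = (q ^- i / mu) *: (X m.-1 * a i * G) + (e_rec i *: A m i - B m.-1 i) * G.
Hypothesis Aend : q ^+ ht *: (X ht * a ht) - A ht.+1 ht - c_rec ht *: B ht ht = 0.

(** The partial sum of the Cayley-Hamilton expression without g, in degree d; in
[Q_rec] its companion, which collects the terms with positive powers of q^2 G. *)
Definition P_rec d i : H := \sum_(j < i.+1) (- q) ^+ j *: (X (d - j)%N * a j).
Fixpoint Q_rec d i : H :=
  if i is i'.+1 then (q * q) *: ((P_rec (d - 2)%N i' + Q_rec (d - 2)%N i') * G) else 0.

(* Coefficients of the closed forms, found from small i.  At i = 0 the denominator
   q + y 0 may vanish, which is harmless as [kap 0] and [nu 0] multiply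
   [Q_rec d 0], that is 0. *)
Let kap i : C := lam / (q + y i).
Let la i : C := (q * q * y i)^-1.
Let nu i : C := - (1 + q * y i) / (q * y i * (q + y i)).

Lemma P_recS d i : P_rec d i.+1 = P_rec d i + (- q) ^+ i.+1 *: (X (d - i.+1)%N * a i.+1).
Proof. by rewrite /P_rec big_ord_recr. Qed.

Lemma yS i : y i.+1 = q * q * y i.
Proof. by rewrite /y mulnS exprD; ring. Qed.

Lemma y_neq0 i : y i != 0.
Proof. by rewrite mulf_neq0 ?expf_neq0. Qed.

Lemma A_step i (x p q1 q2 : H) : (i < ht)%N -> (i = 0 -> q1 = 0) ->
  q ^+ i.+1 *: x - (-1) ^+ i *: (p + kap i *: q1)
    - c_rec i.+1 *: ((-1) ^+ i *: (la i *: q2 + nu i *: q1)) =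
  (-1) ^+ i.+1 *: (p + (- q) ^+ i.+1 *: x + kap i.+1 *: q2).
Proof.
move=> iht q10; have yn := y_neq0 i.
have y1 := @y0 i.+1 ltac:(lia).
have -> : (- q) ^+ i.+1 = (-1) ^+ i.+1 * q ^+ i.+1 by rewrite -exprMn mulN1r.
have sgn : (-1) ^+ i.+1 * (-1) ^+ i.+1 = 1 :> C by rewrite -exprMn mulrNN mul1r expr1n.
pose s : C := (-1) ^+ i.
have sE : (-1) ^+ i.+1 = - s by rewrite exprS mulN1r.
rewrite !sE in sgn *; rewrite -/s.
have E : kap i.+1 = c_rec i.+1 * la i.
  rewrite /kap /c_rec /la yS in y1 *; field; rewrite q0 yn y1 //.
have E1 : (s * kap i + c_rec i.+1 * (s * nu i)) *: q1 = 0.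
  case: (posnP i) => [i0|i0]; first by rewrite q10 // scaler0.
  have yi := @y0 i ltac:(lia).
  suff -> : s * kap i + c_rec i.+1 * (s * nu i) = 0 by rewrite scale0r.
  by rewrite /kap /c_rec /nu yS in y1 *; field; rewrite q0 yn yi y1.
transitivity (q ^+ i.+1 *: x - s *: p - (s * kap i + c_rec i.+1 * (s * nu i)) *: q1
    - (c_rec i.+1 * (s * la i)) *: q2).
  rewrite !scalerDr !scalerA scalerDl !opprD !addrA -!addrA; do 3 congr (_ + _).
  by rewrite !mulrA addrC.
rewrite E1 subr0 !scalerDr !scalerA [- s * (- s * _)]mulrA sgn mul1r E.
rewrite [- s *: p + _]addrC !mulNr !scaleNr; congr (_ - _ *: _).
by rewrite mulrCA.
Qed.

Lemma B_step i (x p q1 q2 : H) : (i.+1 < ht)%N -> (i = 0 -> q1 = 0) ->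
  (q ^- i.+1 / mu) *: (x * G) + (e_rec i.+1 *: ((-1) ^+ i *: (p + kap i *: q1))
    - (-1) ^+ i *: (la i *: q2 + nu i *: q1)) * G =
  (-1) ^+ i.+1 *: (la i.+1 *: ((q * q) *: ((p + (- q) ^+ i.+1 *: x + q2) * G))
    + nu i.+1 *: ((q * q) *: ((p + q1) * G))).
Proof.
move=> iht q10; have yn := y_neq0 i.
have y1 := @y0 i.+1 ltac:(lia).
have q1n := expf_neq0 i.+1 q0.
have sgn : (-1) ^+ i.+1 * (-1) ^+ i.+1 = 1 :> C by rewrite -exprMn mulrNN mul1r expr1n.
have -> : (- q) ^+ i.+1 = (-1) ^+ i.+1 * q ^+ i.+1 by rewrite -exprMn mulN1r.
pose s : C := (-1) ^+ i.
have sE : (-1) ^+ i.+1 = - s by rewrite exprS mulN1r.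
rewrite !sE in sgn *; rewrite -/s.
have E1 : (e_rec i.+1 * (s * kap i) - s * nu i + s * (nu i.+1 * (q * q))) *: q1 = 0.
  case: (posnP i) => [i0|i0]; first by rewrite q10 // scaler0.
  have yi := @y0 i ltac:(lia).
  suff -> : e_rec i.+1 * (s * kap i) - s * nu i + s * (nu i.+1 * (q * q)) = 0 by rewrite scale0r.
  by rewrite /kap /e_rec /nu yS in y1 *; field; rewrite q0 yn yi y1.
have cx : q ^- i.+1 / mu = - s * (la i.+1 * (q * q) * (- s * q ^+ i.+1)).
  have -> : - s * (la i.+1 * (q * q) * (- s * q ^+ i.+1)) =
    (- s * - s) * (la i.+1 * (q * q) * q ^+ i.+1) by ring.
  rewrite sgn mul1r /la /y.
  have -> : (2 * i.+1 = i.+1 + i.+1)%N by lia.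
  rewrite exprD; move: (q ^+ i.+1) q1n => z z0; field.
  by rewrite q0 z0 mu0.
have cp : e_rec i.+1 * s = - s * (la i.+1 * (q * q)) + - s * (nu i.+1 * (q * q)).
  by rewrite /e_rec /la /nu yS in y1 *; field; rewrite q0 yn y1.
have cq2 : - (s * la i) = - s * (la i.+1 * (q * q)).
  by rewrite /la yS; field; rewrite q0 yn.
rewrite !scalerAl -!mulrDl !scalerAl; congr (_ * _).
transitivity ((q ^- i.+1 / mu) *: x + (e_rec i.+1 * s) *: p + (- (s * la i)) *: q2
    + (e_rec i.+1 * (s * kap i) - s * nu i) *: q1).
  rewrite !scalerDr !scalerA scalerBl opprD scaleNr -!addrA; do 2 congr (_ + _).
  by rewrite addrCA !mulrA.
have -> : (e_rec i.+1 * (s * kap i) - s * nu i) *: q1 = (- s * (nu i.+1 * (q * q))) *: q1.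
  apply/eqP; rewrite -subr_eq0 -scalerBl; apply/eqP; rewrite -[RHS]E1; congr (_ *: _).
  by rewrite mulNr opprK.
rewrite cx cp cq2 !scalerDr !scalerA scalerDl -!addrA.
rewrite [RHS]addrCA -[- s * _ * (- s * _)]mulrA; do 2 congr (_ + _); exact: addrCA.
Qed.

(** The recursions raise i at constant degree d = m + i - 1 for A and d = m + i
for B, except for the factor G, which has degree 2. *)
Lemma AB_closed i : (i < ht)%N ->
  (forall d, (0 < d)%N -> (2 * i <= d <= 2 * ht)%N ->
     A (d - i)%N i.+1 = (-1) ^+ i *: (P_rec d i + kap i *: Q_rec d i)) /\
  (forall d, (2 * i.+1 <= d <= 2 * ht)%N ->
     B (d - i.+1)%N i.+1 = (-1) ^+ i *: (la i *: Q_rec d i.+1 + nu i *: Q_rec d i)).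
Proof.
elim: i => [|i IH] iht.
  split=> d.
    move=> d0 dht; rewrite subn0 A1; try lia.
    by rewrite /P_rec big_ord1 expr0 !scale1r subn0 a0 mulr1 scaler0 addr0.
  move=> dht; rewrite subn1 B1; try lia.
  rewrite /Q_rec /P_rec big_ord1 expr0 !scale1r a0 mulr1 !addr0 scaler0 addr0 scalerA.
  have -> : (d - 2 - 0 = d.-1.-1)%N by lia.
  congr (_ *: _); rewrite /la /y muln0 expr0 mulr1; field.
  by rewrite q0 mu0.
have [IA IB] := IH (ltnW iht); split=> d.
  move=> d0 dht; rewrite Arec; try lia.
  have -> : (d - i.+1).+1 = (d - i)%N by lia.
  by rewrite IA ?IB ?P_recS ?A_step //; try lia; move=> ->.
move=> dht; rewrite Brec; try lia.
have -> : (d - i.+2 = (d - 2) - i)%N by lia.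
have -> : ((d - 2 - i).-1 = (d - 2) - i.+1)%N by lia.
rewrite IA ?IB; try lia.
have QE : Q_rec d i.+2 = (q * q) *: ((P_rec (d - 2) i.+1 + Q_rec (d - 2) i.+1) * G) by [].
by rewrite B_step //; [rewrite QE P_recS | move=> ->].
Qed.

Hypothesis yht : q + y ht = lam.

Lemma PQ_eq0 : (0 < ht)%N -> P_rec (2 * ht) ht + Q_rec (2 * ht) ht = 0.
Proof.
move=> ht0; have [IA IB] := @AB_closed ht.-1 ltac:(lia).
have htE : ht.-1.+1 = ht by lia.
have := IA (2 * ht)%N ltac:(lia) ltac:(lia); have := IB (2 * ht)%N ltac:(lia).
rewrite htE; have -> : (2 * ht - ht = ht)%N by lia.
have -> : (2 * ht - ht.-1 = ht.+1)%N by lia.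
move=> EB EA; move: Aend; rewrite EA EB.
have := @A_step ht.-1 (X ht * a ht) (P_rec (2 * ht) ht.-1) (Q_rec (2 * ht) ht.-1)
  (Q_rec (2 * ht) ht) ltac:(lia).
rewrite htE => -> ; last by move=> ->.
have -> : kap ht = 1 by rewrite /kap yht mulfV.
rewrite scale1r => /(congr1 ( *:%R ((-1) ^+ ht))).
rewrite scaler0 scalerA -exprMn mulrNN mul1r expr1n scale1r => <-.
congr (_ + _); have := P_recS (2 * ht) ht.-1; rewrite htE => ->.
by have -> : (2 * ht - ht = ht)%N by lia.
Qed.

Definition eps_low i : H := \sum_(j < i./2.+1) a (i - 2 * j)%N * G ^+ j.
Definition eps i : H :=
  if (i <= ht)%N then eps_low i else eps_low (2 * ht - i)%N * G ^+ (i - ht).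

Lemma PQ_unroll d i : P_rec d i + Q_rec d i =
  \sum_(0 <= l < i.+1) (q * q) ^+ l *: (P_rec (d - 2 * l)%N (i - l)%N * G ^+ l).
Proof.
elim: i d => [|i IH] d.
  by rewrite big_nat1 /= addr0 muln0 !expr0 scale1r mulr1 !subn0.
rewrite big_nat_recl // muln0 !subn0 !expr0 scale1r mulr1; congr (_ + _).
rewrite [LHS]/= IH mulr_suml scaler_sumr; apply: eq_bigr => l _.
rewrite -scalerAl scalerA -exprS -mulrA -exprSr.
by have -> : (d - 2 - 2 * l = d - 2 * l.+1)%N by lia.
Qed.

Lemma sum_window (F : nat -> H) b e N (Q : pred nat) : (e < N)%N ->
  (forall s, (s < N)%N -> Q s = (b <= s <= e)%N) ->
  \sum_(0 <= s < N | Q s) F s = \sum_(b <= s < e.+1) F s.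
Proof.
move=> eN Qs; rewrite [RHS](big_nat_widenl _ 0) // [RHS](big_nat_widen _ _ N) //.
rewrite [LHS]big_nat_cond [RHS]big_nat_cond; apply: eq_bigl => s.
case: (ltnP s N) => sN; first by rewrite /= Qs.
rewrite /=; lia.
Qed.

(** Unrolled, the left-hand side is a double sum over a power l of G and an index s.
For fixed s, the range of l is s - ht <= l <= s / 2; its lower end gives the
common factor of [eps] above the middle degree. *)
Lemma eps_sum : P_rec (2 * ht) ht + Q_rec (2 * ht) ht =
  \sum_(i < (2 * ht).+1) (- q) ^+ i *: (X (2 * ht - i)%N * eps i).
Proof.
pose F l s := (- q) ^+ s *: (X (2 * ht - s)%N * (a (s - 2 * l)%N * G ^+ l)).
rewrite PQ_unroll.
transitivity (\sum_(0 <= l < ht.+1)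
    \sum_(0 <= s < (2 * ht).+1 | (2 * l <= s <= ht + l)%N) F l s).
  apply: eq_big_nat => l lht.
  rewrite (@sum_window _ (2 * l) (ht + l)) //; last lia.
  rewrite -[(2 * l)%N in RHS]add0n big_addn.
  have -> : ((ht + l).+1 - 2 * l = (ht - l).+1)%N by lia.
  rewrite /P_rec -(big_mkord xpredT (fun j => (- q) ^+ j *: (X (2 * ht - 2 * l - j)%N * a j))).
  rewrite mulr_suml scaler_sumr; apply: eq_big_nat => j jl.
  rewrite /F -scalerAl scalerA -mulrA.
  have -> : (j + 2 * l - 2 * l = j)%N by lia.
  have -> : (2 * ht - (j + 2 * l) = 2 * ht - 2 * l - j)%N by lia.
  by congr (_ *: _); rewrite exprD exprM sqrrN -expr2 mulrC.
rewrite (eq_bigr (fun l => \sum_(0 <= s < (2 * ht).+1)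
  (if (2 * l <= s <= ht + l)%N then F l s else 0))); last first.
  by move=> l _; rewrite big_mkcond.
rewrite exchange_big_nat -(big_mkord xpredT (fun i => (- q) ^+ i *: (X (2 * ht - i)%N * eps i))) /=.
apply: eq_big_nat => s sht; rewrite -big_mkcond /=.
rewrite (@sum_window _ (s - ht) s./2); [|lia|by move=> l lht; lia].
rewrite /F -scaler_sumr -mulr_sumr; congr (_ *: (_ * _)).
rewrite /eps /eps_low; case: leqP => hs.
  have -> : (s - ht = 0)%N by lia.
  by rewrite big_mkord.
rewrite -[(s - ht)%N in LHS]add0n big_addn mulr_suml.
rewrite -(big_mkord xpredT (fun j => a (2 * ht - s - 2 * j)%N * G ^+ j * G ^+ (s - ht))).
have -> : ((s./2).+1 - (s - ht) = ((2 * ht - s)./2).+1)%N by lia.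
apply: eq_big_nat => j jl; rewrite exprD mulrA.
by have -> : (s - 2 * (j + (s - ht)) = 2 * ht - s - 2 * j)%N by lia.
Qed.

Lemma closed_sum : (0 < ht)%N ->
  \sum_(i < (2 * ht).+1) (- q) ^+ i *: (X (2 * ht - i)%N * eps i) = 0.
Proof. by move=> ht0; rewrite -eps_sum PQ_eq0. Qed.

End Recursion.

(** * The Cayley-Hamilton identity on a tower *)

Section TowerCayleyHamilton.
Variables (C : fieldType) (H : algType C) (q mu lam : C) (n ht : nat).
Variables (t : tower H mu lam n) (M G : H).
Local Notation r := (tw_r t).
Local Notation k := (tw_k t).
Local Notation S := (tw_S t).
Local Notation asy := (asy q mu lam r k).
Local Notation Rm := (@Rm C H q mu lam).
Hypothesis (SM : S 1 M) (SG : S 0 G).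
Hypothesis relM : r 1%N * (Mb t M 1 * Mb t M 2) = Mb t M 1 * Mb t M 2 * r 1%N.
Hypothesis relG : Mb t M 1 * Mb t M 2 * k 1%N = (mu^-1 * mu^-1) *: (k 1%N * G).
Hypotheses (lamE : lam = q - q^-1) (mu0 : mu != 0) (lam0 : lam != 0) (q0 : q != 0).
Hypothesis loop0 : loop_val q mu lam != 0.
Hypothesis qnum0 : forall i, (2 <= i <= ht)%N -> qnum q i != 0.
Hypothesis mun0 : forall i, (1 <= i <= ht)%N -> mu + q * q ^- (2 * i) != 0.
Hypothesis ht1 : (1 < ht)%N.
Hypothesis htn : (2 * ht + 4 < n)%N.
Hypothesis height : asy ht.-1 ht * Rm (r (ht.-1 + ht)%N) (k (ht.-1 + ht)%N) (q ^- (2 * ht))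
  * asy ht.-1 ht = 0.
Hypothesis mu_ht : q + mu * q ^+ (2 * ht) = q - q^-1.

Let y0 i : (0 < i <= ht)%N -> q + mu * q ^+ (2 * i) != 0.
Proof.
move=> ii; have := mun0 ii; apply: contraNneq => e.
have qi : q ^+ (2 * i) != 0 by rewrite expf_neq0.
have -> : mu + q * q ^- (2 * i) = (q + mu * q ^+ (2 * i)) / q ^+ (2 * i) by field.
by rewrite e mul0r.
Qed.

Lemma Rm_k_q i : (0 < i <= ht)%N ->
  q ^+ i * Rm_k q mu (q ^- (2 * i)) = - (c_rec q mu i * qnum q i).
Proof.
move=> ii; have yi := y0 ii; have mi := mun0 ii.
rewrite /Rm_k /c_rec /qnum -lamE.
move: yi mi; rewrite mulnC exprM; have : q ^+ i != 0 by rewrite expf_neq0.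
move: (q ^+ i) => x x0 yi mi; field.
by rewrite lam0 x0 /=.
Qed.

Let qnum1 : qnum q 1 = 1.
Proof. by rewrite /qnum expr1 -lamE mulfV. Qed.

Let G_comm i : (0 < i <= ht)%N -> GRing.comm G (qa q t M i).
Proof.
by move=> ii; apply: (G_qa SM SG relM relG lamE mu0 lam0 ii) => //; lia.
Qed.

(** The closed solution is applied to the families A and B rescaled by the
q-numbers, which removes all denominators from their recursions. *)
Lemma tower_cayley_hamilton :
  \sum_(i < (2 * ht).+1) (- q) ^+ i *: (Xp t M (2 * ht - i) * eps ht (qa q t M) G i) = 0.
Proof.
have scal i (x : H) : (0 < i <= ht)%N ->
    (q ^+ i * Rm_k q mu (q ^- (2 * i))) *: x = - (c_rec q mu i *: (qnum q i *: x)).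
  by move=> ii; rewrite Rm_k_q // scaleNr scalerA.
apply: (closed_sum (mu := mu) (A := fun m i => qnum q i *: qA q t M m i)
  (B := fun m i => qnum q i *: qB q t M m i)) => //.
- by rewrite -lamE.
- by rewrite /qa /= /PM big_geq // mulr1.
- move=> m m0 mh; rewrite qnum1 scale1r /qA addn1 /= /asy /= mul1r.
  by case: m m0 mh.
- move=> m m0 mh; rewrite qnum1 scale1r; apply: (qB_1 q SM SG relG mu0 lam0) => //; lia.
- move=> m i m0 ih mi.
  rewrite -addrA -scal; last by lia.
  rewrite addrA -(qA_rec SM relM lamE mu0 lam0 qnum0 mun0) //; try lia.
  have qi : qnum q i.+1 != 0 by apply: qnum0; lia.
  rewrite /qA (asyS lamE mu0 lam0 qnum0 mun0 (tw_fam t)) //; last lia.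
  rewrite prednK // -scalerAl PhiZ scalerA mulrCA mulfV // mulr1.
  by rewrite addnS.
- move=> m i m1 ih mi; rewrite (qB_rec SM SG relM relG lamE mu0 lam0 qnum0 mun0) //; last 2 first.
  + by lia.
  + by apply: G_comm; lia.
  have ii : (0 < i <= ht)%N by lia.
  have yi := y0 ii.
  have -> : e_rec q mu i = lam - c_rec q mu i by rewrite /e_rec /c_rec -lamE; field.
  have -> : q ^- i / mu = q ^+ i / mu - qnum q i * (lam / mu).
    have qi : q ^+ i != 0 by rewrite expf_neq0.
    by rewrite /qnum -lamE; field; rewrite lam0 qi mu0.
  rewrite scal // !(mulrDl, mulrBl, mulNr) -!scalerAl.
  set x := _ * G; set y := _ * G; set z := _ * G.
  rewrite [(lam - _) *: _]scalerBl [(_ - _) *: x]scalerBl.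
  rewrite scalerDr scalerBr !scalerA [lam * _]mulrC opprD opprB -!addrA; congr (_ + _).
  rewrite [RHS]addrCA [lam * qnum q i]mulrC; congr (_ + _).
  by rewrite [LHS]addrCA [- _ - _]addrC.
- have hh : (0 < ht <= ht)%N by lia.
  rewrite -addrA -scal // addrA.
  rewrite -(qA_rec SM relM lamE mu0 lam0 qnum0 mun0) //; last lia.
  have := top_flip lamE mu0 lam0 qnum0 mun0 (tw_fam t) ht1 _ height.
  rewrite prednK; last lia.
  move=> -> //; last lia.
  by rewrite mul0r /Phi mulr0 -(scale0r 0) trsZ !scale0r scaler0.
all: lia.
Qed.

End TowerCayleyHamilton.

(** * Operators on tensor powers in coordinates *)

Section Entries.
Variables (N : nat) (A : pzRingType).

Lemma ent_mkop n (f : word N n -> word N n -> A) s t : ent (mkop f) s t = f s t.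
Proof. by rewrite /ent mxE !enum_rankK. Qed.

Lemma opP n (X Y : op A N n) : (forall s t, ent X s t = ent Y s t) -> X = Y.
Proof.
move=> e; apply/matrixP => i j; have := e (enum_val i) (enum_val j).
by rewrite /ent !enum_valK.
Qed.

Lemma entM n (X Y : op A N n) s t : ent (X * Y) s t = \sum_w ent X s w * ent Y w t.
Proof.
rewrite /ent mxE (reindex (enum_rank : word N n -> _)) //.
by apply: onW_bij; exact: enum_rank_bij.
Qed.

Lemma ent1 n s t : ent (1 : op A N n) s t = (s == t)%:R.
Proof. by rewrite /ent mxE (inj_eq enum_rank_inj). Qed.

Lemma entD n (X Y : op A N n) s t : ent (X + Y) s t = ent X s t + ent Y s t.
Proof. by rewrite /ent mxE. Qed.

Lemma ent0 n s t : ent (0 : op A N n) s t = 0.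
Proof. by rewrite /ent mxE. Qed.

Lemma entN n (X : op A N n) s t : ent (- X) s t = - ent X s t.
Proof. by rewrite /ent mxE. Qed.

End Entries.

Section Pasting.
Variables (N : nat).

Definition pull k n (p : 'I_k -> 'I_n) (s : word N n) : word N k := [ffun i => s (p i)].

Definition paste k n (p : 'I_k -> 'I_n) (s : word N n) (w : word N k) : word N n :=
  [ffun j => if [pick i | p i == j] is Some i then w i else s j].

Definition agree k n (p : 'I_k -> 'I_n) (s t : word N n) : bool :=
  [forall j, (j \notin codom p) ==> (s j == t j)].

Lemma agreeP k n (p : 'I_k -> 'I_n) (s t : word N n) :
  reflect (forall j, j \notin codom p -> s j = t j) (agree p s t).
Proof.
apply: (iffP forallP) => [h j jp|h j]; first by have /implyP/(_ jp)/eqP := h j.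
by apply/implyP => jp; rewrite h.
Qed.

Lemma paste_in k n (p : 'I_k -> 'I_n) (pI : injective p) (s : word N n) (w : word N k) i : paste p s w (p i) = w i.
Proof.
rewrite ffunE; case: pickP => [i' /eqP/pI -> //|/(_ i)]; by rewrite eqxx.
Qed.

Lemma paste_out k n (p : 'I_k -> 'I_n) (s : word N n) (w : word N k) j : j \notin codom p -> paste p s w j = s j.
Proof.
move=> jp; rewrite ffunE; case: pickP => [i /eqP e|//].
by rewrite -e codom_f in jp.
Qed.

Lemma pull_paste k n (p : 'I_k -> 'I_n) (pI : injective p) (s : word N n) (w : word N k) : pull p (paste p s w) = w.
Proof. by apply/ffunP => i; rewrite ffunE paste_in. Qed.

Lemma agree_paste k n (p : 'I_k -> 'I_n) (s : word N n) (w : word N k) : agree p s (paste p s w).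
Proof. by apply/agreeP => j jp; rewrite paste_out. Qed.

Lemma agree_sym k n (p : 'I_k -> 'I_n) (s t : word N n) : agree p s t = agree p t s.
Proof. by apply/agreeP/agreeP => h j jp; rewrite h. Qed.

Lemma paste_pull k n (p : 'I_k -> 'I_n) (pI : injective p) (s t : word N n) :
  agree p s t -> paste p s (pull p t) = t.
Proof.
move=> /agreeP st; apply/ffunP => j; case: (boolP (j \in codom p)) => [/codomP[i ->]|jp].
  by rewrite paste_in // ffunE.
by rewrite paste_out // st.
Qed.

(** A product with an operator in the factors p sums over the letters at p only. *)
Lemma sum_agree (V : nmodType) k n (p : 'I_k -> 'I_n) (pI : injective p) (s : word N n) (F : word N n -> V) :
  \sum_(w | agree p s w) F w = \sum_w' F (paste p s w').
Proof.
rewrite (reindex_onto (paste p s) (pull p)) /=; last by move=> w; apply: paste_pull.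
by apply: eq_bigl => w; rewrite agree_paste pull_paste // eqxx.
Qed.

End Pasting.

Section Embed.
Variables (N : nat) (A : pzRingType).

Lemma ent_embed k n (p : 'I_k -> 'I_n) (X : op A N k) s t :
  ent (embed p X) s t = if agree p s t then ent X (pull p s) (pull p t) else 0.
Proof. exact: ent_mkop. Qed.

Lemma ent_embed_mull k n (p : 'I_k -> 'I_n) (pI : injective p) (X : op A N k) (Y : op A N n) s t :
  ent (embed p X * Y) s t = \sum_w ent X (pull p s) w * ent Y (paste p s w) t.
Proof.
rewrite entM (bigID (agree p s)) /= [X in _ + X]big1 ?addr0; last first.
  by move=> w /negbTE h; rewrite ent_embed h mul0r.
rewrite sum_agree //; apply: eq_bigr => w _.
by rewrite ent_embed agree_paste pull_paste.
Qed.

Lemma ent_embed_mulr k n (p : 'I_k -> 'I_n) (pI : injective p) (X : op A N k) (Y : op A N n) s t :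
  ent (Y * embed p X) s t = \sum_w ent Y s (paste p t w) * ent X w (pull p t).
Proof.
rewrite entM (bigID (agree p t)) /= [X in _ + X]big1 ?addr0; last first.
  by move=> w /negbTE h; rewrite ent_embed agree_sym h mulr0.
rewrite sum_agree //; apply: eq_bigr => w _.
by rewrite ent_embed agree_sym agree_paste pull_paste.
Qed.

Lemma embedM k n (p : 'I_k -> 'I_n) (pI : injective p) (X Y : op A N k) :
  embed p (X * Y) = embed p X * embed p Y.
Proof.
apply: opP => s t; rewrite ent_embed_mull // ent_embed; case: ifP => st.
  rewrite entM; apply: eq_bigr => w _; rewrite ent_embed pull_paste //.
  have -> // : agree p (paste p s w) t.
  by apply/agreeP => j jp; rewrite paste_out //; move/agreeP: st; apply.
rewrite big1 // => w _; rewrite ent_embed.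
have -> : agree p (paste p s w) t = false; last by rewrite mulr0.
apply: contraFF st => /agreeP h; apply/agreeP => j jp; rewrite -h //.
by rewrite paste_out.
Qed.

Lemma embed1 k n (p : 'I_k -> 'I_n) : embed p (1 : op A N k) = 1.
Proof.
apply: opP => s t; rewrite ent_embed !ent1; case: ifP => [/agreeP st|st].
  congr (nat_of_bool _)%:R; apply/eqP/eqP => [e|-> //]; apply/ffunP => j.
  case: (boolP (j \in codom p)) => [/codomP[i ->]|/st //].
  by move/ffunP/(_ i): e; rewrite !ffunE.
case: eqP => // e; by move/agreeP: st; rewrite e; case.
Qed.

Lemma embedD k n (p : 'I_k -> 'I_n) (X Y : op A N k) :
  embed p (X + Y) = embed p X + embed p Y.
Proof.
by apply: opP => s t; rewrite entD !ent_embed; case: ifP; rewrite ?entD ?addr0.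
Qed.

Lemma embedN k n (p : 'I_k -> 'I_n) (X : op A N k) : embed p (- X) = - embed p X.
Proof.
by apply: opP => s t; rewrite entN !ent_embed; case: ifP; rewrite ?entN ?oppr0.
Qed.

Lemma embed_comp k n m (p : 'I_k -> 'I_n) (p' : 'I_n -> 'I_m) (pI : injective p')
    (X : op A N k) : embed p' (embed p X) = embed (p' \o p) X.
Proof.
apply: opP => s t; rewrite !ent_embed.
have -> : pull (p' \o p) s = pull p (pull p' s) by apply/ffunP => i; rewrite !ffunE.
have -> : pull (p' \o p) t = pull p (pull p' t) by apply/ffunP => i; rewrite !ffunE.
have -> : agree (p' \o p) s t = agree p' s t && agree p (pull p' s) (pull p' t).
  apply/agreeP/andP => [h|[/agreeP h1 /agreeP h2] j jp].
    split; apply/agreeP => j jp.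
      by apply: h; apply: contra jp => /codomP[i ->]; exact: codom_f.
    rewrite !ffunE; apply: h; apply: contra jp => /codomP[i /pI ->].
    by rewrite codom_f.
  case: (boolP (j \in codom p')) => [/codomP[i e]|/h1 //].
  have := h2 i; rewrite !ffunE -e; apply; apply: contra jp => /codomP[l il].
  by rewrite e il; exact: (codom_f (p' \o p)).
by case: (agree p' s t).
Qed.

Lemma eq_embed k n (p p' : 'I_k -> 'I_n) (X : op A N k) : p =1 p' -> embed p X = embed p' X.
Proof.
move=> e; apply: opP => s t; rewrite !ent_embed.
have pe u : pull p u = pull p' u by apply/ffunP => i; rewrite !ffunE e.
have -> : agree p s t = agree p' s t.
  by apply/agreeP/agreeP => h j jp; apply: h; move: jp; rewrite (eq_codom e).
by rewrite !pe.
Qed.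

Lemma embed_id n (X : op A N n) : embed id X = X.
Proof.
apply: opP => s t; rewrite ent_embed.
have e u : pull id u = u :> word N n by apply/ffunP => i; rewrite ffunE.
have -> : agree id s t by apply/agreeP => j; rewrite (codom_f id).
by rewrite !e.
Qed.

Lemma ent_disjoint k l n (p : 'I_k -> 'I_n) (p' : 'I_l -> 'I_n) (X : op A N k) (Y : op A N l) s t :
  injective p -> (forall i j, p i != p' j) ->
  ent (embed p X * embed p' Y) s t =
  if [forall j, (j \notin codom p) ==> (j \notin codom p') ==> (s j == t j)]
  then ent X (pull p s) (pull p t) * ent Y (pull p' s) (pull p' t) else 0.
Proof.
move=> pI dis; rewrite ent_embed_mull //.
have np j : p' j \notin codom p by apply/negP => /codomP[i /eqP]; rewrite eq_sym; apply/negP.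
have pp w : pull p' (paste p s w) = pull p' s.
  by apply/ffunP => j; rewrite [LHS]ffunE [RHS]ffunE paste_out.
rewrite (bigD1 (pull p t)) //= big1 ?addr0; last first.
  move=> w wt; rewrite ent_embed; case: ifP => [/agreeP h|_]; last by rewrite mulr0.
  case/eqP: wt; apply/ffunP => i; rewrite ffunE -h ?paste_in //.
  by apply/negP => /codomP[j /eqP]; apply/negP.
rewrite ent_embed pp; set b := agree _ _ _; set b' := [forall j, _].
have -> : b = b'; last by case: b'; rewrite ?mulr0.
apply/agreeP/forallP => h j.
  apply/implyP => jp; apply/implyP => /h <-.
  by rewrite paste_out.
move=> jp'; case: (boolP (j \in codom p)) => [/codomP[i ->]|jp].
  by rewrite paste_in // ffunE.
by rewrite paste_out //; apply/eqP; have /implyP/(_ jp)/implyP/(_ jp') := h j.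
Qed.

Lemma embed_comm k l n (p : 'I_k -> 'I_n) (p' : 'I_l -> 'I_n) (X : op A N k) (Y : op A N l) :
  injective p -> injective p' -> (forall i j, p i != p' j) ->
  (forall s t s' t', ent X s t * ent Y s' t' = ent Y s' t' * ent X s t) ->
  embed p X * embed p' Y = embed p' Y * embed p X.
Proof.
move=> pI p'I dis XY; apply: opP => s t; rewrite !ent_disjoint //; last first.
  by move=> i j; rewrite eq_sym.
have -> : [forall j, (j \notin codom p) ==> (j \notin codom p') ==> (s j == t j)] =
  [forall j, (j \notin codom p') ==> (j \notin codom p) ==> (s j == t j)].
  by apply: eq_forallb => j; case: (_ \in codom p); case: (_ \in _); case: (_ == _).
by rewrite XY.
Qed.

End Embed.

Section AtFactor.
Variables (N : nat) (A : pzRingType).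

Lemma strand_inj n k m : (m.-1 + k <= n.+1)%N ->
  injective (fun i : 'I_k => inord (m.-1 + i) : 'I_n.+1).
Proof.
move=> mk i j /(congr1 val) /=; have := ltn_ord i; have := ltn_ord j => li lj.
by rewrite !inordK; [move=> e; apply: val_inj => /=; lia | lia | lia].
Qed.

Lemma at_factorM n k m (X Y : op A N k) : (m.-1 + k <= n.+1)%N ->
  at_factor n (X * Y) m = at_factor n X m * at_factor n Y m.
Proof. by move=> mk; apply/embedM/strand_inj. Qed.

Lemma at_factor1 n k m : at_factor n (1 : op A N k) m = 1.
Proof. exact: embed1. Qed.

Lemma at_factorD n k m (X Y : op A N k) :
  at_factor n (X + Y) m = at_factor n X m + at_factor n Y m.
Proof. exact: embedD. Qed.

Lemma at_factorN n k m (X : op A N k) : at_factor n (- X) m = - at_factor n X m.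
Proof. exact: embedN. Qed.

Lemma at_factor0 n k m : at_factor n (0 : op A N k) m = 0.
Proof. by apply: opP => s t; rewrite ent_embed !ent0 if_same. Qed.

Lemma at_factor_sum n k m (I : Type) (s : seq I) (P : pred I) (F : I -> op A N k) :
  at_factor n (\sum_(i <- s | P i) F i) m = \sum_(i <- s | P i) at_factor n (F i) m.
Proof.
exact: (big_morph (fun X : op A N k => at_factor n X m) (at_factorD n m) (at_factor0 n k m)).
Qed.

Lemma at_factor_at n l k m j (X : op A N k) : (m.-1 + k <= l.+1)%N ->
  (j.-1 + l.+1 <= n.+1)%N -> (0 < m)%N ->
  at_factor n (at_factor l X m) j = at_factor n X (j.-1 + m).
Proof.
move=> mk jl m0; rewrite /at_factor embed_comp; last exact: strand_inj.
apply: eq_embed => i; apply: val_inj => /=; have := ltn_ord i => li.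
by rewrite !inordK; lia.
Qed.

Lemma at_factor_id n (X : op A N n.+1) : at_factor n X 1 = X.
Proof.
rewrite -[RHS]embed_id; apply: eq_embed => i; apply: val_inj => /=.
by rewrite inordK // ltn_ord.
Qed.

Lemma at_factor_comm n k l i j (X : op A N k) (Y : op A N l) :
  (i.-1 + k <= j.-1)%N -> (j.-1 + l <= n.+1)%N ->
  (forall s t s' t', ent X s t * ent Y s' t' = ent Y s' t' * ent X s t) ->
  at_factor n X i * at_factor n Y j = at_factor n Y j * at_factor n X i.
Proof.
move=> ij jl XY; apply: embed_comm => //; try by apply: strand_inj; lia.
move=> a b; apply/eqP => /(congr1 val) /=.
have := ltn_ord a; have := ltn_ord b => la lb.
by rewrite !inordK; lia.
Qed.

End AtFactor.

Section Scalars.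
Variables (C : fieldType) (N : nat) (A : algType C).

Lemma ent_ext n (X : op C N n) s t : ent (extend_scalars A X) s t = (ent X s t)%:A.
Proof. by rewrite /ent mxE. Qed.

Lemma extM n (X Y : op C N n) :
  extend_scalars A (X * Y) = extend_scalars A X * extend_scalars A Y.
Proof. exact: map_mxM. Qed.

Lemma extD n (X Y : op C N n) :
  extend_scalars A (X + Y) = extend_scalars A X + extend_scalars A Y.
Proof. exact: map_mxD. Qed.

Lemma extN n (X : op C N n) : extend_scalars A (- X) = - extend_scalars A X.
Proof. exact: map_mxN. Qed.

Lemma ext1 n : extend_scalars A (1 : op C N n) = 1.
Proof. exact: map_mx1. Qed.

Lemma ext_inj n (X Y : op C N n) : extend_scalars A X = extend_scalars A Y -> X = Y.
Proof.
move=> e; apply: opP => s t; apply: (fmorph_inj (in_alg A)).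
by rewrite /= -!ent_ext e.
Qed.

Lemma ext_at n k m (X : op C N k) :
  extend_scalars A (at_factor n X m) = at_factor n (extend_scalars A X) m.
Proof.
by apply: opP => s t; rewrite ent_ext !ent_embed; case: ifP; rewrite ?ent_ext ?scale0r.
Qed.

Lemma scalarC (c : C) (x : A) : c%:A * x = x * c%:A.
Proof. by rewrite mulr_algl mulr_algr. Qed.

End Scalars.

(** Operators with scalars restricted to C.  At least one letter is required, so
that the algebra is not the zero ring. *)
Definition tens (C : fieldType) (A : algType C) (N' n : nat) : Type := op A N'.+1 n.+1.

Section TensorAlgebra.
Variables (C : fieldType) (A : algType C) (N' n : nat).
Local Notation N := N'.+1.
Local Notation H := (tens A N' n).

HB.instance Definition _ := GRing.PzRing.on H.

Fact tens_oner_neq0 : (1 : H) != 0.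
Proof.
apply/eqP => e; have := congr1 (fun X : op A N n.+1 => ent X [ffun=> ord0] [ffun=> ord0]) e.
by rewrite ent1 ent0 eqxx => /eqP; rewrite oner_eq0.
Qed.

HB.instance Definition _ := GRing.PzSemiRing_isNonZero.Build H tens_oner_neq0.

Definition tens_scale (c : C) (X : H) : H := map_mx (fun a => c *: a) (X : op A N n.+1).

Lemma ent_tscale c (X : H) s t : ent (tens_scale c X : op A N n.+1) s t = c *: ent (X : op A N n.+1) s t.
Proof. by rewrite /ent mxE. Qed.

Fact tens_scaleA a b X : tens_scale a (tens_scale b X) = tens_scale (a * b) X.
Proof. by apply: opP => s t; rewrite !ent_tscale scalerA. Qed.
Fact tens_scale1 : left_id 1 tens_scale.
Proof. by move=> X; apply: opP => s t; rewrite !ent_tscale scale1r. Qed.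
Fact tens_scaleDr : right_distributive tens_scale +%R.
Proof. by move=> c X Y; apply: opP => s t; rewrite ent_tscale !entD !ent_tscale scalerDr. Qed.
Fact tens_scaleDl X : {morph tens_scale^~ X : a b / a + b}.
Proof. by move=> a b; apply: opP => s t; rewrite entD !ent_tscale scalerDl. Qed.

HB.instance Definition _ := GRing.Zmodule_isLmodule.Build C H
  tens_scaleA tens_scale1 tens_scaleDr tens_scaleDl.

Fact tens_scaleAl (c : C) (X Y : H) : c *: (X * Y) = (c *: X) * Y.
Proof.
apply: opP => s t; rewrite ent_tscale !entM scaler_sumr; apply: eq_bigr => w _.
by rewrite ent_tscale scalerAl.
Qed.

HB.instance Definition _ := GRing.Lmodule_isLalgebra.Build C H tens_scaleAl.

Fact tens_scaleAr (c : C) (X Y : H) : c *: (X * Y) = X * (c *: Y).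
Proof.
apply: opP => s t; rewrite ent_tscale !entM scaler_sumr; apply: eq_bigr => w _.
by rewrite ent_tscale scalerAr.
Qed.

HB.instance Definition _ := GRing.Lalgebra_isAlgebra.Build C H tens_scaleAr.

End TensorAlgebra.

(** * The rank one operator K *)

Section RankOne.
Variables (C : fieldType) (N : nat).
Local Notation I := 'I_N.
Variables (k r psi : I -> I -> I -> I -> C).
Hypothesis psi_r : forall s1 s3 t1 t3,
  \sum_(p : I * I) psi s1 p.1 t1 p.2 * r p.2 s3 p.1 t3 = ((s1 == t3) && (s3 == t1))%:R.

(** Contraction with the skew inverse removes a factor r and identifies the indices
that it joined. *)
Lemma psi_contract (J : finType) s1 t1 (x v : J -> I) (g : J -> C) :
  \sum_(p : I * I) psi s1 p.1 t1 p.2 * (\sum_q g q * r p.2 (x q) p.1 (v q)) =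
  \sum_(q | (v q == s1) && (x q == t1)) g q.
Proof.
rewrite (eq_bigr (fun p : I * I => \sum_q g q * (psi s1 p.1 t1 p.2 * r p.2 (x q) p.1 (v q)))).
  rewrite exchange_big [RHS]big_mkcond; apply: eq_bigr => q _ /=.
  rewrite -mulr_sumr psi_r eq_sym; case: ifP; by rewrite ?mulr1 ?mulr0.
by move=> p _; rewrite mulr_sumr; apply: eq_bigr => q _; rewrite mulrCA.
Qed.

Hypothesis kk : forall b c a a' b' c',
  \sum_x k b c x c' * k a x a' b' =
  \sum_(p : I * I * I) k b c p.1.1 p.1.2 * (r a p.1.1 a' p.2 * r p.2 p.1.2 b' c').

Definition dual1 s1 t1 y b' := \sum_(p : I * I) psi s1 p.1 t1 p.2 * k p.2 y p.1 b'.
Definition dual2 b x y' y := \sum_(p : I * I) psi x p.1 y' p.2 * dual1 p.2 y b p.1.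

(** The relation K_2 K_1 = K_2 R_1 R_2, contracted once with the skew inverse, to
remove R_1; in [dual2P] a second contraction removes R_2. *)
Lemma dual1P b c s1 t1 b' c' :
  \sum_y k b c y c' * dual1 s1 t1 y b' = \sum_z k b c t1 z * r s1 z b' c'.
Proof.
transitivity (\sum_(p : I * I) psi s1 p.1 t1 p.2 * (\sum_y k b c y c' * k p.2 y p.1 b')).
  under eq_bigr => y _ do rewrite mulr_sumr.
  rewrite exchange_big; apply: eq_bigr => p _ /=; rewrite mulr_sumr.
  by apply: eq_bigr => y _; rewrite mulrCA.
under eq_bigr => p _ do rewrite kk.
under eq_bigr => p _ do under eq_bigr => q _ do rewrite [r _ _ _ _ * _]mulrC mulrA.
rewrite (psi_contract s1 t1 (fun q : I * I * I => q.1.1) (fun q : I * I * I => q.2)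
  (fun q : I * I * I => k b c q.1.1 q.1.2 * r q.2 q.1.2 b' c')).
rewrite (reindex_onto (fun z => (t1, z, s1)) (fun q => q.1.2)) /=; last first.
  by move=> [[x y] v] /= /andP[/eqP -> /eqP ->].
by apply: eq_big => [z|//]; rewrite !eqxx.
Qed.

Lemma dual2P b c t x y y' :
  \sum_z k b c z t * dual2 z x y' y = k b c y y' *+ (x == t).
Proof.
transitivity (\sum_(p : I * I) psi x p.1 y' p.2 * (\sum_z k b c z t * dual1 p.2 y z p.1)).
  under eq_bigr => z _ do rewrite mulr_sumr.
  rewrite exchange_big; apply: eq_bigr => p _ /=; rewrite mulr_sumr.
  by apply: eq_bigr => z _; rewrite mulrCA.
under eq_bigr => p _ do rewrite dual1P.
rewrite (psi_contract x y' id (fun=> t) (fun z => k b c y z)) eq_sym.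
by case: eqP => _ /=; rewrite ?big_pred1_eq // big_pred0.
Qed.

(** For fixed (y, y'), the matrix [dual2 z x y' y] in z and x is, by [dual2P], up to
a scalar the inverse of every row (b, c) of k, read as a matrix.  Hence all rows
are proportional to one of them. *)
Lemma rank_one : exists u v : I -> I -> C, forall a b c d, k a b c d = u a b * v c d.
Proof.
case: (pickP (fun p : I * I * I * I => k p.1.1.1 p.1.1.2 p.1.2 p.2 != 0)); last first.
  move=> k0; exists (fun _ _ => 0), (fun _ _ => 0) => a b c d; rewrite mul0r.
  exact/eqP/negbFE/(k0 (a, b, c, d)).
move=> [[[a0 b0] y] y'] /= nz.
exists (fun a b => k a b y y' / k a0 b0 y y'), (k a0 b0) => a b c d.
pose row a b : 'M[C]_N := \matrix_(t, z) k a b z t.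
pose V : 'M[C]_N := \matrix_(z, x) dual2 z x y' y.
have rowV a' b' : row a' b' *m V = (k a' b' y y')%:M.
  apply/matrixP => t x; rewrite !mxE eq_sym -dual2P.
  by apply: eq_bigr => z _; rewrite !mxE.
have Vrow : V *m ((k a0 b0 y y')^-1 *: row a0 b0) = 1%:M.
  by apply: mulmx1C; rewrite -scalemxAl rowV scale_scalar_mx mulVf.
have : row a b = row a b *m (V *m ((k a0 b0 y y')^-1 *: row a0 b0)).
  by rewrite Vrow mulmx1.
rewrite mulmxA rowV mul_scalar_mx scalerA => /matrixP/(_ d c).
by rewrite !mxE.
Qed.

End RankOne.

Section TraceWeight.
Variables (C : fieldType) (N : nat).
Local Notation I := 'I_N.
Variables (r psi : I -> I -> I -> I -> C) (u v : I -> I -> C) (m : C).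
Hypothesis psi_r : forall s1 s3 t1 t3,
  \sum_(p : I * I) psi s1 p.1 t1 p.2 * r p.2 s3 p.1 t3 = ((s1 == t3) && (s3 == t1))%:R.
Hypothesis krk : forall a a',
  \sum_(p : I * I * I) (v p.1.1 p.1.2 * u p.2 p.1.2) * r a p.1.1 a' p.2 = m *+ (a == a').

(** The hypothesis [krk] is K_2 R_1 K_2 = m K_2 for K = u v, in coordinates.
Contraction with the skew inverse removes R_1 on the left, and on the right it
leaves the partial trace of the skew inverse, which is D_R. *)
Lemma trace_weight s t :
  \sum_e u s e * v t e = m * \sum_a psi s a t a.
Proof.
transitivity (\sum_(p : I * I) psi s p.1 t p.2 * (m *+ (p.2 == p.1))); last first.
  rewrite mulr_sumr (bigID (fun p : I * I => p.2 == p.1)) /= [X in _ + X]big1 ?addr0; last first.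
    by move=> p /negbTE ->; rewrite mulr0.
  rewrite (reindex_onto (fun a => (a, a)) fst) /=; last first.
    by move=> [a b] /= /eqP ->.
  by apply: eq_big => a; rewrite !eqxx // mulrC.
under [RHS]eq_bigr => p _ do rewrite -krk.
rewrite (psi_contract psi_r s t (fun q : I * I * I => q.1.1) (fun q : I * I * I => q.2)
  (fun q : I * I * I => v q.1.1 q.1.2 * u q.2 q.1.2)).
rewrite (reindex_onto (fun z => (t, z, s)) (fun q => q.1.2)) /=; last first.
  by move=> [[x y] w] /= /andP[/eqP -> /eqP ->].
by apply: eq_big => [z|z _]; rewrite ?eqxx // mulrC.
Qed.

End TraceWeight.

Section SmallWords.
Variables (N : nat).

Definition w1 (a : 'I_N) : word N 1 := [ffun=> a].
Definition w2 (a b : 'I_N) : word N 2 := [ffun i : 'I_2 => if val i is 0 then a else b].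
Definition w3 (a b c : 'I_N) : word N 3 :=
  [ffun i : 'I_3 => match val i with 0 => a | 1 => b | _ => c end].

Lemma w2E (s : word N 2) : s = w2 (s ord0) (s ord_max).
Proof.
by apply/ffunP => -[[|[|//]] i2]; rewrite ffunE /=; congr (s _); apply: val_inj.
Qed.

Lemma sum_w2 (V : nmodType) (F : word N 2 -> V) :
  \sum_w F w = \sum_a \sum_b F (w2 a b).
Proof.
rewrite pair_big /= (reindex (fun p : 'I_N * 'I_N => w2 p.1 p.2)) //.
exists (fun w : word N 2 => (w ord0, w ord_max)) => [[a b] _|w _] /=; last by rewrite -w2E.
by rewrite !ffunE.
Qed.

Let p1 (i : 'I_2) : 'I_3 := inord (1.-1 + i).
Let p2 (i : 'I_2) : 'I_3 := inord (2.-1 + i).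

Let p1I : injective p1. Proof. exact: strand_inj. Qed.
Let p2I : injective p2. Proof. exact: strand_inj. Qed.

Let p1_codom (j : 'I_3) : (j \in codom p1) = (j != ord_max).
Proof.
apply/codomP/idP => [[i ->]|jm].
  apply/negP => /eqP/(congr1 val) /=; have := ltn_ord i => li.
  by rewrite inordK; lia.
have j2 : nat_of_ord j <> 2%N by move=> e; case/eqP: jm; apply: val_inj.
have lj : (j < 2)%N by have := ltn_ord j; lia.
by exists (Ordinal lj); apply: val_inj; rewrite /= inordK //=; apply: leq_trans lj _.
Qed.

Let p2_codom (j : 'I_3) : (j \in codom p2) = (j != ord0).
Proof.
apply/codomP/idP => [[i ->]|jm].
  apply/negP => /eqP/(congr1 val) /=; have := ltn_ord i => li.
  by rewrite inordK; lia.
have j0 : nat_of_ord j <> 0%N by move=> e; case/eqP: jm; apply: val_inj.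
have lj : (j.-1 < 2)%N by have := ltn_ord j; lia.
by exists (Ordinal lj); apply: val_inj; rewrite /= inordK /=; have := ltn_ord j; lia.
Qed.

Let pull1 a b c : pull p1 (w3 a b c) = w2 a b.
Proof. by apply/ffunP => -[[|[|//]] i2]; rewrite !ffunE /= inordK. Qed.

Let pull2 a b c : pull p2 (w3 a b c) = w2 b c.
Proof. by apply/ffunP => -[[|[|//]] i2]; rewrite !ffunE /= inordK. Qed.

Let w3E (s : word N 3) : s = w3 (s ord0) (s (inord 1)) (s ord_max).
Proof.
apply/ffunP => -[[|[|[|//]]] i2]; rewrite ffunE /=; congr (s _); apply: val_inj => //=.
by rewrite inordK.
Qed.

Let paste1 a b c x y : paste p1 (w3 a b c) (w2 x y) = w3 x y c.
Proof.
rewrite [LHS]w3E; congr w3.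
- have -> : ord0 = p1 ord0 by apply: val_inj; rewrite /= inordK.
  by rewrite paste_in // ffunE.
- have -> : inord 1 = p1 ord_max by apply: val_inj; rewrite /= !inordK.
  by rewrite paste_in // ffunE.
- by rewrite paste_out ?ffunE // p1_codom eqxx.
Qed.

Let paste2 a b c x y : paste p2 (w3 a b c) (w2 x y) = w3 a x y.
Proof.
rewrite [LHS]w3E; congr w3.
- by rewrite paste_out ?ffunE // p2_codom eqxx.
- have -> : inord 1 = p2 ord0 by apply: val_inj; rewrite /= !inordK.
  by rewrite paste_in // ffunE.
- have -> : ord_max = p2 ord_max by apply: val_inj; rewrite /= inordK.
  by rewrite paste_in // ffunE.
Qed.

Variable (A : pzRingType).

Lemma ent_mul1 (X : op A N 2) (Y : op A N 3) a b c t :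
  ent (at_factor 2 X 1 * Y) (w3 a b c) t =
  \sum_x \sum_y ent X (w2 a b) (w2 x y) * ent Y (w3 x y c) t.
Proof.
rewrite ent_embed_mull // sum_w2; apply: eq_bigr => x _; apply: eq_bigr => y _.
by rewrite -[fun _ => _]/p1 pull1 paste1.
Qed.

Lemma ent_mul2 (X : op A N 2) (Y : op A N 3) a b c t :
  ent (at_factor 2 X 2 * Y) (w3 a b c) t =
  \sum_x \sum_y ent X (w2 b c) (w2 x y) * ent Y (w3 a x y) t.
Proof.
rewrite ent_embed_mull // sum_w2; apply: eq_bigr => x _; apply: eq_bigr => y _.
by rewrite -[fun _ => _]/p2 pull2 paste2.
Qed.

Lemma ent_at1 (X : op A N 2) a b c a' b' c' :
  ent (at_factor 2 X 1) (w3 a b c) (w3 a' b' c') =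
  if c == c' then ent X (w2 a b) (w2 a' b') else 0.
Proof.
rewrite ent_embed -/p1 !pull1; congr (if _ then _ else _).
apply/agreeP/eqP => [h|cc j]; last by rewrite p1_codom negbK => /eqP ->; rewrite !ffunE.
by have := h ord_max; rewrite p1_codom eqxx !ffunE /= => ->.
Qed.

Lemma ent_at2 (X : op A N 2) a b c a' b' c' :
  ent (at_factor 2 X 2) (w3 a b c) (w3 a' b' c') =
  if a == a' then ent X (w2 b c) (w2 b' c') else 0.
Proof.
rewrite ent_embed -/p2 !pull2; congr (if _ then _ else _).
apply/agreeP/eqP => [h|cc j]; last by rewrite p2_codom negbK => /eqP ->; rewrite !ffunE.
by have := h ord0; rewrite p2_codom eqxx !ffunE /= => ->.
Qed.

Lemma insert_mid a b c : insert_letter (inord 1) c (w2 a b) = w3 a c b.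
Proof.
have e0 : lift (inord 1 : 'I_3) (ord0 : 'I_2) = ord0 by apply: val_inj; rewrite /= inordK.
have e2 : lift (inord 1 : 'I_3) (ord_max : 'I_2) = ord_max by apply: val_inj; rewrite /= /bump inordK.
rewrite [LHS]w3E; congr w3; rewrite ffunE.
- by rewrite -e0 liftK ffunE.
- by rewrite unlift_none.
- by rewrite -e2 liftK ffunE.
Qed.

Lemma insert_last a c : insert_letter ord_max c (w1 a) = w2 a c.
Proof.
have e0 : lift (ord_max : 'I_2) (ord0 : 'I_1) = ord0 by apply: val_inj.
rewrite [LHS]w2E; congr w2; rewrite ffunE.
- by rewrite -e0 liftK ffunE.
- by rewrite unlift_none.
Qed.

End SmallWords.

Section SkewInverse.
Variables (C : fieldType) (N : nat) (R Psi : op C N 2).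
Local Notation e4 X := (fun a b c d => ent X (w2 a b) (w2 c d)).

Lemma skew_entries : ptrace (inord 1) (at_factor 2 Psi 1 * at_factor 2 R 2) = flip N C ->
  forall s1 s3 t1 t3, \sum_(p : 'I_N * 'I_N) e4 Psi s1 p.1 t1 p.2 * e4 R p.2 s3 p.1 t3 =
   ((s1 == t3) && (s3 == t1))%:R.
Proof.
move=> sk s1 s3 t1 t3; have := congr1 (fun X => ent X (w2 s1 s3) (w2 t1 t3)) sk.
rewrite !ent_mkop !ffunE /= => <-; rewrite -(pair_big xpredT xpredT
  (fun a b => e4 Psi s1 a t1 b * e4 R b s3 a t3)) /=.
apply: eq_bigr => a _; rewrite !insert_mid ent_mul1.
rewrite exchange_big; apply: eq_bigr => b _ /=; rewrite (bigD1 t1) //= big1.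
  by rewrite addr0 ent_at2 eqxx.
by move=> x /negbTE h; rewrite ent_at2 h mulr0.
Qed.

Lemma psi_of_skew : skew_invertible R -> skew_inverse R (Psi_of R).
Proof. by case=> P hP; rewrite /Psi_of; apply: (xgetPex 0 (ex_intro _ P hP)). Qed.

End SkewInverse.

(** * BMW relations of an R-matrix *)

(** Multiplied out, the quadratic factor is 1 + lam r - r^2, so that the definition
of k is the skein relation and the cubic relation says that r k = mu k. *)
Lemma bmw_genI (C : fieldType) (H : algType C) (q mu lam : C) (r k : H) :
  lam = q - q^-1 -> q != 0 -> mu != 0 -> lam != 0 ->
  k = (mu^-1 * lam^-1) *: ((q *: 1 - r) * (q^-1 *: 1 + r)) ->
  (q *: 1 - r) * (q^-1 *: 1 + r) * (mu *: 1 - r) = 0 -> bmw_gen mu lam r k.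
Proof.
move=> lamE q0 mu0 lam0 kE cub.
have cr c : GRing.comm r (c *: 1) by apply: comm_scale; exact: commr1.
have rp : GRing.comm r ((q *: 1 - r) * (q^-1 *: 1 + r)).
  by apply: commrM; [apply: commrB | apply: commrD].
have pE : (q *: 1 - r) * (q^-1 *: 1 + r) = 1 + lam *: r - r * r.
  rewrite mulrBl !mulrDr -!scalerAl -!scalerAr !mul1r !mulr1 scalerA divff // scale1r.
  by rewrite lamE scalerBl opprD !addrA.
have rk : r * k = mu *: k.
  have e : (q *: 1 - r) * (q^-1 *: 1 + r) * r = mu *: ((q *: 1 - r) * (q^-1 *: 1 + r)).
    by apply/eqP; rewrite eq_sym -subr_eq0 -{1}[X in mu *: X]mulr1 scalerAr -mulrBr cub.
  by rewrite kE -scalerAr rp e !scalerA [_ * mu]mulrC.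
have kr : k * r = mu *: k.
  by rewrite -rk kE -scalerAr -scalerAl rp.
have lk : (lam * mu) *: k = 1 + lam *: r - r * r.
  have e1 : (lam * mu) * (mu^-1 * lam^-1) = 1 by field; rewrite lam0.
  by rewrite kE scalerA pE e1 scale1r.
split=> //; rewrite /skein_inv.
- rewrite mulrBr -scalerAr mulrBr mulr1 rk scalerBr scalerA lk.
  by rewrite opprB addrC [1 + _ - _ - _]addrAC addrK subrK.
- rewrite mulrBl -scalerAl mulrBl mul1r kr scalerBr scalerA lk.
  by rewrite opprB addrC [1 + _ - _ - _]addrAC addrK subrK.
Qed.

Section Lift.
Variables (C : fieldType) (A : algType C) (N' n : nat).
Local Notation N := N'.+1.
Local Notation H := (tens A N' n).

Definition place m k (X : op C N k) : H := at_factor n (extend_scalars A X) m.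

Lemma placeM m k (X Y : op C N k) : (m.-1 + k <= n.+1)%N ->
  place m (X * Y) = place m X * place m Y.
Proof. by move=> mk; rewrite /place extM at_factorM. Qed.

Lemma place1 m k : place m (1 : op C N k) = 1.
Proof. by rewrite /place ext1 at_factor1. Qed.

Lemma placeD m k (X Y : op C N k) : place m (X + Y) = place m X + place m Y.
Proof. by rewrite /place extD at_factorD. Qed.

Lemma placeN m k (X : op C N k) : place m (- X) = - place m X.
Proof. by rewrite /place extN at_factorN. Qed.

Lemma placeZ m k c (X : op C N k) : place m (c *: X) = c *: place m X.
Proof.
apply: opP => s t; rewrite ent_tscale !ent_embed; case: ifP => _; last by rewrite scaler0.
by rewrite !ent_ext /ent mxE scalerA.
Qed.

Lemma place0 m k : place m (0 : op C N k) = 0.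
Proof. by rewrite -[X in place m X](scale0r 0) placeZ scale0r. Qed.

Lemma place_scalar m k c : place m (c%:M : op C N k) = c *: 1.
Proof. by rewrite -scalemx1 placeZ place1. Qed.

Lemma place_at m l j k (X : op C N k) : (m.-1 + k <= l.+1)%N ->
  (j.-1 + l.+1 <= n.+1)%N -> (0 < m)%N ->
  place j (at_factor l X m) = place (j.-1 + m) X.
Proof. by move=> mk jl m0; rewrite /place ext_at at_factor_at. Qed.

Lemma place_full_inj (X Y : op C N n.+1) : place 1 X = place 1 Y -> X = Y.
Proof. by rewrite /place !at_factor_id; apply: ext_inj. Qed.

Lemma place_horner m k (X : op C N k) (p : {poly C}) : (m.-1 + k <= n.+1)%N ->
  annihilates p X -> horner_alg (place m X) p = 0.
Proof.
move=> mk pX; have := congr1 (fun Y => place m Y) pX; rewrite place0 => <-.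
rewrite /horner_alg /horner_morph horner_coef size_map_poly.
rewrite (big_morph (fun Y : op C N k => place m Y) (@placeD m k) (@place0 m k)).
apply: eq_bigr => i _; rewrite coef_map placeZ mulr_algl; congr (_ *: _).
elim: (i : nat) => [|j IH]; first by rewrite !expr0 place1.
by rewrite !exprS placeM // IH.
Qed.

Lemma place_annihilates (X : op C N n.+1) (p : {poly C}) :
  horner_alg (place 1 X) p = 0 -> annihilates p X.
Proof.
rewrite /horner_alg /horner_morph horner_coef size_map_poly => e.
apply: place_full_inj; rewrite place0 -[RHS]e.
rewrite (big_morph (fun Y : op C N n.+1 => place 1 Y) (@placeD 1 n.+1) (@place0 1 n.+1)).
apply: eq_bigr => i _; rewrite coef_map placeZ mulr_algl; congr (_ *: _).
elim: (i : nat) => [|j IH]; first by rewrite !expr0 place1.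
by rewrite !exprS placeM // IH.
Qed.

End Lift.

Section Family.
Variables (C : fieldType) (A : algType C) (N' : nat) (q mu : C).
Local Notation N := N'.+1.
Variable R : op C N 2.
Hypothesis bmwR : BMW_type q mu R.
Local Notation lam := (q - q^-1).
Local Notation K := (Kmat q mu R).

Lemma bmw_q0 : q != 0. Proof. by case: bmwR => -[]. Qed.
Lemma bmw_mu0 : mu != 0. Proof. by case: bmwR => _ []. Qed.
Lemma bmw_lam0 : lam != 0.
Proof.
case: bmwR => -[q0 q1 q1'] _ _ _ _; rewrite subr_eq0; apply: contraNneq q1' => e.
have : (q - 1) * (q + 1) == 0.
  by rewrite -subr_sqr expr1n subr_eq0 expr2 {2}e mulfV.
by rewrite mulf_eq0 subr_eq0 (negbTE q1) addr_eq0.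
Qed.
Lemma bmw_loop0 : loop_val q mu lam != 0.
Proof.
case: bmwR => _ [mu0 muq muq'] _ _ _.
have e1 : q - mu != 0 by rewrite subr_eq0 eq_sym.
have e2 : q^-1 + mu != 0 by rewrite addrC addr_eq0.
by rewrite /loop_val !mulf_neq0 ?invr_eq0 ?mulf_neq0 ?bmw_lam0.
Qed.

Section Strands.
Variable n : nat.
Local Notation H := (tens A N' n).
Local Notation place := (@place C A N' n).

Lemma place_K m : (m.-1 + 2 <= n.+1)%N ->
  place m K = (mu^-1 * lam^-1) *: ((q *: 1 - place m R) * (q^-1 *: 1 + place m R)).
Proof. by move=> mk; rewrite placeZ placeM // !placeD placeN !place_scalar. Qed.

Lemma bmw_gen_place m : (m.-1 + 2 <= n.+1)%N -> bmw_gen mu lam (place m R) (place m K).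
Proof.
move=> mn; apply: (bmw_genI (q := q)) => //; first exact: bmw_q0; first exact: bmw_mu0.
- exact: bmw_lam0.
- exact: place_K.
case: bmwR => _ _ _ [_ /(place_horner A mn) + _] _.
rewrite !rmorphM !rmorphB !rmorphD /= !horner_algX !horner_algC => e.
by rewrite -[q *: 1 - _]opprB -[mu *: 1 - _]opprB mulrN !mulNr opprK [_^-1 *: 1 + _]addrC e.
Qed.

Lemma skein_inv_place m : (m.-1 + 2 <= n.+1)%N ->
  skein_inv lam (place m R) (place m K) = place m (invmx R).
Proof.
move=> mn; have [g _ _ _] := bmw_gen_place mn.
have [Ru _] : Rmatrix R by case: bmwR.
have e : place m (invmx R) * place m R = 1.
  by rewrite -placeM // -(place1 _ _ _ m 2); congr (place m _); apply: mulVmx.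
by rewrite -[LHS]mul1r -e -mulrA g mulr1.
Qed.

Lemma bmw_fam_place : bmw_fam mu lam n.+1 (fun i => place i R) (fun i => place i K).
Proof.
split.
- by move=> i il; apply: bmw_gen_place; lia.
- move=> i i0 il; have [m1 m2] : (i.-1 + 2 <= n.+1)%N /\ (i.+1.-1 + 2 <= n.+1)%N by lia.
  have m3 : (i.-1 + 3 <= n.+1)%N by lia.
  have l1 (X : op C N 2) : place i (at_factor 2 X 1) = place i X.
    by rewrite place_at // addn1 prednK.
  have l2 (X : op C N 2) : place i (at_factor 2 X 2) = place i.+1 X.
    by rewrite place_at // addn2 prednK.
  case: bmwR => _ _ [_ br] _ [kk kk' kkk].
  apply: (bmw_adjI bmw_lam0); rewrite ?skein_inv_place //; first 2 last.
  + by have := congr1 (fun Y => place i Y) br; rewrite !placeM // !l1 !l2.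
  + by have := congr1 (fun Y => place i Y) kk; rewrite !placeM // !l1 !l2.
  + by have := congr1 (fun Y => place i Y) kk'; rewrite !placeM // !l1 !l2.
  + by have := congr1 (fun Y => place i Y) kkk; rewrite !placeM // !l1 !l2.
  + exact: bmw_gen_place.
  + exact: bmw_gen_place.
- move=> i j i0 ij jn; apply: at_factor_comm; [lia|lia|].
  by move=> s t s' t'; rewrite !ent_ext scalarC.
Qed.

End Strands.
End Family.

Section Contraction.
Variables (C : fieldType) (N' : nat) (q mu : C).
Local Notation N := N'.+1.
Variable R : op C N 2.
Hypothesis bmwR : BMW_type q mu R.
Hypothesis skewR : skew_invertible R.
Local Notation K := (Kmat q mu R).
Local Notation e4 X := (fun a b c d => ent X (w2 a b) (w2 c d)).

Lemma ent_at12 (X Y : op C N 2) a x y a' b' c' :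
  ent (at_factor 2 X 1 * at_factor 2 Y 2) (w3 a x y) (w3 a' b' c') =
  \sum_v e4 X a x a' v * e4 Y v y b' c'.
Proof.
rewrite ent_mul1 (bigD1 a') //= [X in _ + X]big1 ?addr0; last first.
  move=> z /negbTE h; rewrite big1 // => w _; by rewrite ent_at2 h mulr0.
by apply: eq_bigr => v _; rewrite ent_at2 eqxx.
Qed.

(** Otherwise R would satisfy a quadratic equation. *)
Lemma Kmat_neq0 : K != 0.
Proof.
apply/eqP => K0; have [_ [mu0 muq muq'] _ [mon _ minp] _] := bmwR.
have : annihilates (('X - q%:P) * ('X + (q^-1)%:P)) R.
  apply: (@place_annihilates C C^o N' 1).
  rewrite !rmorphM !rmorphB !rmorphD /= !horner_algX !horner_algC.
  have e := place_K C^o q mu R (isT : (1.-1 + 2 <= 2)%N); rewrite K0 place0 in e.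
  have /eqP := esym e; rewrite scaler_eq0 => /orP[|/eqP e'].
    by rewrite mulf_eq0 !invr_eq0 (negbTE mu0) (negbTE (bmw_lam0 bmwR)).
  by rewrite -[q *: 1 - _]opprB mulNr in e'; rewrite [_ + q^-1%:A]addrC -[LHS]opprK e' oppr0.
move=> /minp /dvdp_leq.
have e : 'X + q^-1%:P = 'X - (- q^-1)%:P by rewrite polyCN opprK.
have nz (x : C) : 'X - x%:P != 0 :> {poly C} by rewrite polyXsubC_eq0.
by rewrite e !size_mul ?mulf_neq0 ?nz //= !size_XsubC /= => /(_ isT).
Qed.

Lemma psi_R : forall s1 s3 t1 t3, \sum_(p : 'I_N * 'I_N)
  e4 (Psi_of R) s1 p.1 t1 p.2 * e4 R p.2 s3 p.1 t3 = ((s1 == t3) && (s3 == t1))%:R.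
Proof. by apply: skew_entries; have [] := psi_of_skew skewR. Qed.

Lemma Kmat_rank1 : exists u v : 'I_N -> 'I_N -> C,
  forall a b c d, e4 K a b c d = u a b * v c d.
Proof.
apply: (rank_one psi_R) => b c a a' b' c'.
case: bmwR => _ _ _ _ [/(congr1 (fun X => ent X (w3 a b c) (w3 a' b' c'))) + _ _].
rewrite -mulrA !ent_mul2 => e; transitivity (\sum_x \sum_y ent K (w2 b c) (w2 x y) *
    ent (at_factor 2 K 1) (w3 a x y) (w3 a' b' c')).
  apply: eq_bigr => x _; rewrite (bigD1 c') //= ent_at1 eqxx big1 ?addr0 // => y /negbTE h.
  by rewrite ent_at1 h mulr0.
rewrite e pair_big /= -(pair_big xpredT xpredT (fun p v => ent K (w2 b c) (w2 p.1 p.2) *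
  (ent R (w2 a p.1) (w2 a' v) * ent R (w2 v p.2) (w2 b' c')))) /=.
by apply: eq_bigr => p _; rewrite ent_at12 mulr_sumr.
Qed.

Lemma krk_op : at_factor 2 K 2 * at_factor 2 R 1 * at_factor 2 K 2 = mu^-1 *: at_factor 2 K 2.
Proof.
apply: (@place_full_inj C C^o N' 2).
rewrite placeZ !placeM // !place_at //.
exact: (bmw_krk (bmw_mu0 bmwR) (fam_adj (bmw_fam_place C^o bmwR 2) (isT : (0 < 1)%N) isT)).
Qed.

Lemma Kmat_trace : exists u v : 'I_N -> 'I_N -> C,
  [/\ forall a b c d, e4 K a b c d = u a b * v c d,
      forall c d, \sum_e u c e * v d e = mu^-1 * ent (D_of R) (w1 c) (w1 d) &
      exists a b c d, u a b * v c d != 0].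
Proof.
have [u [v uv]] := Kmat_rank1; exists u, v.
have nz : exists a b c d, u a b * v c d != 0.
  have [[i j] ij] : exists p : 'I_(word_count N 2) * 'I_(word_count N 2), K p.1 p.2 != 0.
    apply/existsP; apply: contraNT Kmat_neq0; rewrite negb_exists => /forallP K0.
    apply/eqP/matrixP => i j; rewrite [RHS]mxE; apply/eqP.
    by have := K0 (i, j) => /= /negbNE.
  have := uv (enum_val i ord0) (enum_val i ord_max) (enum_val j ord0) (enum_val j ord_max).
  rewrite /= -!w2E /ent !enum_valK => e.
  by exists (enum_val i ord0), (enum_val i ord_max), (enum_val j ord0), (enum_val j ord_max); rewrite -e.
split=> // c d.
have -> : ent (D_of R) (w1 c) (w1 d) = \sum_a e4 (Psi_of R) c a d a.
  by rewrite ent_mkop; apply: eq_bigr => a _; rewrite !insert_last.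
apply: (trace_weight psi_R) => a a'.
have [a0 [b0 [b1 [c1]]]] := nz; rewrite mulf_eq0 negb_or => /andP[u0 v0].
have := congr1 (fun X => ent X (w3 a a0 b0) (w3 a' b1 c1)) krk_op.
rewrite -mulrA ent_mul2 [RHS]mxE -/(ent _ _ _) ent_at2 uv => e.
apply: (mulfI u0); apply: (mulIf v0).
transitivity (mu^-1 * (if a == a' then u a0 b0 * v b1 c1 else 0)); last first.
  by case: eqP => _; rewrite ?mulr0 ?mul0r // mulrCA mulrA.
rewrite -e pair_big /= -(pair_big xpredT xpredT (fun p w =>
  (v p.1 p.2 * u w p.2) * e4 R a p.1 a' w)) /= mulr_sumr mulr_suml.
apply: eq_bigr => p _; rewrite ent_at12 !mulr_sumr mulr_suml.
by apply: eq_bigr => w _; rewrite !uv; ring.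
Qed.

End Contraction.

(** * The tower of operators on tensor powers *)

Section ScaledOperators.
Variables (C : fieldType) (A : algType C) (N : nat).

(** Multiplication by a scalar of the ground field. *)
Definition oscale n (c : C) (X : op A N n) : op A N n := map_mx (fun a => c *: a) X.

Lemma ent_oscale n c (X : op A N n) s t : ent (oscale c X) s t = c *: ent X s t.
Proof. by rewrite /ent mxE. Qed.

Lemma at_factor_oscale n k m c (X : op A N k) :
  at_factor n (oscale c X) m = oscale c (at_factor n X m).
Proof.
by apply: opP => s t; rewrite ent_oscale !ent_embed ent_oscale; case: ifP; rewrite ?scaler0.
Qed.

End ScaledOperators.

Section Restriction.
Variables (N' : nat) (A : pzRingType).
Local Notation N := N'.+1.

Definition front n k (i : 'I_k) : 'I_n.+1 := inord (1.-1 + i).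

Lemma front_inj n k : (k <= n.+1)%N -> injective (@front n k).
Proof. by move=> kn; apply: strand_inj. Qed.

Definition pad n k (s : word N k) : word N n.+1 := paste (@front n k) [ffun=> ord0] s.

(** A linear left inverse of the embedding in the first factors: the other factors
are frozen at the letter 0.  It makes the partial trace a total function. *)
Definition restrict n k (X : op A N n.+1) : op A N k :=
  mkop (fun s t => ent X (pad n s) (pad n t)).

Lemma agree_pad n k (s t : word N k) : agree (@front n k) (pad n s) (pad n t).
Proof. by apply/agreeP => j jp; rewrite !paste_out. Qed.

Lemma restrict_at n k (X : op A N k) : (k <= n.+1)%N -> restrict k (at_factor n X 1) = X.
Proof.
move=> kn; apply: opP => s t; rewrite ent_mkop ent_embed (agree_pad n s t).
by rewrite !pull_paste //; apply: front_inj.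
Qed.

Lemma at_factor_inj n k (X Y : op A N k) : (k <= n.+1)%N ->
  at_factor n X 1 = at_factor n Y 1 -> X = Y.
Proof. by move=> kn e; rewrite -(restrict_at X kn) e restrict_at. Qed.

End Restriction.

Section QuantumTrace.
Variables (C : fieldType) (A : algType C) (N' : nat) (q mu : C).
Local Notation N := N'.+1.
Variable R : op C N 2.
Hypothesis bmwR : BMW_type q mu R.
Hypothesis skewR : skew_invertible R.
Local Notation K := (Kmat q mu R).

Lemma RtraceD n (i : 'I_n.+1) (X Y : op A N n.+1) :
  Rtrace R i (X + Y) = Rtrace R i X + Rtrace R i Y.
Proof.
apply: opP => s t; rewrite entD !ent_mkop -big_split; apply: eq_bigr => c _ /=.
by rewrite -big_split; apply: eq_bigr => d _ /=; rewrite entD scalerDr.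
Qed.

Lemma RtraceZ n (i : 'I_n.+1) c (X : op A N n.+1) :
  Rtrace R i (oscale c X) = oscale c (Rtrace R i X).
Proof.
apply: opP => s t; rewrite ent_oscale !ent_mkop scaler_sumr; apply: eq_bigr => a _.
rewrite scaler_sumr; apply: eq_bigr => d _.
by rewrite ent_oscale scalerA mulrC -scalerA.
Qed.

Section LastTwo.
Variable i : nat.
Let pK (j : 'I_2) : 'I_i.+2 := inord (i.+1.-1 + j).
Let pX := @front i.+1 i.+1.
Let pY := @front i.+1 i.

Let pK0 : pK ord0 = inord i. Proof. by rewrite /pK /= addn0. Qed.
Let pK1 : pK ord_max = ord_max. Proof. by apply: val_inj; rewrite /= inordK /= addn1. Qed.

Let pKI : injective pK. Proof. by apply: strand_inj; rewrite /= addn2. Qed.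

Let pX_codom (j : 'I_i.+2) : (j \in codom pX) = (j != ord_max).
Proof.
apply/codomP/idP => [[l ->]|jm].
  by apply/negP => /eqP/(congr1 val) /=; have := ltn_ord l => li; rewrite inordK /=; lia.
have j2 : nat_of_ord j <> i.+1 by move=> e; case/eqP: jm; apply: val_inj.
have lj : (j < i.+1)%N by have := ltn_ord j; lia.
by exists (Ordinal lj); apply: val_inj; rewrite /= inordK /= //; lia.
Qed.

Let pY_pK l j : pY l != pK j.
Proof.
apply/eqP => /(congr1 val) /=; have := ltn_ord l; have := ltn_ord j => ? ?.
by rewrite !inordK /=; lia.
Qed.

Let pKY_cover (j : 'I_i.+2) : j \notin codom pY -> j \in codom pK.
Proof.
move=> jY; apply/codomP.
have ji : (i <= j)%N.
  rewrite leqNgt; apply: contra jY => ji; apply/codomP; exists (Ordinal ji).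
  by apply: val_inj; rewrite /= inordK /=; lia.
have lj : (j - i < 2)%N by have := ltn_ord j; lia.
by exists (Ordinal lj); apply: val_inj; rewrite /= inordK /=; have := ltn_ord j; lia.
Qed.

Let pull_insert (s : word N i.+2) w :
  pull pX (paste pK s w) = insert_letter ord_max (w ord0) (pull pY s).
Proof.
apply/ffunP => j; rewrite [LHS]ffunE [RHS]ffunE.
case: unliftP => [l|] ->; last first.
  have -> : pX ord_max = pK ord0 by apply: val_inj; rewrite pK0 /= !inordK.
  by rewrite paste_in //.
have -> : pX (lift ord_max l) = pY l.
  by rewrite /pX /pY /front /= /bump leqNgt ltn_ord.
rewrite paste_out ?ffunE //; apply/negP => /codomP[m /eqP].
exact/negP/pY_pK.
Qed.

(** As K(s,t) = u(s) v(t), the product contracts the last letters of X with the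
weight sum_e u(c,e) v(d,e), which [Kmat_trace] identifies as mu^-1 D_R. *)
Lemma KXK (X : op A N i.+1) :
  at_factor i.+1 (extend_scalars A K) i.+1 * at_factor i.+1 X 1
    * at_factor i.+1 (extend_scalars A K) i.+1 =
  oscale mu^-1 (at_factor i.+1 (Rtrace R ord_max X) 1
    * at_factor i.+1 (extend_scalars A K) i.+1).
Proof.
have [u [v [uv uvD _]]] := Kmat_trace bmwR skewR.
apply: opP => s t; rewrite ent_oscale.
rewrite (ent_disjoint (p := pY) (p' := pK)) //; last by apply: front_inj; lia.
have -> : [forall j, (j \notin codom pY) ==> (j \notin codom pK) ==> (s j == t j)].
  by apply/forallP => j; apply/implyP => /pKY_cover ->.
rewrite -mulrA (ent_embed_mull (p := pK)) //.
set us := u (pull pK s ord0) (pull pK s ord_max).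
set vt := v (pull pK t ord0) (pull pK t ord_max).
have -> : ent (extend_scalars A K) (pull pK s) (pull pK t) = (us * vt)%:A.
  by rewrite ent_ext [pull pK s]w2E [pull pK t]w2E uv.
pose x a c := ent X (insert_letter ord_max a (pull pY s)) (insert_letter ord_max c (pull pY t)).
have XE w w' : ent (at_factor i.+1 X 1) (paste pK s w) (paste pK t w') =
    if w ord_max == w' ord_max then x (w ord0) (w' ord0) else 0.
  rewrite ent_embed -/pX !pull_insert; congr (if _ then _ else _).
  apply/agreeP/eqP => [h|e j].
    by have := h (pK ord_max); rewrite !paste_in // pX_codom pK1 eqxx; apply.
  by rewrite pX_codom negbK => /eqP ->; rewrite -pK1 !paste_in.
transitivity (\sum_a \sum_c (us * vt * (mu^-1 * ent (D_of R) (w1 c) (w1 a))) *: x a c).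
  rewrite sum_w2; apply: eq_bigr => a _.
  under [RHS]eq_bigr => c _ do rewrite -uvD mulr_sumr scaler_suml.
  rewrite exchange_big; apply: eq_bigr => b _.
  rewrite ent_ext [pull pK s]w2E uv (ent_embed_mulr (p := pK)) // sum_w2 mulr_sumr.
  apply: eq_bigr => c _; rewrite (bigD1 b) //= [X in _ + X]big1 ?addr0; last first.
    by move=> d /negbTE h; rewrite XE !ffunE /= eq_sym h mul0r.
  rewrite XE !ffunE /= eqxx ent_ext [pull pK t]w2E uv.
  rewrite mulr_algl mulr_algr scalerA; congr (_ *: _).
  by rewrite /us /vt !ffunE; ring.
rewrite ent_mkop mulr_algr scalerA exchange_big scaler_sumr; apply: eq_bigr => c _.
rewrite scaler_sumr; apply: eq_bigr => a _; rewrite scalerA; congr (_ *: _).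
by rewrite /w1; ring.
Qed.
End LastTwo.
End QuantumTrace.

Section OperatorTower.
Variables (C : fieldType) (A : algType C) (N' : nat) (q mu : C).
Local Notation N := N'.+1.
Variables R F : op C N 2.
Hypothesis bmwR : BMW_type q mu R.
Hypothesis skewR : skew_invertible R.
Hypothesis RF : compatible R F.
Local Notation K := (Kmat q mu R).
Variable n : nat.
Local Notation H := (tens A N' n).
Local Notation pl := (@place C A N' n).

Definition first_strands i (X : H) : Prop :=
  (i <= n.+1)%N -> exists X' : op A N i, X = at_factor n X' 1.

Definition strand_trace i (X : H) : H :=
  if i is j.+1 then at_factor n (Rtrace R ord_max (restrict j.+1 X)) 1 else 0.

Lemma strand_traceE i (X : op A N i.+1) : (i < n.+1)%N ->
  strand_trace i.+1 (at_factor n X 1) = at_factor n (Rtrace R ord_max X) 1.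
Proof. by move=> ii; rewrite /= restrict_at. Qed.

Lemma restrictD k (X Y : H) : restrict k (X + Y) = restrict k X + restrict k Y.
Proof. by apply: opP => s t; rewrite entD !ent_mkop entD. Qed.

Lemma restrictZ k c (X : H) : restrict k (c *: X) = oscale c (restrict k X).
Proof. by apply: opP => s t; rewrite ent_oscale !ent_mkop ent_tscale. Qed.

Lemma tensZ k m c (X : op A N k) :
  c *: (at_factor n X m : H) = at_factor n (oscale c X) m.
Proof. by rewrite at_factor_oscale. Qed.

Lemma place_front i (X : op C N 2) : (0 < i < n.+1)%N -> first_strands i.+1 (pl i X).
Proof.
case: i => // i /andP[_ ii] _; exists (at_factor i.+1 (extend_scalars A X) i.+1).
by rewrite at_factor_at //; lia.
Qed.

Lemma place_comm i j X (Y : op C N 2) : (i < j < n.+1)%N -> first_strands i X ->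
  GRing.comm X (pl j Y).
Proof.
move=> ij Sx; have [|X' ->] := Sx; first lia.
apply: at_factor_comm; [lia|lia|].
by move=> s t s' t'; rewrite ent_ext scalarC.
Qed.

Lemma place3 i (e : (0 < i)%N) (ii : (i.+1 < n.+1)%N) (X Y Z X' Y' Z' : op C N 2) :
  at_factor 2 X 1 * at_factor 2 Y 2 * at_factor 2 Z 1 =
  at_factor 2 X' 2 * at_factor 2 Y' 1 * at_factor 2 Z' 2 ->
  pl i X * pl i.+1 Y * pl i Z = pl i.+1 X' * pl i Y' * pl i.+1 Z'.
Proof.
move=> /(congr1 (fun Y => pl i Y)).
have l1 (W : op C N 2) : pl i (at_factor 2 W 1) = pl i W.
  by rewrite place_at // ?addn1 ?prednK //; lia.
have l2 (W : op C N 2) : pl i (at_factor 2 W 2) = pl i.+1 W.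
  by rewrite place_at // ?addn2 ?prednK //; lia.
have m3 : (i.-1 + 3 <= n.+1)%N by lia.
by rewrite !placeM // !l1 !l2.
Qed.

Lemma place_KXK i (X : H) : (i.+1 < n.+1)%N -> first_strands i.+1 X ->
  pl i.+1 K * X * pl i.+1 K = mu^-1 *: (strand_trace i.+1 X * pl i.+1 K).
Proof.
move=> ii Sx; have [|X' ->] := Sx; first lia.
rewrite strand_traceE; last lia.
have := congr1 (fun Y => at_factor n Y 1) (KXK bmwR skewR X').
rewrite at_factor_oscale !at_factorM ?at_factor_at //; lia.
Qed.

Lemma place_K_inj i (X : H) : (i.+1 < n.+1)%N -> first_strands i X ->
  X * pl i.+1 K = 0 -> X = 0.
Proof.
move=> ii Sx; have [|X' ->] := Sx; first lia.
have [u [v [uv _ [a [b [c [d nz]]]]]]] := Kmat_trace bmwR skewR.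
move=> e; rewrite -(at_factor0 _ _ n i 1); congr at_factor.
apply: opP => s t; rewrite ent0.
pose pK (j : 'I_2) : 'I_n.+1 := inord (i.+1.-1 + j).
have pKI : injective pK by apply: strand_inj; rewrite /= addn2.
have pY_pK (l : 'I_i) j : @front n i l != pK j.
  apply/eqP => /(congr1 val) /=; have := ltn_ord l; have := ltn_ord j => ? ?.
  by rewrite !inordK /=; lia.
have fI : injective (@front n i) by apply: front_inj; lia.
have pullK (w : word N i) z : pull pK (paste pK (pad n w) z) = z by apply: pull_paste.
have pullY (w : word N i) z : pull (@front n i) (paste pK (pad n w) z) = w.
  apply/ffunP => j; rewrite ffunE paste_out ?paste_in //.
  by apply/negP => /codomP[l /eqP]; apply/negP.
have := congr1 (fun Y : op A N n.+1 => ent Y (paste pK (pad n s) (w2 a b)) (paste pK (pad n t) (w2 c d))) e.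
rewrite (ent_disjoint (p := @front n i) (p' := pK)) // ent0 !pullK !pullY.
case: ifP => [_|/negP[]]; last first.
  apply/forallP => j; apply/implyP => jY; apply/implyP => jK.
  by rewrite !paste_out // !ffunE.
rewrite ent_ext uv mulr_algr => /eqP; rewrite scaler_eq0.
by rewrite (negbTE nz) => /eqP.
Qed.

Lemma place_unit i (X : op C N 2) : X \in unitmx -> (0 < i < n.+1)%N ->
  pl i X * pl i (invmx X) = 1 /\ pl i (invmx X) * pl i X = 1.
Proof.
move=> Xu ii; have mi : (i.-1 + 2 <= n.+1)%N by lia.
rewrite -!placeM // -!(place1 _ _ n i 2).
by split; congr (place _ _ _ _); [apply: mulmxV|apply: mulVmx].
Qed.

(* Transparent, so that its projections compute. *)
Definition op_tower : tower H mu (q - q^-1) n.+1.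
Proof.
refine (@Tower C H mu (q - q^-1) n.+1 (fun i => pl i R) (fun i => pl i K)
  (fun i => pl i F) (fun i => pl i (invmx F)) first_strands strand_trace
  _ _ _ _ _ _ _ _ _ _ _ _ _ _ _ _ _ _ _ _ _ _ _).
- exact: bmw_fam_place.
- by move=> i _; exists 1; rewrite at_factor1.
- move=> i x y Sx Sy ii; have [X ->] := Sx ii; have [Y ->] := Sy ii.
  by exists (X + Y); rewrite at_factorD.
- move=> i c x Sx ii; have [X ->] := Sx ii.
  by exists (oscale c X); rewrite tensZ.
- move=> i x y Sx Sy ii; have [X ->] := Sx ii; have [Y ->] := Sy ii.
  by exists (X * Y); rewrite at_factorM.
- move=> i [|j] x ij Sx jj; have [|X ->] := Sx; try lia.
    by move: ij; rewrite leqn0 => /eqP i0; subst i; exists X.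
  by exists (at_factor j X 1); rewrite at_factor_at.
- by move=> i; apply: place_front.
- by move=> i; apply: place_front.
- by move=> i; apply: place_front.
- by move=> i; apply: place_front.
- by move=> i j x; apply: place_comm.
- by move=> i j x; apply: place_comm.
- by move=> i j x; apply: place_comm.
- by move=> i ii; have [_ [Fu _] _ _] := RF; have [] := place_unit Fu ii.
- by move=> i ii; have [_ [Fu _] _ _] := RF; have [] := place_unit Fu ii.
- by move=> i i0 ii; have [_ [_ br] _ _] := RF; apply: place3.
- by move=> i i0 ii; have [_ _ br _] := RF; apply: place3.
- by move=> i i0 ii; have [_ _ _ br] := RF; apply/esym/place3.
- move=> [|i] x y; first by rewrite addr0.
  by rewrite /= restrictD RtraceD at_factorD.
- move=> [|i] c x; first by rewrite scaler0.
  by rewrite /= restrictZ RtraceZ tensZ.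
- by move=> i x ii Sx _; exists (Rtrace R ord_max (restrict i.+1 x)).
- exact: place_KXK.
- exact: place_K_inj.
Defined.

End OperatorTower.

(** * Comparison with the elements of the quantum matrix algebra *)

Section Comparison.
Variables (C : fieldType) (A : algType C) (N' : nat) (q mu : C).
Local Notation N := N'.+1.
Local Notation lam := (q - q^-1).
Variables R F : op C N 2.
Variable M : op A N 1.
Hypothesis bmwR : BMW_type q mu R.
Hypothesis skewR : skew_invertible R.
Hypothesis RF : compatible R F.
Hypothesis relM : qm_relator R F M = 0.
Local Notation K := (Kmat q mu R).
Variable n : nat.
Local Notation H := (tens A N' n).
Local Notation pl := (@place C A N' n).
Local Notation t := (op_tower A bmwR skewR RF n).
Local Notation front X := (at_factor n X 1 : H).
Local Notation MM := (front M).

Let mu0 := bmw_mu0 bmwR.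
Let lam0 := bmw_lam0 bmwR.

Lemma front_Mbar i j : (0 < j <= i.+1)%N -> (i < n.+1)%N ->
  front (Mbar F M i j) = Mb t MM j.
Proof.
elim: j => [//|[|j] IH] ji ii; first by rewrite /= at_factor_at.
have f_at (X : op C N 2) : front (extend_scalars A (at_factor i X j.+1)) = pl j.+1 X.
  by rewrite ext_at at_factor_at //; lia.
have -> : Mb t MM j.+2 = pl j.+1 F * Mb t MM j.+1 * pl j.+1 (invmx F) by [].
rewrite -IH; [|lia|lia].
have -> : Mbar F M i j.+2 = extend_scalars A (at_factor i F j.+1) * Mbar F M i j.+1
  * extend_scalars A (at_factor i (invmx F) j.+1) by [].
by rewrite !at_factorM // !f_at.
Qed.

Lemma front_Mbar_prod i j : (0 < j <= i.+1)%N -> (i < n.+1)%N ->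
  front (Mbar_prod F M i j) = PM t MM 0 j.
Proof.
move=> ji ii; rewrite /Mbar_prod /PM big_add1 -[j.+1.-1]/j.
have mm : {morph (fun X : op A N i.+1 => front X) : x y / x * y} by move=> x y; apply: at_factorM.
rewrite (big_morph _ mm (at_factor1 _ _ n i.+1 1)).
by apply: eq_big_nat => l lj; apply: front_Mbar => //; lia.
Qed.

Lemma front_Rtrace_all i (X : op A N i) : (i <= n.+1)%N ->
  trs t 0 i (front X) = (Rtrace_all R X)%:M.
Proof.
elim: i X => [|i IH] X ii.
  apply: opP => s w; rewrite ent_embed /=.
  have -> : agree (fun j : 'I_0 => inord (1.-1 + j) : 'I_n.+1) s w = (s == w).
    apply/agreeP/eqP => [h|-> //]; apply/ffunP => j; apply: h.
    by apply/negP => /codomP[[]].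
  have card0 : word_count N 0 = 1%N by rewrite /word_count card_ffun !card_ord expn0.
  rewrite [RHS]mxE (inj_eq enum_rank_inj); case: ifP => //= _.
  rewrite mulr1n /mxtrace.
  have : (forall a b : 'I_(word_count N 0), a = b) by rewrite card0 => a b; rewrite !ord1.
  move=> all_eq; rewrite /ent (bigD1 (enum_rank (pull (fun j : 'I_0 => inord (1.-1 + j)) s))) //=.
  rewrite big1 ?addr0; last by move=> a /eqP[]; apply: all_eq.
  by congr (X _ _); apply: all_eq.
by rewrite [LHS]/= add0n restrict_at // IH //; lia.
Qed.

Lemma front_star_pow m : (m < n)%N -> front (star_pow R F M m) = Xp t MM m.
Proof.
elim: m => [|m IH] mn; first by rewrite /= at_factor1.
have SM : tw_S t 1 MM by move=> _; exists M.
rewrite (Xp_rec SM mu0 lam0); last lia.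
rewrite [star_pow _ _ _ _]/= at_factorM; last lia.
congr (_ * _); rewrite /qm_phi -[LHS]strand_traceE; last lia.
rewrite !at_factorM //; try lia.
rewrite at_factor_at //; try lia.
by rewrite IH //; lia.
Qed.

Lemma place_antisym i j s : (s + i < n.+1)%N -> (j <= i.+1)%N ->
  pl s.+1 (antisym q mu R i j) =
  asy q mu lam (tw_r t) (tw_k t) s j.
Proof.
move=> si; elim: j => [|[|j] IH] ji; try by rewrite place1.
have pk (X : op C N 2) : pl s.+1 (at_factor i X j.+1) = pl (s + j.+1) X.
  by rewrite place_at //; lia.
rewrite [antisym _ _ _ _ _]/= placeZ !placeM; try lia.
rewrite IH; last lia.
rewrite /Rminus !placeD !placeZ place1 !pk.
by rewrite /asy /= /Rm /Rm_r /Rm_k.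
Qed.

Lemma front_qm_a i : (i < n.+1)%N -> (qm_a q mu R F M i)%:M = qa q t MM i :> H.
Proof.
case: i => [|i] ii; first by rewrite /qa /= /PM big_geq // mulr1.
rewrite /qa -(front_Mbar_prod (i := i)); [|lia|lia].
rewrite -(place_antisym (i := i)) //; last lia.
rewrite /place -at_factorM; last exact: ltnW.
exact: esym (front_Rtrace_all (Mbar_prod F M i i.+1 * extend_scalars A (antisym q mu R i i.+1)) (ltnW ii)).
Qed.

Lemma scalarM (a b : A) : (a * b)%:M = (a%:M : H) * (b%:M : H).
Proof. exact: scalar_mxM. Qed.

Lemma scalarX (a : A) m : (a ^+ m)%:M = (a%:M : H) ^+ m.
Proof. by elim: m => [|m IH]; rewrite ?expr0 // !exprS scalarM IH. Qed.

Lemma scalarZ c (a : A) : (c *: a)%:M = c *: (a%:M : H).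
Proof. by apply: opP => s w; rewrite ent_tscale /ent !mxE scalerMnr. Qed.

Lemma front_scalar i (a : A) : front (a%:M : op A N i) = a%:M.
Proof.
apply: opP => s w; rewrite ent_embed; case: ifP => sw.
  rewrite /ent !mxE !(inj_eq enum_rank_inj); congr (_ *+ _); congr nat_of_bool.
  apply/eqP/eqP => [e|-> //]; apply/ffunP => j.
  case: (boolP (j \in codom (fun l : 'I_i => inord (1.-1 + l) : 'I_n.+1))) => jc.
    by have [l ->] := codomP jc; move/ffunP/(_ l): e; rewrite !ffunE.
  by move/agreeP: sw; apply.
rewrite /ent mxE (inj_eq enum_rank_inj).
case: eqP => // e; move/agreeP: sw; rewrite e; by case.
Qed.

Let SM : tw_S t 1 MM. Proof. by move=> _; exists M. Qed.

(** K has rank one, so K P K is K times an element of the algebra. *)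
Let kMk (P : op A N 2) : exists c : A,
  extend_scalars A K * P * extend_scalars A K = extend_scalars A K * c%:M.
Proof.
have [u [v [uv _ _]]] := Kmat_trace bmwR skewR.
have uvw x y : ent (extend_scalars A K) x y = (u (x ord0) (x ord_max) * v (y ord0) (y ord_max))%:A.
  by rewrite ent_ext {1}[x]w2E {1}[y]w2E uv.
exists (\sum_(x : word N 2) \sum_(y : word N 2) (v (x ord0) (x ord_max) * u (y ord0) (y ord_max)) *: ent P x y).
apply: opP => s w; rewrite -mulrA !entM [RHS](bigD1 w) //= [X in _ + X]big1 ?addr0; last first.
  by move=> x /negbTE xw; rewrite [ent _%:M _ _]mxE (inj_eq enum_rank_inj) xw mulr0.
rewrite [ent _%:M _ _]mxE eqxx mulr1n mulr_sumr; apply: eq_bigr => x _.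
rewrite entM !mulr_sumr; apply: eq_bigr => y _.
rewrite !uvw !mulr_algl mulr_algr !scalerA; congr (_ *: _); ring.
Qed.

Hypothesis n_ge2 : (2 < n)%N.

Let P := Mbar_prod F M 1 2.

Lemma front_M12 : front P = Mb t MM 1 * Mb t MM 2.
Proof.
rewrite /P front_Mbar_prod //; last lia.
by rewrite /PM big_ltn // big_ltn // big_geq // mulr1.
Qed.

Lemma front_relM : tw_r t 1%N * (Mb t MM 1 * Mb t MM 2) = Mb t MM 1 * Mb t MM 2 * tw_r t 1%N.
Proof.
rewrite -front_M12; apply/eqP; rewrite -subr_eq0; apply/eqP.
have := congr1 (fun X : op A N 2 => front X) relM.
rewrite at_factor0 => <-.
by rewrite /qm_relator at_factorD at_factorN !at_factorM //; lia.
Qed.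

(** M_1 M_2 commutes with K, so that M_1 M_2 K is proportional to K M_1 M_2 K and,
by [kMk], to K times an element of the algebra.  The trace over both factors
identifies this element as g. *)
Lemma front_qm_g : let G : H := (qm_g q mu R F M)%:M in
  Mb t MM 1 * Mb t MM 2 * tw_k t 1%N = (mu^-1 * mu^-1) *: (tw_k t 1%N * G).
Proof.
have PE := front_M12; have rP := front_relM; rewrite -PE in rP.
have g1 : bmw_gen mu lam (tw_r t 1%N) (tw_k t 1%N) by apply: (fam_gen (tw_fam t)); lia.
have kP : GRing.comm (front P) (tw_k t 1%N).
  exact: (k_intertwine lam0 g1 g1 (esym rP)).
have kk := bmw_kkE (erefl lam) mu0 lam0 g1.
have [c cE] := kMk P.
have kPk : tw_k t 1%N * front P * tw_k t 1%N = tw_k t 1%N * c%:M.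
  have := congr1 (fun X : op A N 2 => front X) cE.
  have n2 : (1.-1 + 2 <= n.+1)%N by lia.
  by rewrite !(at_factorM _ _ n2) front_scalar => e; exact: e.
have l0 : loop_val q mu lam != 0 by apply: bmw_loop0 bmwR.
pose G : H := (mu * mu / loop_val q mu lam) *: (c%:M : H).
have SG : tw_S t 0 G.
  apply: tw_SZ => _; exists c%:M; by rewrite front_scalar.
have PkG : front P * tw_k t 1%N = (mu^-1 * mu^-1) *: (tw_k t 1%N * G).
  rewrite /G -scalerAr scalerA -kPk -kP -[_ * _ * tw_k t 1%N]mulrA kk -scalerAr scalerA.
  rewrite [X in X *: _](_ : _ = 1) ?scale1r //.
  by field; rewrite mu0 l0.
rewrite /= -PE PkG; congr (_ *: (_ * _)).
have tr : trs t 0 2 (front P * tw_k t 1%N) = loop_val q mu lam *: G.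
  rewrite PkG trsZ (trs_modr mu0 lam0) //; [|lia|by apply: tw_Sk; lia].
  have -> : trs t 0 2 (tw_k t 1%N) = (mu * mu * loop_val q mu lam) *: 1.
    rewrite /trs (T_k t mu0 lam0) //; last lia.
    by rewrite tw_TZ (T_1 t (erefl lam) mu0 lam0) ?scalerA ?mulrA //; lia.
  rewrite -scalerAl mul1r scalerA; congr (_ *: _); by field; rewrite mu0.
have coef : mu * lam / ((q - mu) * (q^-1 + mu)) = (loop_val q mu lam)^-1.
  by rewrite /loop_val invf_div.
rewrite /qm_g coef scalarZ -[LHS]scale1r -(mulVf l0) -scalerA -tr; congr (_ *: _).
have -> : front P * tw_k t 1%N = front (P * extend_scalars A K).
  rewrite at_factorM //; lia.
by rewrite front_Rtrace_all //; lia.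
Qed.

End Comparison.

Lemma rscaleE (N : nat) (A : pzRingType) n (X : op A N n) x : rscale X x = X * x%:M.
Proof.
apply: opP => s t; rewrite entM (bigD1 t) //= big1 ?addr0.
  by rewrite /ent !mxE eqxx mulr1n.
by move=> w /negbTE h; rewrite [ent _%:M _ _]mxE (inj_eq enum_rank_inj) h mulr0.
Qed.

Lemma scale_in_alg (C : fieldType) (A : algType C) (N n : nat) c (X : op A N n) :
  c%:A *: X = oscale c X.
Proof. by apply: opP => s t; rewrite ent_oscale /ent mxE mulr_algl. Qed.

Section SpCayleyHamilton.
Variables (C : fieldType) (A : algType C) (N' : nat) (q mu : C).
Local Notation N := N'.+1.
Variables R F : op C N 2.
Variable M : op A N 1.
Variable ht : nat.
Hypothesis spR : Sp_type q mu R ht.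
Hypothesis RF : compatible R F.
Hypothesis relM : qm_relator R F M = 0.

(** The relations of the generators are the only property of M that is used, so M
may be any matrix over any algebra. *)
Lemma cayley_hamilton_matrix :
  \sum_(i < (2 * ht).+1) (((- q) ^+ i)%:A : A) *:
      rscale (star_pow R F M (2 * ht - i)) (qm_eps q mu R F M ht i) = 0.
Proof.
have [ht2 skewR bmwR muE [qnum0 mun0 _ height]] := spR.
pose n := (2 * ht + 10)%N.
pose t := op_tower A bmwR skewR RF n.
have mu0 := bmw_mu0 bmwR; have lam0 := bmw_lam0 bmwR; have q0 := bmw_q0 bmwR.
pose MM : tens A N' n := at_factor n M 1.
have SM : tw_S t 1 MM by move=> _; exists M.
pose G : tens A N' n := (qm_g q mu R F M)%:M.
have SG : tw_S t 0 G by move=> _; exists (qm_g q mu R F M)%:M; rewrite front_scalar.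
have relG : Mb t MM 1 * Mb t MM 2 * tw_k t 1%N = (mu^-1 * mu^-1) *: (tw_k t 1%N * G).
  by apply: front_qm_g => //; lia.
have relR : tw_r t 1%N * (Mb t MM 1 * Mb t MM 2) = Mb t MM 1 * Mb t MM 2 * tw_r t 1%N.
  by apply: front_relM => //; lia.
have mun0' i : (1 <= i <= ht)%N -> mu + q * q ^- (2 * i) != 0.
  move=> /mun0; rewrite -addr_eq0; congr (_ + _ != 0).
  by rewrite expfzDr // expr1z -exprnN.
have mu_ht : q + mu * q ^+ (2 * ht) = q - q^-1.
  congr (_ + _); rewrite muE expfzDr // -exprnN mulNr -mulrA mulVf ?mulr1 //.
  by rewrite expf_neq0.
have hh : asy q mu (q - q^-1) (tw_r t) (tw_k t) ht.-1 ht *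
  Rm q mu (q - q^-1) (tw_r t (ht.-1 + ht)%N) (tw_k t (ht.-1 + ht)%N) (q ^- (2 * ht)) *
  asy q mu (q - q^-1) (tw_r t) (tw_k t) ht.-1 ht = 0.
  rewrite -(@place_antisym C A N' q mu R F bmwR skewR RF n ht); [|lia|lia].
  have pk (X : op C N 2) : place A n ht.-1.+1 (at_factor ht X ht) = place A n (ht.-1 + ht) X.
    by rewrite place_at //; lia.
  have := congr1 (fun Y => place A n ht.-1.+1 Y) height.
  rewrite place0 !placeM; try lia.
  by rewrite /Rminus !placeD !placeZ place1 !pk.
have qaE i : (i < n.+1)%N -> qa q t MM i = (qm_a q mu R F M i)%:M by move=> ii; rewrite front_qm_a.
have epsE i : (i <= 2 * ht)%N -> eps ht (qa q t MM) G i = (qm_eps q mu R F M ht i)%:M.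
  have lowE j : (j <= ht)%N -> eps_low (qa q t MM) G j = (qm_eps_low q mu R F M j)%:M.
    move=> jh; rewrite /eps_low /qm_eps_low raddf_sum; apply: eq_bigr => l _ /=.
    by rewrite qaE ?scalarM ?scalarX //; lia.
  move=> ih; rewrite /eps /qm_eps; case: leqP => ih'; first exact: lowE.
  by rewrite lowE ?scalarM ?scalarX //; lia.
have n1 : (1 <= n.+1)%N by [].
apply: (at_factor_inj n1); rewrite at_factor0 at_factor_sum.
rewrite -[RHS](tower_cayley_hamilton SM SG relR relG _ mu0 lam0 q0 (bmw_loop0 bmwR) qnum0 mun0' _ _ hh mu_ht) //; last lia.
apply: eq_bigr => i _; rewrite scale_in_alg -tensZ rscaleE at_factorM // front_scalar.
rewrite (front_star_pow M bmwR skewR RF); last lia.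
by rewrite epsE // -ltnS.
Qed.

End SpCayleyHamilton.

Local Open Scope complex_scope.

Theorem theorem5 (K : realType) (N k : nat) (q mu : K[i]) (R F : op K[i] N 2)
    (hRF : Sp_type_QMA q mu R F k) :
  let A := QMA R F in
  let M : op A N 1 := QMA_mat R F in
  \sum_(i < (2 * k).+1)
    (((- q) ^+ i)%:A : A) *:
      rscale (star_pow R F M (2 * k - i)) (qm_eps q mu R F M k i) = 0.
Proof.
move=> A M; case: N R F hRF @A @M => [|N'] R F hRF A M.
  (* There are no letters, hence no words of length 1. *)
  by apply/matrixP => i; case: (enum_val i ord0).
have [RF spR _] := hRF.
exact: cayley_hamilton_matrix spR RF (QMA_relation R F).
Qed.
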